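(* Let $k\ge1$, $D=(d_1,\dots,d_{k+1})\in\mathbb Z_{\ge0}^{k+1}$ with $d_1=0$, $d_{k+1}\le1$ and $d_2+\cdots+d_{k+1}\ge2$. Let $2\le l\le k$ with $d_i=0$ for all $i<l$, and let $l_1=\min\{i:i>l,\ d_i\ne0\}$ (when it exists). The following isomorphisms of $\widehat{\mathfrak{sl}}_2$-modules hold. a) Suppose $d_l\ge2$. Let $D'$ be given by $d'_l=d_l-2$, $d'_i=d_i$ for $i\neq l$, and let $D''$ be given by $d''_{l-1}=d_{l-1}+1$, $d''_l=d_l-2$, $d''_{l+1}=d_{l+1}+1$, $d''_i=d_i$ otherwise, except that if $l=k$ then $d''_{k+1}=(d_{k+1}+1)\bmod 2$. Then $L^D\cong L^{D'}\oplus L^{D''}$. Suppose now $d_l=1$, and let $D'$ be obtained from $D$ by decreasing $d_l$ by $1$, decreasing $d_{l_1}$ by $1$ and increasing $d_{l_1-l+1}$ by $1$. b$_1$) If $l_1\ne k+1$, let $D''$ be given by $d''_{l-1}=d_{l-1}+1$, $d''_l=0$, $d''_{l_1}=d_{l_1}-1$, $d''_{l_1+1}=d_{l_1+1}+1$, $d''_i=d_i$ otherwise, except that if $l_1=k$ then $d''_{k+1}=(d_{k+1}+1)\bmod2$. Then $L^D\cong L^{D'}\oplus L^{D''}$. b$_2$) If $l_1=k+1$, then $L^D\cong L^{D'}$.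
   Context: $\widehat{\mathfrak{sl}}_2=\mathfrak{sl}_2\otimes\mathbb C[z,z^{-1}]\oplus\mathbb Cc$, $x_i=x\otimes z^i$, $c$ central, $[x_i,y_j]=[x,y]_{i+j}-i\delta_{i+j,0}(x,y)c$, $(x,y)=\mathrm{tr}(xy)$; $e,f,h$ is the standard basis of $\mathfrak{sl}_2$. The fermionic space $F$: let $\psi(i),\phi(i)$, $i\in\mathbb Z$, be mutually anticommuting variables with zero squares. $F$ has basis the semi-infinite monomials $\dots\psi(N-1)\phi(N-1)\psi(N)\phi(N)\,\psi(i_1)\cdots\psi(i_s)\,\phi(j_1)\cdots\phi(j_t)$, $N<i_1<\dots<i_s$, $N<j_1<\dots<j_t$. $\psi(i),\phi(i)$ act by right multiplication, $\psi^*(i),\phi^*(i)$ by (right) differentiation with respect to $\psi(-i),\phi(-i)$, so $[\psi^*(i),\psi(j)]_+=[\phi^*(i),\phi(j)]_+=\delta_{i+j,0}$ and all other anticommutators vanish. $\widehat{\mathfrak{sl}}_2$ acts on $F$ with $c=1$ by $e(z)=\sum_ie_iz^i=\psi(z)\phi(z)$, $f(z)=\sum_if_iz^i=\phi^*(z)\psi^*(z)$ (where $a(z)=\sum_ia(i)z^i$), with $h_i$ determined by the commutation relations. $F^{\otimes k}$ is then a level $k$ module. Put $v(2N)=\dots\psi(N-1)\phi(N-1)\psi(N)$, $v(2N+1)=\dots\psi(N-1)\phi(N-1)\psi(N)\phi(N)$. Definition of $L^D$ for $D\in\mathbb Z_{\ge0}^{k+1}$, $d_{k+1}\in\{0,1\}$: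 let $n=d_1+\cdots+d_{k+1}$ and $\beta_i=d_{i+1}+\cdots+d_{k+1}$, $i=1,\dots,k$. For $s\ge1$ put $$w_s=v(-\beta_1-2s)\otimes\cdots\otimes v(-\beta_k-2s),\qquad M_s=\mathbb C[e_{-(n+2s)+1},\dots,e_{-1},e_0]\,w_s\subset F^{\otimes k}.$$ These form an increasing chain and $L^D=\bigcup_{s\ge1}M_s$, which is an (integrable) $\widehat{\mathfrak{sl}}_2$-submodule of $F^{\otimes k}$. *)

(* Defs.v *)
From HB Require Import structures.
From mathcomp Require Import all_boot all_order all_algebra finmap.
From mathcomp Require Import boolp classical_sets functions cardinality fsbigop.
From mathcomp Require Import reals complex monalg zify.

Set Implicit Arguments.
Unset Strict Implicit.
Unset Printing Implicit Defensive.

Import Order.TTheory GRing.Theory Num.Theory.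

Local Open Scope ring_scope.

(* Free vector spaces: [{malg K[T]}] is the space of finite formal            *)
(* K-combinations of elements of T; [<< t >>] is the basis vector t.          *)
Definition lin_ext (K : fieldType) (T : choiceType) (V : lmodType K)
  (g : T -> V) (u : {malg K[T]}) : V := \sum_(t <- msupp u) u@_t *: g t.

Variant sl2_basis := sl2_e | sl2_f | sl2_h.

Definition sl2_basis_code (x : sl2_basis) : option bool :=
  match x with sl2_e => Some true | sl2_f => Some false | sl2_h => None end.
Definition sl2_basis_decode (o : option bool) : sl2_basis :=
  match o with Some true => sl2_e | Some false => sl2_f | None => sl2_h end.
Lemma sl2_basis_codeK : cancel sl2_basis_code sl2_basis_decode.
Proof. by case. Qed.
HB.instance Definition _ := Equality.copy sl2_basis (can_type sl2_basis_codeK).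
HB.instance Definition _ := Choice.copy sl2_basis (can_type sl2_basis_codeK).

Section AffineLieAlgebra.
Variable K : fieldType.

Definition sl2_mx (x : sl2_basis) : 'M[K]_2 :=
  match x with
  | sl2_e => delta_mx 0 1
  | sl2_f => delta_mx 1 0
  | sl2_h => delta_mx 0 0 - delta_mx 1 1
  end.

(* The basis of the affine algebra: [Some (x, i)] is x_i = x (x) z^i and      *)
(* [None] is the central element c.                                           *)
Definition sl2hat := {malg K[option (sl2_basis * int)]}.

(* A (x) z^i for a traceless matrix A, expanded in the basis e, f, h *)
Definition loop (A : 'M[K]_2) (i : int) : sl2hat :=
  A 0 1 *: << Some (sl2_e, i) >> + A 1 0 *: << Some (sl2_f, i) >>
  + A 0 0 *: << Some (sl2_h, i) >>.

Definition bracket_basis (a b : option (sl2_basis * int)) : sl2hat :=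
  match a, b with
  | Some (x, i), Some (y, j) =>
      let X := sl2_mx x in let Y := sl2_mx y in
      loop (X *m Y - Y *m X) (i + j)
      - ((if i + j == 0 then i%:~R else 0) * \tr (X *m Y)) *: << None >>
  | _, _ => 0
  end.

Definition bracket (x y : sl2hat) : sl2hat :=
  lin_ext (fun a => lin_ext (bracket_basis a) y) x.

(* A subset [mcarrier] of a vector space, with operators by which the         *)
(* elements of sl2hat act; [is_module] says that this is a module.            *)
Record premodule := Premodule {
  mspace : lmodType K;
  maction : sl2hat -> mspace -> mspace;
  mcarrier : set mspace
}.
Arguments mcarrier : clear implicits.

Record is_module (M : premodule) : Prop := IsModule {
  module0 : mcarrier M 0;
  module_lin : forall (a : K) (u v : mspace M),
    mcarrier M u -> mcarrier M v -> mcarrier M (a *: u + v);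
  module_act : forall (x : sl2hat) (u : mspace M),
    mcarrier M u -> mcarrier M (maction x u);
  module_linr : forall (x : sl2hat) (a : K) (u v : mspace M),
    mcarrier M u -> mcarrier M v ->
    maction x (a *: u + v) = a *: maction x u + maction x v;
  module_linl : forall (x y : sl2hat) (a : K) (u : mspace M),
    mcarrier M u -> maction (a *: x + y) u = a *: maction x u + maction y u;
  module_bracket : forall (x y : sl2hat) (u : mspace M),
    mcarrier M u ->
    maction (bracket x y) u
    = maction x (maction y u) - maction y (maction x u)
}.

Definition dsum (M N : premodule) : premodule :=
  @Premodule (mspace M * mspace N)%type
    (fun x p => (maction x p.1, maction x p.2))
    [set p | mcarrier M p.1 /\ mcarrier N p.2]%classic.

Definition module_iso (M N : premodule) : Prop :=
  [/\ is_module M, is_module N &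
    exists phi : mspace M -> mspace N,
      [/\ set_bij (mcarrier M) (mcarrier N) phi,
          forall (a : K) (u v : mspace M), mcarrier M u -> mcarrier M v ->
            phi (a *: u + v) = a *: phi u + phi v
        & forall (x : sl2hat) (u : mspace M), mcarrier M u ->
            phi (maction x u) = maction x (phi u)]].

End AffineLieAlgebra.

(* The variables are ordered                                                  *)
(*   ... < psi(N-1) < phi(N-1) < psi(N) < phi(N) < psi(N+1) < ...             *)
(* and numbered by their position: psi(i) is 2i and phi(i) is 2i+1.  A        *)
(* semi-infinite monomial is, up to sign, the increasing product of a set of  *)
(* variables containing all p << 0 and no p >> 0; it is encoded by the finite *)
(* symmetric difference of this set with {p | p < 0}.  The basis of F formed  *)
(* by the increasing products differs from the one with all psi's written     *)
(* before the phi's only by signs, and both contain the v(m).                 *)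
Definition semimon := {fset int}.

Definition occ (X : semimon) (p : int) : bool := (p < 0) (+) (p \in X).

Definition toggle (X : semimon) (p : int) : semimon :=
  if p \in X then (X `\ p)%fset else (p |` X)%fset.

Definition nright (X : semimon) (p : int) : nat :=
  #|` fset_set [set q : int | occ X q /\ p < q]%classic|.

Definition vmon (m : int) : semimon :=
  fset_set [set p : int | (p < 0) (+) (p <= m)]%classic.

Lemma finite_int_itv (a b : int) :
  finite_set [set i : int | a <= i /\ i <= b]%classic.
Proof.
apply: (@sub_finite_set _ _
  ((fun m : nat => a + m%:Z) @` `I_(`|b - a|%N.+1))%classic).
  move=> i /= [ai ib]; exists `|i - a|%N => /=; lia.
exact/finite_image/finite_II.
Qed.

Lemma finite_nright (X : semimon) (p : int) :
  finite_set [set q : int | occ X q /\ p < q]%classic.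
Proof.
apply: (@sub_finite_set _ _
  ([set` X] `|` [set q | p <= q /\ q <= 0])%classic).
  move=> q /= [+ pq]; rewrite /occ; case: (boolP (q \in X)); first by left.
  by rewrite addbF => _ q0; right; split; lia.
by rewrite finite_setU; split; [exact: finite_fset | exact: finite_int_itv].
Qed.

Lemma occ_vmon (m p : int) : occ (vmon m) p = (p <= m).
Proof.
rewrite /occ /vmon in_fset_set; last first.
  apply: (@sub_finite_set _ _
    ([set q | 0 <= q /\ q <= m] `|` [set q | m <= q /\ q <= 0])%classic).
    by move=> q /=; case: (ltP q 0); case: (leP q m) => //= ? ? _;
      [right | left]; lia.
  by rewrite finite_setU; split; exact: finite_int_itv.
have -> : (p \in [set q : int | (q < 0) (+) (q <= m)]%classic)
    = (p < 0) (+) (p <= m) by apply/idP/idP; rewrite inE.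
by rewrite addKb.
Qed.

Lemma occ_toggle (X : semimon) (p q : int) :
  occ (toggle X p) q = (q == p) (+) occ X q.
Proof.
rewrite /occ /toggle; case: ifP => pX; rewrite !inE;
  by case: eqP => [->|_]; rewrite ?pX /= ?addbF ?addbT //; case: (p < 0).
Qed.

Section FermionicSpace.
Variable K : fieldType.

Definition Fock := {malg K[semimon]}.

(* right multiplication by the variable at position p *)
Definition rmul_var (p : int) : Fock -> Fock := lin_ext (fun X =>
  if occ X p then 0 else (-1) ^+ nright X p *: << toggle X p >>).

(* right differentiation with respect to the variable at position p *)
Definition rder_var (p : int) : Fock -> Fock := lin_ext (fun X =>
  if occ X p then (-1) ^+ nright X p *: << toggle X p >> else 0).

Definition psi (i : int) : Fock -> Fock := rmul_var (i *+ 2).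
Definition phi (i : int) : Fock -> Fock := rmul_var (i *+ 2 + 1).
Definition psi' (i : int) : Fock -> Fock := rder_var ((- i) *+ 2).
Definition phi' (i : int) : Fock -> Fock := rder_var ((- i) *+ 2 + 1).

(* All but finitely many terms vanish: finite_e_mode, finite_f_mode below. *)
Definition e_mode (n : int) (u : Fock) : Fock :=
  \sum_(i \in [set: int]) psi i (phi (n - i) u).
Definition f_mode (n : int) (u : Fock) : Fock :=
  \sum_(i \in [set: int]) phi' i (psi' (n - i) u).
(* from [e_n, f_0] = h_n - n delta_(n,0) c = h_n *)
Definition h_mode (n : int) (u : Fock) : Fock :=
  e_mode n (f_mode 0 u) - f_mode 0 (e_mode n u).

Definition Fock_act (b : option (sl2_basis * int)) (u : Fock) : Fock :=
  match b with
  | Some (sl2_e, i) => e_mode i u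
  | Some (sl2_f, i) => f_mode i u
  | Some (sl2_h, i) => h_mode i u
  | None => u
  end.

Section TensorPower.
Variable k : nat.

(* The k-th tensor power of F: the basis vector << t >> is                    *)
(* << t 0 >> (x) ... (x) << t (k-1) >>.                                       *)
Definition FockT := {malg K[{ffun 'I_k -> semimon}]}.

(* << t 0 >> (x) ... (x) v (x) ... (x) << t (k-1) >>, with v at place a *)
Definition put (t : {ffun 'I_k -> semimon}) (a : 'I_k) : Fock -> FockT :=
  lin_ext (fun X => << [ffun b => if b == a then X else t b] >>).

(* sum over a of 1 (x) ... (x) T (x) ... (x) 1, with T at place a *)
Definition coproduct (T : Fock -> Fock) : FockT -> FockT :=
  lin_ext (fun t => \sum_(a < k) put t a (T << t a >>)).

Definition FockT_act (x : sl2hat K) (u : FockT) : FockT :=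
  lin_ext (fun b => coproduct (Fock_act b) u) x.

Definition e_act (i : int) : FockT -> FockT :=
  FockT_act << Some (sl2_e, i) >>.

(* d_1, ..., d_(k+1) *)
Definition entry (D : k.+1.-tuple nat) (i : nat) : nat := nth 0%N D i.-1.

Definition total (D : k.+1.-tuple nat) : nat :=
  (\sum_(1 <= j < k.+2) entry D j)%N.

Definition beta (D : k.+1.-tuple nat) (i : nat) : nat :=
  (\sum_(i.+1 <= j < k.+2) entry D j)%N.

Definition wvec (D : k.+1.-tuple nat) (s : nat) : FockT :=
  << [ffun a : 'I_k => vmon (- (beta D a.+1)%:Z - (s *+ 2)%:Z)] >>.

(* A polynomial in e_0, e_(-1), ..., e_(-(n+2s)+1) is given by a list of      *)
(* terms (coefficient, factors), where the factor j < n+2s stands for e_(-j). *)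
Definition Mspace (D : k.+1.-tuple nat) (s : nat) : set FockT :=
  [set u | exists P : seq (K * seq 'I_(total D + 2 * s)),
     u = \sum_(m <- P)
           m.1 *: foldr (fun j : 'I_(total D + 2 * s) => e_act (- (j : nat)%:Z)) (wvec D s) m.2]%classic.

Definition LD (D : k.+1.-tuple nat) : premodule K :=
  @Premodule K FockT FockT_act
    [set u | exists2 s : nat, (0 < s)%N & Mspace D s u]%classic.

Definition of_entries (d : nat -> nat) : k.+1.-tuple nat :=
  [tuple d i.+1 | i < k.+1].

Definition Da' (D : k.+1.-tuple nat) (l : nat) : k.+1.-tuple nat :=
  of_entries (fun i => if i == l then entry D l - 2 else entry D i)%N.

(* The entry d_(j+1) + 1, taken modulo 2 when j + 1 = k + 1 *)
Definition succ_entry (D : k.+1.-tuple nat) (j : nat) : nat :=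
  (if j == k then (entry D k.+1 + 1) %% 2 else entry D j.+1 + 1)%N.

Definition Da'' (D : k.+1.-tuple nat) (l : nat) : k.+1.-tuple nat :=
  of_entries (fun i =>
    if i == l.-1 then entry D l.-1 + 1
    else if i == l then entry D l - 2
    else if i == l.+1 then succ_entry D l
    else entry D i)%N.

Definition Db' (D : k.+1.-tuple nat) (l l1 : nat) : k.+1.-tuple nat :=
  of_entries (fun i =>
    entry D i - (i == l) - (i == l1) + (i == l1 - l + 1))%N.

Definition Db'' (D : k.+1.-tuple nat) (l l1 : nat) : k.+1.-tuple nat :=
  of_entries (fun i =>
    if i == l.-1 then entry D l.-1 + 1
    else if i == l then 0
    else if i == l1 then entry D l1 - 1
    else if i == l1.+1 then succ_entry D l1
    else entry D i)%N.

End TensorPower.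
End FermionicSpace.

Definition all_supp (K : fieldType) (A : pred semimon) (u : Fock K) : Prop :=
  forall X, X \in msupp u -> A X.

Lemma all_supp_lin_ext (K : fieldType) (A : pred semimon)
    (g : semimon -> Fock K) (u : Fock K) :
  (forall X, X \in msupp u -> all_supp A (g X)) -> all_supp A (lin_ext g u).
Proof.
move=> gA Y; apply: contraLR => nAY.
rewrite -mcoeff_eq0 /lin_ext raddf_sum /= big_seq big1 // => X Xu.
have /eqP gY : (g X)@_Y == 0.
  by rewrite mcoeff_eq0; apply: contra nAY; exact: gA.
by rewrite mcoeffZ gY mulr0.
Qed.

Lemma lin_ext_eq0 (K : fieldType) (g : semimon -> Fock K) (u : Fock K) :
  (forall X, X \in msupp u -> g X = 0) -> lin_ext g u = 0.
Proof.
by move=> g0; rewrite /lin_ext big_seq big1 // => X Xu; rewrite g0 // scaler0.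
Qed.

Lemma all_supp_basis (K : fieldType) (A : pred semimon) (c : K) X :
  A X -> all_supp A (c *: << X >> : Fock K).
Proof.
move=> AX Y; apply: contraLR => nAY; rewrite -mcoeff_eq0 mcoeffZ mcoeffU.
by have [XY|_] := eqVneq X Y; [rewrite -XY AX in nAY | rewrite mulr0].
Qed.

Lemma all_supp0 (K : fieldType) (A : pred semimon) : all_supp A (0 : Fock K).
Proof. by move=> X; rewrite -mcoeff_neq0 mcoeff0 eqxx. Qed.

Lemma bounded_supp (K : fieldType) (u : Fock K) :
  exists B : nat, forall X, X \in msupp u -> forall p : int,
    (p < - B%:Z -> occ X p) /\ (B%:Z < p -> ~~ occ X p).
Proof.
exists (\max_(X <- msupp u) \max_(p <- (X : {fset int})) `|p|%N)%N.
move=> X Xu p; set B := (\max_(X <- _) _)%N.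
have XB : p \in X -> (`|p|%N <= B)%N.
  move=> pX; apply: (@leq_trans (\max_(q <- (X : {fset int})) `|q|%N)%N).
    exact: (leq_bigmax_seq p).
  exact: (leq_bigmax_seq X Xu).
rewrite /occ; case: (boolP (p \in X)) => [/XB pB|_]; last by split; lia.
by split; lia.
Qed.

Lemma finite_e_mode (K : fieldType) (n : int) (u : Fock K) :
  finite_set [set i : int | psi i (phi (n - i) u) <> 0]%classic.
Proof.
have [B Bu] := bounded_supp u.
apply: (sub_finite_set _
  (finite_int_itv (- (B%:Z + `|n|%:Z + 1)) (B%:Z + `|n|%:Z + 1))).
move=> i /= nz; split; rewrite leNgt; apply/negP => hi; apply: nz.
  apply: lin_ext_eq0 => Y; suff H : all_supp (fun Y => occ Y (i *+ 2))
      (phi (n - i) u) by move=> /H ->.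
  apply: all_supp_lin_ext => X Xu; case: ifP => [_|no]; first exact: all_supp0.
  apply: all_supp_basis; rewrite occ_toggle.
  have [oX _] := Bu X Xu (i *+ 2).
  have oi : occ X (i *+ 2) by apply: oX; lia.
  by rewrite oi addbT; apply/eqP => E; rewrite -E oi in no.
have -> : phi (n - i) u = 0.
  apply: lin_ext_eq0 => X Xu.
  have [oX _] := Bu X Xu ((n - i) *+ 2 + 1).
  by rewrite oX //; lia.
apply: lin_ext_eq0 => X; rewrite -mcoeff_neq0 mcoeff0 eqxx //.
Qed.

Lemma finite_f_mode (K : fieldType) (n : int) (u : Fock K) :
  finite_set [set i : int | phi' i (psi' (n - i) u) <> 0]%classic.
Proof.
have [B Bu] := bounded_supp u.
apply: (sub_finite_set _
  (finite_int_itv (- (B%:Z + `|n|%:Z + 1)) (B%:Z + `|n|%:Z + 1))).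
move=> i /= nz; split; rewrite leNgt; apply/negP => hi; apply: nz.
  apply: lin_ext_eq0 => Y; suff H : all_supp (fun Y => ~~ occ Y ((- i) *+ 2 + 1))
      (psi' (n - i) u) by move=> /H /negbTE ->.
  apply: all_supp_lin_ext => X Xu; case: ifP => [no|_]; last exact: all_supp0.
  apply: all_supp_basis; rewrite occ_toggle.
  have [_ oX] := Bu X Xu ((- i) *+ 2 + 1).
  have /negbTE oi : ~~ occ X ((- i) *+ 2 + 1) by apply: oX; lia.
  by rewrite oi addbF; apply/eqP => E; rewrite -E oi in no.
have -> : psi' (n - i) u = 0.
  apply: lin_ext_eq0 => X Xu.
  have [_ oX] := Bu X Xu ((- (n - i)) *+ 2).
  by rewrite (negbTE (oX _)) //; lia.
apply: lin_ext_eq0 => X; rewrite -mcoeff_neq0 mcoeff0 eqxx //.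
Qed.

(* Main.v *)
(** Write c_a = beta_1 - beta_(a+1), a nondecreasing sequence, and let the
    polynomial ring in the modes of e(z) act on F^(x)k.  Then e(z)^i w_s has no
    terms below degree c_0 + ... + c_(i-1), and e(z)^(k+1) w_s = 0.  These
    relations generate the annihilator of w_s: the leading coefficient of
    e(z)^i maps w_s to the vector of the sequence with c_0, ..., c_(i-1) raised
    by 2, and the fermions, which commute with e(z), raise a single entry, so
    one can induct on i, on the degree of a polynomial and on c_(i-1).
    The modules L^D are unions of cyclic modules over this ring, because the
    top coefficients of e(z)^k and e(z)^(k+1) express w_s through w_(s+1).

    Let a be the number of zeros in c and suppose that some entry c_b >= 2
    is preceded by ones only.  Adding e_top^a to the relations of c gives those
    of c'', obtained by raising c_(a-1) and lowering c_b by 1.  So w_s |-> w''_s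
    defines a surjection of L^D onto L^(D''), and its kernel is generated by
    the vectors e_top^a w_s, which up to a permutation of the tensor factors
    are those of L^(D').  If there is no such b, then w_s itself lies in the
    module generated by the e_top^a w_(s+1).  The surjection splits: for the
    positive definite Hermitian form with the monomials as orthonormal basis,
    e_n and f_(-n) are adjoint, and the kernel has an orthogonal complement,
    being graded by the energy with finite dimensional pieces. *)

From HB Require Import structures.
Require Import Defs.
From mathcomp Require Import all_boot all_order all_algebra fingroup perm finmap.
From mathcomp Require Import boolp classical_sets functions cardinality fsbigop.
From mathcomp Require Import reals complex monalg zify ring.

Set Implicit Arguments.
Unset Strict Implicit.
Unset Printing Implicit Defensive.

Import Order.TTheory GRing.Theory Num.Theory.

Local Open Scope ring_scope.

(** The number 2 that recurs throughout is the charge of e(z): e_(m+1) sends v(m) to plus or minus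
    v(m+2). Three obstacles shape the proof. The annihilator of w_s has no evident generators. It is
    reached by sending the tail of the sequence to infinity, and the divisibility that drives the
    induction (multiplying by the leading coefficient of e(z)^kap raises the order of e(z)^i by 2i)
    comes from Taylor's formula in characteristic 0. Next, passing from w_(s+1) to w_s costs a
    scalar that depends on the sequence, so w_s |-> w''_s respects the two chains only after
    rescaling. The homomorphism is therefore handled as a graph generated by pairs, to which the
    results on chains apply again. Finally, stability under f_j is not visible on a single cyclic
    module: a vector must be rewritten with very negative modes e_l at a large s, so that f_j kills
    w_s and no central term appears. A chain sees its starting point only up to even shifts, whence
    d_(k+1) modulo 2. *)

Section LinearFun.
Variables (K : fieldType) (U V : lmodType K).

Lemma lin0 (f : U -> V) : linear f -> f 0 = 0.
Proof. by move=> lf; move: (lf (-1) 0 0); rewrite scaler0 addr0 scaleN1r addNr. Qed.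

Lemma linD (f : U -> V) : linear f -> {morph f : x y / x + y}.
Proof. by move=> lf x y; rewrite -[x]scale1r lf !scale1r. Qed.

Lemma linZ (f : U -> V) : linear f -> forall a, {morph f : x / a *: x}.
Proof. by move=> lf a x; rewrite -[a *: x]addr0 lf lin0 // addr0. Qed.

Lemma linN (f : U -> V) : linear f -> {morph f : x / - x}.
Proof. by move=> lf x; rewrite -scaleN1r linZ // scaleN1r. Qed.

Lemma linB (f : U -> V) : linear f -> {morph f : x y / x - y}.
Proof. by move=> lf x y; rewrite linD // linN. Qed.

Lemma lin_sum (f : U -> V) : linear f -> forall (I : Type) (r : seq I) (P : pred I) F,
  f (\sum_(i <- r | P i) F i) = \sum_(i <- r | P i) f (F i).
Proof.
by move=> lf I r P F; apply: (big_morph f); [exact: linD | exact: lin0].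
Qed.

Lemma lin_comp (W : lmodType K) (f : V -> W) (g : U -> V) :
  linear f -> linear g -> linear (f \o g).
Proof. by move=> lf lg a u v /=; rewrite lg lf. Qed.

Lemma lin_scale (a : K) : linear ( *:%R a : V -> V).
Proof. by move=> b x y; rewrite scalerDr !scalerA mulrC. Qed.

End LinearFun.

Section LinExt.
Variables (K : fieldType) (T : choiceType) (V : lmodType K).
Implicit Types (g : T -> V) (u v : {malg K[T]}).

Lemma lin_extEw g u (d : {fset T}) : (msupp u `<=` d)%fset ->
  lin_ext g u = \sum_(t <- d) u@_t *: g t.
Proof.
move=> ud; rewrite /lin_ext (big_fset_incl _ ud) //= => t _ tu.
by rewrite mcoeff_outdom // scale0r.
Qed.

Lemma lin_ext_is_linear g : linear (lin_ext g).
Proof.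
move=> a u v; set d := (msupp u `|` msupp v)%fset.
have ud : (msupp u `<=` d)%fset by exact: fsubsetUl.
have vd : (msupp v `<=` d)%fset by exact: fsubsetUr.
have wd : (msupp (a *: u + v) `<=` d)%fset.
  apply: fsubset_trans (msuppD_le _ _) _; apply: fsetSU.
  exact: msuppZ_le.
rewrite !(lin_extEw _ ud, lin_extEw _ vd, lin_extEw _ wd) scaler_sumr -big_split.
by apply: eq_bigr => t _; rewrite mcoeffD mcoeffZ scalerDl scalerA.
Qed.

HB.instance Definition _ g := GRing.isLinear.Build K {malg K[T]} V _ (lin_ext g)
  (lin_ext_is_linear g).

Lemma lin_extU g t : lin_ext g << t >> = g t.
Proof. by rewrite /lin_ext msuppU oner_eq0 big_seq_fset1 mcoeffUU scale1r. Qed.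

Lemma malgEZ u : u = \sum_(t <- msupp u) u@_t *: << t >>.
Proof.
rewrite {1}(monalgE u); apply: eq_bigr => t _; apply/malgP => s.
by rewrite mcoeffZ !mcoeffU; case: eqP => _; rewrite ?mulr1 ?mulr0.
Qed.

Lemma linear_malg_ext (f g : {malg K[T]} -> V) : linear f -> linear g ->
  (forall t, f << t >> = g << t >>) -> f =1 g.
Proof.
move=> lf lg fg u.
by rewrite (malgEZ u) !lin_sum //; apply: eq_bigr => t _; rewrite !linZ // fg.
Qed.

End LinExt.

Lemma malgMUU (K : fieldType) (M : monomType) (m n : M) :
  << m >> * << n >> = << mmul m n >> :> {malg K[M]}.
Proof. by rewrite malgM_def fgmulUU mulr1. Qed.

(** * Polynomials in commuting operators *)

Section PolynomialAction.
Variables (K : fieldType) (T : choiceType) (V : lmodType K).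
Variable E : T -> V -> V.
Hypothesis linE : forall t, linear (E t).
Hypothesis commE : forall s t v, E s (E t v) = E t (E s v).

Let pw (m : T -> nat) (s : seq T) (v : V) := foldr (fun t u => iter (m t) (E t) u) v s.

Definition act_monom (m : {cmonom T}) (v : V) : V :=
  foldr (fun t u => iter (m t) (E t) u) v (finsupp m).

Definition act (P : {malg K[{cmonom T}]}) (v : V) : V :=
  lin_ext (fun m => act_monom m v) P.

Lemma iter_linear n t : linear (iter n (E t)).
Proof. by elim: n => [|n IH] a u v //=; rewrite IH linE. Qed.

Let pw_linear m s : linear (pw m s).
Proof. by elim: s => [|t s IH] a u v //=; rewrite IH iter_linear. Qed.

Let iterC s t m n v : iter m (E s) (iter n (E t) v) = iter n (E t) (iter m (E s) v).
Proof.
have C1 u : E s (iter n (E t) u) = iter n (E t) (E s u).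
  by elim: n u => //= n IHn u; rewrite commE IHn.
by elim: m v => [|m IH] v //=; rewrite IH C1.
Qed.

Let pwC m s n t v : pw m s (iter n (E t) v) = iter n (E t) (pw m s v).
Proof. by elim: s => [|u s IH] //=; rewrite IH iterC. Qed.

Let pw_perm m s1 s2 v : perm_eq s1 s2 -> pw m s1 v = pw m s2 v.
Proof.
elim: s1 s2 => [|t s1 IH] s2; first by rewrite perm_sym => /perm_nilP ->.
move=> ps; have ts2 : t \in s2 by rewrite -(perm_mem ps) mem_head.
have pr := perm_to_rem ts2.
have : perm_eq (t :: s1) (t :: rem t s2) by rewrite (perm_trans ps).
rewrite perm_cons => /IH /= ->.
elim: s2 ts2 {ps pr} => //= u s2 IHs; rewrite inE eq_sym.
by case: eqVneq => [-> //|_ /=] /IHs <-; rewrite iterC.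
Qed.

Let pw_undup m s v : pw m s v = pw m [seq t <- s | m t != 0%N] v.
Proof. by elim: s => //= t s ->; case: eqP => //= ->. Qed.

(** The operators commute, so neither the order nor extra factors of exponent 0 matter; the product
    of two monomials can then be computed on the union of their supports. *)
Lemma act_monomEw (m : {cmonom T}) (s : seq T) v :
  uniq s -> {subset finsupp m <= s} ->
  act_monom m v = foldr (fun t u => iter (m t) (E t) u) v s.
Proof.
move=> us ms; rewrite -/(pw m s v) pw_undup; apply: pw_perm.
apply: uniq_perm; rewrite ?filter_uniq ?fset_uniq // => t.
rewrite mem_filter cmE_neq0; apply/idP/andP => [tm|[]//]; split=> //.
exact: ms.
Qed.

Lemma act_monomM (m1 m2 : {cmonom T}) v :
  act_monom (mmul m1 m2) v = act_monom m1 (act_monom m2 v).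
Proof.
set s := (finsupp m1 `|` finsupp m2)%fset : seq T.
have us : uniq s by exact: fset_uniq.
rewrite (@act_monomEw _ s) //; last first.
  by move=> t; rewrite mdomD.
rewrite (@act_monomEw m1 s) //; last by move=> t; rewrite in_fsetU => ->.
rewrite (@act_monomEw m2 s) //; last by move=> t; rewrite in_fsetU orbC => ->.
elim: (s) v => //= t r IH v.
rewrite IH -!/(pw _ _ _) -pwC cmM iterD.
by rewrite -!pwC.
Qed.

Lemma act_monom1 v : act_monom mone v = v.
Proof. by rewrite /act_monom mdom1. Qed.

Lemma act_monomU t v : act_monom (ucm t) v = E t v.
Proof. by rewrite (@act_monomEw _ [:: t]) //= ?cmUU // => s; rewrite mdomU !inE. Qed.

Lemma act_monom_linear m : linear (act_monom m).
Proof. exact: pw_linear. Qed.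

Lemma act_is_linearl v : linear (act^~ v).
Proof. exact: lin_ext_is_linear. Qed.

Lemma actU m v : act << m >> v = act_monom m v.
Proof. by rewrite /act lin_extU. Qed.

Lemma act_is_linear P : linear (act P).
Proof.
move=> a u v; rewrite /act /lin_ext scaler_sumr -big_split; apply: eq_bigr => m _.
by rewrite act_monom_linear scalerDr !scalerA mulrC.
Qed.

Lemma actM P Q v : act (P * Q) v = act P (act Q v).
Proof.
move: P; apply: linear_malg_ext.
- by move=> a P P'; rewrite mulrDl -scalerAl act_is_linearl.
- exact: act_is_linearl.
move=> m; move: Q; apply: linear_malg_ext.
- by move=> a P P'; rewrite mulrDr -scalerAr act_is_linearl.
- by move=> a P P'; rewrite act_is_linearl act_is_linear.
by move=> n; rewrite malgMUU [LHS]actU [in RHS]actU actU act_monomM.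
Qed.

Lemma act1 v : act 1 v = v.
Proof. by rewrite -[1]/<< mone >> actU act_monom1. Qed.

Lemma actX t v : act << ucm t >> v = E t v.
Proof. by rewrite actU act_monomU. Qed.

End PolynomialAction.

Lemma act_comm (K : fieldType) (T : choiceType) (V W : lmodType K) (E : T -> V -> V)
    (E' : T -> W -> W) (f : V -> W) : linear f -> (forall t v, f (E t v) = E' t (f v)) ->
  forall P v, f (act E P v) = act E' P (f v).
Proof.
move=> lf fE P v; rewrite /act /lin_ext (lin_sum lf); apply: eq_bigr => m _.
rewrite (linZ lf) /act_monom; congr (_ *: _); elim: (finsupp m : seq T) => //= t s <-.
elim: (m t) (foldr _ _ _) => //= n IH u; by rewrite fE IH.
Qed.

(** * The ideals of relations *)

Section SmallPolynomials.
Variable S : comNzRingType.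
Implicit Types (J : S -> Prop) (p q : {poly S}).

Record is_ideal J : Prop := IsIdeal {
  ideal_0 : J 0;
  ideal_D : forall x y, J x -> J y -> J (x + y);
  ideal_Ml : forall a x, J x -> J (a * x)
}.

(** Vanishing to order [n] at z = 0 modulo [J]. With [J] the annihilator of a vector, it says that a
    power of the current has no terms below degree [n] on that vector. *)
Definition small J n p := forall j, (j < n)%N -> J p`_j.

Lemma is_ideal_eq0 : is_ideal (fun x => x = 0).
Proof. by split=> // [x y -> ->|a x ->]; rewrite ?addr0 ?mulr0. Qed.

Lemma is_ideal_principal (g : S) : is_ideal (fun x => exists a, x = a * g).
Proof.
split; first by exists 0; rewrite mul0r.
  by move=> _ _ [a ->] [b ->]; exists (a + b); rewrite mulrDl.
by move=> b _ [a ->]; exists (b * a); rewrite mulrA.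
Qed.

Variable J : S -> Prop.
Hypothesis idJ : is_ideal J.

Let J0 := ideal_0 idJ.
Let JD := ideal_D idJ.
Let JMl := ideal_Ml idJ.

Lemma ideal_Mr x (a : S) : J x -> J (x * a).
Proof. by rewrite mulrC; apply: JMl. Qed.

Lemma ideal_N x : J x -> J (- x).
Proof. by rewrite -mulN1r; apply: JMl. Qed.

Lemma ideal_B x y : J x -> J y -> J (x - y).
Proof. by move=> Jx Jy; apply: JD => //; apply: ideal_N. Qed.

Lemma ideal_Mn x n : J x -> J (x *+ n).
Proof. by rewrite -mulr_natl; apply: JMl. Qed.

Lemma ideal_sum (I : Type) (r : seq I) (P : pred I) (F : I -> S) :
  (forall i, P i -> J (F i)) -> J (\sum_(i <- r | P i) F i).
Proof. by move=> JF; elim/big_ind: _. Qed.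

Lemma smallW m n p : (m <= n)%N -> small J n p -> small J m p.
Proof. by move=> mn sp j jm; apply: sp; apply: leq_trans mn. Qed.

Lemma smallD n p q : small J n p -> small J n q -> small J n (p + q).
Proof. by move=> sp sq j jn; rewrite coefD; apply: JD => //; [exact: sp|exact: sq]. Qed.

Lemma smallN n p : small J n p -> small J n (- p).
Proof. by move=> sp j jn; rewrite coefN; apply/ideal_N/sp. Qed.

Lemma smallB n p q : small J n p -> small J n q -> small J n (p - q).
Proof. by move=> sp sq; apply/smallD/smallN. Qed.

Lemma smallMn n p m : small J n p -> small J n (p *+ m).
Proof. by move=> sp j jn; rewrite coefMn; apply/ideal_Mn/sp. Qed.

Lemma small_sum n (I : Type) (r : seq I) (P : pred I) (F : I -> {poly S}) :
  (forall i, P i -> small J n (F i)) -> small J n (\sum_(i <- r | P i) F i).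
Proof.
by move=> sF j jn; rewrite coef_sum; apply: ideal_sum => i Pi; apply: sF.
Qed.

Lemma smallM m n p q : small J m p -> small J n q -> small J (m + n) (p * q).
Proof.
move=> sp sq j jmn; rewrite coefM; apply: ideal_sum => i _.
have [im|mi] := ltnP i m; first exact/ideal_Mr/sp.
apply/JMl/sq; have := ltn_ord i; lia.
Qed.

Lemma small_any p : small J 0 p. Proof. by []. Qed.

Lemma smallMl n p q : small J n q -> small J n (p * q).
Proof. exact: smallM (small_any p). Qed.

Lemma smallMr n p q : small J n p -> small J n (p * q).
Proof. by rewrite mulrC; apply: smallMl. Qed.

Lemma small_Xn n : small J n 'X^n.
Proof. by move=> j jn; rewrite coefXn ltn_eqF //; apply: J0. Qed.

Lemma smallXnK n m p : small J (n + m) ('X^m * p) -> small J n p.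
Proof.
move=> sp j jn; have := sp (j + m)%N; rewrite ltn_add2r mulrC coefMXn.
by rewrite [(j + m < m)%N]ltnNge leq_addl addnK; apply.
Qed.

Lemma small_deriv n p : small J n p -> small J n.-1 p^`().
Proof. by move=> sp j jn; rewrite coef_deriv; apply/ideal_Mn/sp; lia. Qed.

(** Every term of the convolution other than the product of the two leading coefficients has a
    factor below its order, hence in [J]. *)
Lemma coefM_lead m n p q : small J m p -> small J n q ->
  J ((p * q)`_(m + n) - p`_m * q`_n).
Proof.
move=> sp sq; rewrite coefM.
have mi : (m < (m + n).+1)%N by lia.
rewrite (bigD1 (Ordinal mi)) //= addKn addrAC subrr add0r.
apply: ideal_sum => i im; have [{}im|mi'] := ltnP i m; first exact/ideal_Mr/sp.
have {}im : (i != m :> nat) by [].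
apply/JMl/sq; have := ltn_ord i; lia.
Qed.

(** The quotient by [J] has no torsion; this allows division by the integers that differentiation
    produces. *)
Hypothesis divJ : forall n x, J (x *+ n.+1) -> J x.

Lemma small_div m n p : small J m (p *+ n.+1) -> small J m p.
Proof. by move=> sp j jm; apply: (divJ (n := n)); rewrite -coefMn; apply: sp. Qed.

(* [X] and [X'] annihilate [Y] up to order [M]; differentiating, one loses two
   powers of [X], or one of [X'], for every two, or one, derivatives of [Y]. *)
Lemma small_derivn M (X Y : {poly S}) : small J M (X * Y) -> small J M (X^`() * Y) ->
  forall n a b, (n < a.*2 + b)%N -> small J (M - n) (X ^+ a * X^`() ^+ b * Y^`(n)).
Proof.
move=> XY X'Y; elim=> [|n IH] a b nab.
  rewrite subn0 derivn0; case: a nab => [|a] nab.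
    case: b nab => [//|b] _; rewrite expr0 mul1r exprSr -mulrA; exact: smallMl.
  have -> : X ^+ a.+1 * X^`() ^+ b * Y = X ^+ a * X^`() ^+ b * (X * Y).
    by rewrite exprS; ring.
  exact: smallMl.
have D : small J (M - n.+1) (X ^+ a * X^`() ^+ b * Y^`(n))^`().
  by rewrite subnS; apply/small_deriv/IH; lia.
rewrite !derivM !deriv_exp -derivnS in D.
set t3 := X ^+ a * X^`() ^+ b * Y^`(n.+1) in D *.
rewrite mulrDl -addrA in D.
set t1 := X^`() * X ^+ a.-1 *+ a * X^`() ^+ b * Y^`(n) in D.
(* By Leibniz, [D] is the sum of [t1], a term with the second derivative of [X], and [t3]. In the
   first two the weight [a.*2 + b] drops only by one, so the case [n] covers them. *)
have -> : t3 = (t1 + (X ^+ a * (X^`()^`() * X^`() ^+ b.-1 *+ b) * Y^`(n) + t3))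
   - t1 - (X ^+ a * (X^`()^`() * X^`() ^+ b.-1 *+ b) * Y^`(n)) by ring.
apply: smallB.
  apply: smallB; first exact: D.
  rewrite /t1; case: a nab {D t1 t3} => [|a] nab.
    by rewrite mulr0n !mul0r => j _; rewrite coef0; apply: J0.
  have -> : X^`() * X ^+ a.+1.-1 *+ a.+1 * X^`() ^+ b * Y^`(n)
    = (X ^+ a * X^`() ^+ b.+1 * Y^`(n)) *+ a.+1.
    by rewrite /= !mulrnAl exprS; congr (_ *+ _); ring.
  apply: smallMn; apply: smallW (IH a b.+1 _); lia.
case: b nab {D t1 t3} => [|b] nab.
  by rewrite mulr0n mulr0 mul0r => j _; rewrite coef0; apply: J0.
have -> : X ^+ a * (X^`()^`() * X^`() ^+ b.+1.-1 *+ b.+1) * Y^`(n)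
  = X^`()^`() * (X ^+ a * X^`() ^+ b * Y^`(n)) *+ b.+1.
  by rewrite /= mulrnAr mulrnAl; congr (_ *+ _); ring.
apply/smallMn/smallMl; apply: smallW (IH a b _); lia.
Qed.

(** Taylor's formula at the generic point z with increment -z. *)
Lemma taylor0 (Y : {poly S}) : (Y`_0)%:P = \sum_(n < size Y) (- 'X) ^+ n * Y^`N(n).
Proof.
have := @nderiv_taylor _ (Y^:P) 'X (- 'X) (mulrC _ _).
rewrite subrr -[Y^:P.[0]]/(Y^:P.[0%:P]) horner_map -horner_coef0 => ->.
rewrite size_map_polyC; apply: eq_bigr => n _; rewrite mulrC; congr (_ * _).
by rewrite nderivn_map -[_.['X]]/(_ \Po 'X) comp_polyXr.
Qed.

(** Modulo [J], write X^kap = z^d Y. Then X Y vanishes, and so does X' Y, since (kap+1) X' X^kap is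
    the derivative of X^(kap+1). Expand the constant term of Y by [taylor0]: the terms with n < 2i
    vanish after multiplication by X^i, by [small_derivn], and those with n >= 2i bring the factor
    z^(2i). The bound on [N] leaves room for the orders lost to differentiation. *)
Lemma small_expM_coef (N d e i kap : nat) (X : {poly S}) :
  small J N (X ^+ kap.+1) -> small J d (X ^+ kap) -> small J e (X ^+ i) ->
  (d + e + i.*2 < N)%N ->
  small J (e + i.*2) (X ^+ i * ((X ^+ kap)`_d)%:P).
Proof.
move=> sN sd se dN; set Y := drop_poly d (X ^+ kap).
have XkE : X ^+ kap = take_poly d (X ^+ kap) + 'X^d * Y.
  by rewrite [_ * Y]mulrC poly_take_drop.
have stake : small J N (take_poly d (X ^+ kap)).
  move=> j _; rewrite coef_take_poly; case: ifP => [jd|_]; first exact: sd.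
  exact: J0.
have XY : small J (N - d) (X * Y).
  apply: (@smallXnK _ d); rewrite subnK; last lia.
  have -> : 'X^d * (X * Y) = X ^+ kap.+1 - X * take_poly d (X ^+ kap).
    by rewrite exprS {1}XkE; ring.
  by apply: smallB => //; apply: smallMl.
have X'Y : small J (N - d.+1) (X^`() * Y).
  apply: (@smallXnK _ d).
  have -> : 'X^d * (X^`() * Y) = X^`() * X ^+ kap - X^`() * take_poly d (X ^+ kap).
    by rewrite {1}XkE; ring.
  apply: smallB; last by apply: smallMl; apply: smallW stake; lia.
  apply: (@small_div _ kap).
  have -> : X^`() * X ^+ kap *+ kap.+1 = (X ^+ kap.+1)^`() by rewrite deriv_exp.
  by apply: smallW (small_deriv sN); lia.
have {}XY : small J (N - d.+1) (X * Y) by apply: smallW XY; lia.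
have -> : (X ^+ kap)`_d = Y`_0 by rewrite coef_drop_poly.
rewrite taylor0 mulr_sumr; apply: small_sum => n _.
have -> : X ^+ i * ((- 'X) ^+ n * Y^`N(n)) = (-1) ^+ n * ('X^n * (X ^+ i * Y^`N(n))).
  by rewrite [(- 'X) ^+ n]exprNn; ring.
apply: smallMl; have [ni|ni] := ltnP n i.*2; last first.
  have -> : (e + i.*2 = i.*2 + e)%N by lia.
  apply: smallM; first by apply: smallW (@small_Xn n).
  exact: smallMr.
have sD : small J (N - d.+1 - n) (X ^+ i * Y^`N(n)).
  have := small_derivn XY X'Y (n := n) (a := i) (b := 0).
  rewrite addn0 expr0 mulr1 nderivn_def => /(_ ni).
  rewrite mulrnAr -(prednK (fact_gt0 n)); exact: small_div.
by apply: smallW (smallM (@small_Xn n) sD); lia.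
Qed.

End SmallPolynomials.

Section GeneratedIdeal.
Variable S : comNzRingType.
Implicit Types G : S -> Prop.

Inductive ideal G : S -> Prop :=
| ideal_nil : ideal G 0
| ideal_cons a g x : G g -> ideal G x -> ideal G (a * g + x).

Lemma ideal_gen G a g : G g -> ideal G (a * g).
Proof. by move=> Gg; rewrite -[a * g]addr0; apply: ideal_cons => //; apply: ideal_nil. Qed.

Lemma ideal_gen1 G g : G g -> ideal G g.
Proof. by move=> Gg; rewrite -[g]mul1r; apply: ideal_gen. Qed.

Lemma ideal_is_ideal G : is_ideal (ideal G).
Proof.
have iD x y : ideal G x -> ideal G y -> ideal G (x + y).
  elim=> [|a g {}x Gg _ IH] iy; first by rewrite add0r.
  by rewrite -addrA; apply: ideal_cons => //; apply: IH.
split=> //; first exact: ideal_nil.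
move=> b x; elim=> [|a g {}x Gg _ IH]; first by rewrite mulr0; apply: ideal_nil.
by rewrite mulrDr mulrA; apply: ideal_cons.
Qed.

Lemma ideal_le G (J : S -> Prop) x : is_ideal J -> (forall g, G g -> J g) ->
  ideal G x -> J x.
Proof.
move=> idJ GJ; elim=> [|a g {}x Gg _ IH]; first exact: ideal_0.
by apply: ideal_D => //; apply: ideal_Ml => //; apply: GJ.
Qed.

Lemma ideal_addgen G (g0 : S) x : ideal (fun g => G g \/ g = g0) x ->
  exists a y, [/\ ideal G y & x = a * g0 + y].
Proof.
elim=> [|a g {}x + _ [b [y [iy ->]]]].
  by exists 0, 0; split; [exact: ideal_nil | rewrite mul0r addr0].
case=> [Gg|->].
  exists b, (a * g + y); split; first exact: ideal_cons.
  by rewrite addrCA.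
by exists (a + b), y; split=> //; rewrite mulrDl addrA.
Qed.

End GeneratedIdeal.

(** * Coefficients of powers of the current *)

Section CurrentPolynomials.
Variable K : numFieldType.

Definition cpoly := {malg K[{cmonom nat}]}.

Definition cvar (j : nat) : cpoly := << ucm j >>.

(** Truncated so that powers are taken among polynomials; by [coef_cseriesX] the cut does not affect
    coefficients of degree below [N]. *)
Definition cseries (N : nat) : {poly cpoly} := \poly_(j < N) cvar j.

(* The coefficient of [z^n] in [x(z)^i], where [x(z) = sum_j x_j z^j]. *)
Definition ccoef (i n : nat) : cpoly := (cseries n.+1 ^+ i)`_n.

Definition csum (c : nat -> nat) (i : nat) : nat := \sum_(a < i) c a.

(** For [kap = k] these will generate the annihilator of the vector of [c]; for [kap < k] they are
    what survives when the entries from [kap] on go to infinity. *)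
Definition crel (kap : nat) (c : nat -> nat) (g : cpoly) : Prop :=
  exists i n, [/\ (0 < i)%N, ((i <= kap) && (n < csum c i))%N || (i == kap.+1)
    & g = ccoef i n].

Lemma cpoly_divn (G : cpoly -> Prop) n x : ideal G (x *+ n.+1) -> ideal G x.
Proof.
have nz : n.+1%:R != 0 :> K by rewrite pnatr_eq0.
have xE : x = (n.+1%:R^-1 : K)%:A * (x *+ n.+1).
  by rewrite mulr_algl -scaler_nat scalerA mulVf ?scale1r.
by move=> Gx; rewrite xE; apply: ideal_Ml; first exact: ideal_is_ideal.
Qed.

Lemma coef_cseriesX N i n : (n < N)%N -> (cseries N ^+ i)`_n = ccoef i n.
Proof.
move=> nN; apply/eqP; rewrite -subr_eq0 -coefB subrXX; apply/eqP.
have sd : small (fun x : cpoly => x = 0) n.+1 (cseries N - cseries n.+1).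
  by move=> j jn; rewrite coefB !coef_poly jn (leq_trans jn nN) subrr.
exact: (smallMr (@is_ideal_eq0 _) _ sd (ltnSn n)).
Qed.

Lemma small_cseries (J : cpoly -> Prop) N i d : (d <= N)%N ->
  (forall n, (n < d)%N -> J (ccoef i n)) -> small J d (cseries N ^+ i).
Proof. by move=> dN Jc j jd; rewrite coef_cseriesX; [exact: Jc | lia]. Qed.

Lemma csumS c i : csum c i.+1 = (csum c i + c i)%N.
Proof. by rewrite /csum big_ord_recr. Qed.

Lemma csum_add2 c i : csum (fun a => c a + 2)%N i = (csum c i + i.*2)%N.
Proof. by rewrite /csum big_split /= sum_nat_const card_ord muln2. Qed.

(** This is [small_expM_coef] modulo the relations of [c], with [d] and [e] the orders of e(z)^kap
    and e(z)^i. The coefficients of e(z)^(kap+1) are relations for both sequences. *)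
Lemma crel_shift kap c g : (0 < kap)%N -> crel kap (fun a => c a + 2)%N g ->
  ideal (crel kap c) (g * ccoef kap (csum c kap)).
Proof.
move=> kap0 [i [n [i0 /orP[/andP[ik]|/eqP ik ->]]]]; last first.
  rewrite mulrC; apply: ideal_gen; exists i, n; split=> //.
  by rewrite ik eqxx orbT.
rewrite csum_add2 => nd ->.
(* The shortest truncation that the strict bound in [small_expM_coef] allows. *)
set d := csum c kap; set N := (d + csum c i + i.*2).+1.
have iI := ideal_is_ideal (crel kap c).
have igen j m : (0 < j)%N -> ((j <= kap) && (m < csum c j))%N || (j == kap.+1) ->
    ideal (crel kap c) (ccoef j m).
  by move=> j0 jm; apply: ideal_gen1; exists j, m; split.
have sN : small (ideal (crel kap c)) N (cseries N ^+ kap.+1).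
  by apply: small_cseries => // m _; apply: igen; rewrite ?eqxx ?orbT.
have sd : small (ideal (crel kap c)) d (cseries N ^+ kap).
  apply: small_cseries => [|m md]; first by rewrite /N; lia.
  by apply: igen => //; rewrite leqnn md.
have se : small (ideal (crel kap c)) (csum c i) (cseries N ^+ i).
  apply: small_cseries => [|m md]; first by rewrite /N; lia.
  by apply: igen => //; rewrite ik md.
have := small_expM_coef iI (@cpoly_divn _) sN sd se (ltnSn _) nd.
by rewrite coefMC !coef_cseriesX //; rewrite /N; lia.
Qed.

(* If [x_0^a] vanishes, a product of [i] variables of total index at most
   [i - a] contains too many factors [x_0]. *)
Lemma ccoef_cvar0 a i n : (n + a <= i)%N -> exists q, ccoef i n = q * ccoef a 0.
Proof.
move=> nai.
have xa : ccoef a 0 = cvar 0 ^+ a.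
  by rewrite /ccoef -horner_coef0 horner_exp horner_coef0 coef_poly.
rewrite xa; set J := fun x => exists q, x = q * cvar 0 ^+ a.
have iJ : is_ideal J by exact: is_ideal_principal.
rewrite -/(J _) /ccoef.
have -> : cseries n.+1 = (cvar 0)%:P + 'X * drop_poly 1 (cseries n.+1).
  rewrite -{1}(poly_take_drop 1 (cseries n.+1)) mulrC; congr (_ + _).
  by apply/polyP => j; rewrite coef_take_poly coefC coef_poly; case: j.
rewrite exprDn coef_sum; apply: ideal_sum => // -[p pi] _ /=.
rewrite coefMn; apply: ideal_Mn => //; rewrite -rmorphXn coefCM.
rewrite exprMn mulrC.
have [np|pn] := ltnP n p; first by rewrite mulrC coefXnM np mulr0; apply: ideal_0.
have -> : (i - p = (i - p - a) + a)%N by lia.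
rewrite exprD; exists (('X^p * drop_poly 1 (cseries n.+1) ^+ p)`_n * cvar 0 ^+ (i - p - a)).
by rewrite mulrA.
Qed.

Lemma csum_nondecr_sub kap c m p : (p <= kap)%N -> (forall a, (a < kap)%N -> (c a <= m)%N) ->
  (csum c kap <= csum c (kap - p) + m * p)%N.
Proof.
elim: p => [|p IH] pk cm; first by rewrite subn0; lia.
have := IH (ltnW pk) cm.
have -> : (kap - p = (kap - p.+1).+1)%N by lia.
rewrite csumS; have := cm (kap - p.+1)%N; lia.
Qed.

(* Expanding powers of the truncation [x(z) - z^j (x_j + ...)]. *)
Lemma ccoef_trunc k c j : (0 < k)%N -> (forall a, (a < k)%N -> (c a < j)%N) ->
  ideal (crel k c) (ccoef k (csum c k) - (cseries j ^+ k)`_(csum c k)) /\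
  ideal (crel k c) ((cvar j * ccoef k (csum c k)) *+ k.+1
    + (cseries j ^+ k.+1)`_(csum c k + j)).
Proof.
move=> k0 cj; set d := csum c k; set J := ideal _.
have iJ : is_ideal J by exact: ideal_is_ideal.
have cm : forall a, (a < k)%N -> (c a <= j.-1)%N by move=> a /cj; lia.
have j0 : (0 < j)%N by have := cj 0%N k0; lia.
set N := (d + j).+1; set X := cseries N.
set G := drop_poly j X.
have XE : cseries j = X - 'X^j * G.
  rewrite mulrC; apply/esym/eqP; rewrite subr_eq -{1}(poly_take_drop j X); apply/eqP.
  congr (_ + _); apply/polyP => n; rewrite coef_take_poly !coef_poly.
  case: ltnP => // nj; rewrite ifT //; rewrite /N; lia.
have G0 : G`_0 = cvar j by rewrite coef_drop_poly coef_poly ifT // /N; lia.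
have sX i : (i <= k)%N -> small J (csum c i) (X ^+ i).
  move=> ik; case: (posnP i) => [->|i0].
    by rewrite /csum big_ord0.
  apply: small_cseries => [|m md].
    have := @csum_nondecr_sub i c 0 0; rewrite /N /d.
    suff : (csum c i <= csum c k)%N by lia.
    elim: (k) ik => [|k' IH]; first by rewrite leqn0 => /eqP ->.
    by rewrite leq_eqVlt => /predU1P[-> //|/IH]; rewrite csumS; lia.
  apply: ideal_gen1; exists i, m; split=> //.
  by rewrite ik md.
have sX1 : small J N (X ^+ k.+1).
  apply: small_cseries => // m _; apply: ideal_gen1.
  by exists k.+1, m; split; rewrite ?eqxx ?orbT.
(* Each factor z^j G costs [j], more than any entry of [c]. Hence in e(z)^k these terms start beyond
   [csum c k], and in e(z)^(k+1) those with p >= 2 start beyond [csum c k + j]; there p = 1 gives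
   the product with x_j. *)
have term e p : (0 < p)%N -> (e - p <= k)%N ->
    small J (csum c (e - p) + j * p) (X ^+ (e - p) * (- ('X^j * G)) ^+ p *+ 'C(e, p)).
  move=> p0 ep; apply: smallMn => //; apply: smallM => //; first exact: sX.
  have -> : (- ('X^j * G)) ^+ p = 'X^(j * p) * (-1) ^+ p * G ^+ p.
    by rewrite [(- ('X^j * G)) ^+ p]exprNn exprMn -exprM; ring.
  by do 2!apply: smallMr => //; apply: small_Xn.
rewrite {1}XE; split.
  rewrite exprDn big_ord_recl /= subn0 expr0 mulr1 bin0 mulr1n coefD.
  rewrite coef_cseriesX; last by rewrite /N; lia.
  rewrite opprD addNKr; apply: ideal_N => //; rewrite coef_sum; apply: ideal_sum => //.
  move=> p _; rewrite /bump /= add1n.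
  apply: term => //; first lia.
  have := @csum_nondecr_sub k c j.-1 p.+1 (ltn_ord p) cm.
  by rewrite -/d; move: (ltn_ord p) => ? ?; nia.
rewrite XE exprDn big_ord_recl big_ord_recl /= subn0 expr0 mulr1 bin0 mulr1n !coefD.
set q := \sum_(i < k) _; set s := q`_(d + j).
have Js : J s.
  rewrite /s /q coef_sum; apply: ideal_sum => // p _; rewrite /bump /= !add1n.
  apply: term => //; first lia.
  have := @csum_nondecr_sub k c j.-1 p.+1 (ltn_ord p) cm.
  have -> : (k.+1 - p.+2 = k - p.+1)%N by lia.
  by rewrite -/d; move: (ltn_ord p) => ? ?; nia.
have J1 : J (X ^+ k.+1)`_(d + j) by apply: sX1; rewrite /N.
have J2 := coefM_lead iJ (sX k (leqnn k)) (smallMr iJ G (@small_Xn _ J iJ j)).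
rewrite -/d in J2.
rewrite /bump /= add1n expr1 subSS subn0 bin1 mulrN mulNrn coefN coefMn.
rewrite [in J _]coef_cseriesX in J2; last by rewrite /N; lia.
rewrite coefXnM ltnn subnn G0 in J2.
set u := (X ^+ k * _)`_ _ in J2 *; set v := ccoef _ _ in J2 *.
have -> : (cvar j * v) *+ k.+1 + ((X ^+ k.+1)`_(d + j) + (- (u *+ k.+1) + s))
  = (X ^+ k.+1)`_(d + j) + s - (u - v * cvar j) *+ k.+1 by rewrite mulrnBl [v * _]mulrC; ring.
by apply: ideal_B => //; [apply: ideal_D | apply: ideal_Mn].
Qed.

End CurrentPolynomials.

(** * The grading by polynomial degree *)

Section DegreeTruncation.
Variable K : numFieldType.
Implicit Types P Q g : cpoly K.

Definition cdeg_trunc (r : nat) P : cpoly K :=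
  lin_ext (fun m => if (mdeg m < r)%N then << m >> else 0) P.

Definition chomog (i : nat) g := forall m, m \in msupp g -> mdeg m = i.

Lemma chomog0 i : chomog i 0.
Proof. by move=> m; rewrite msupp0. Qed.

Lemma chomogD i g g' : chomog i g -> chomog i g' -> chomog i (g + g').
Proof.
move=> hg hg' m /(fsubsetP (msuppD_le _ _)).
by rewrite in_fsetU => /orP[/hg|/hg'].
Qed.

Lemma chomogM i j g g' : chomog i g -> chomog j g' -> chomog (i + j) (g * g').
Proof.
move=> hg hg' m /msuppM_le[m1 [m2 [m1g m2g ->]]].
by rewrite mdegM (hg _ m1g) (hg' _ m2g).
Qed.

Lemma chomogU m : chomog (mdeg m) << m >>.
Proof. by move=> m'; rewrite msuppU oner_eq0 inE => /eqP ->. Qed.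

Lemma chomog_ccoef i n : chomog i (ccoef K i n).
Proof.
rewrite /ccoef; elim: i (n) (n.+1) => [|i IH] {}n N.
  rewrite expr0 coef1; case: (n == 0%N); last exact: chomog0.
  by have := @chomogU mone; rewrite mdeg1.
rewrite exprS coefM; apply: (big_ind (chomog i.+1)).
- exact: chomog0.
- exact: chomogD.
move=> j _; rewrite -add1n; apply: chomogM; last exact: IH.
rewrite coef_poly; case: ifP => _; last exact: chomog0.
by have := @chomogU (ucm (j : nat)); rewrite mdegU.
Qed.

Lemma cdeg_trunc_linear r : linear (cdeg_trunc r).
Proof. exact: lin_ext_is_linear. Qed.

Lemma cdeg_truncU r m : cdeg_trunc r << m >> = if (mdeg m < r)%N then << m >> else 0.
Proof. exact: lin_extU. Qed.

Lemma cdeg_truncM r i Q g : chomog i g ->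
  cdeg_trunc r (Q * g) = cdeg_trunc (r - i) Q * g.
Proof.
move=> hg; move: Q; apply: linear_malg_ext.
- by move=> a x y; rewrite mulrDl -scalerAl cdeg_trunc_linear.
- by move=> a x y; rewrite cdeg_trunc_linear mulrDl -scalerAl.
move=> m; rewrite cdeg_truncU [in LHS](malgEZ g) mulr_sumr lin_sum; last exact: cdeg_trunc_linear.
rewrite [in RHS](malgEZ g) mulr_sumr; apply: eq_big_seq => n ng.
rewrite -!scalerAr linZ; last exact: cdeg_trunc_linear.
rewrite malgMUU cdeg_truncU mdegM (hg _ ng) ltn_subRL addnC.
by case: (i + mdeg m < r)%N; [rewrite malgMUU | rewrite mul0r].
Qed.

Lemma cdeg_truncK r P : cdeg_trunc r (cdeg_trunc r P) = cdeg_trunc r P.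
Proof.
move: P; apply: linear_malg_ext.
- by move=> a x y; rewrite !cdeg_trunc_linear.
- exact: cdeg_trunc_linear.
move=> m; rewrite !cdeg_truncU; case mr: (mdeg m < r)%N; first by rewrite cdeg_truncU mr.
by rewrite lin0 //; apply: cdeg_trunc_linear.
Qed.

Lemma cdeg_trunc_id P : exists r, cdeg_trunc r P = P.
Proof.
exists (msize P); rewrite /cdeg_trunc /lin_ext [RHS](malgEZ P).
by apply: eq_big_seq => m mP; rewrite msize_mdeg_lt.
Qed.

Lemma cdeg_trunc0 P : cdeg_trunc 0 P = 0.
Proof. by rewrite /cdeg_trunc /lin_ext big1 // => m _; rewrite scaler0. Qed.

(** The relations are homogeneous, so truncating a combination only truncates its coefficients. This
    keeps cofactors of small degree in the induction on the degree. *)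
Lemma ideal_cdeg_trunc r kap c P : ideal (crel kap c) P ->
  ideal (crel kap c) (cdeg_trunc r P).
Proof.
elim=> [|a g x Gg _ IH].
  by rewrite lin0; [exact: ideal_nil | exact: cdeg_trunc_linear].
rewrite linD; last exact: cdeg_trunc_linear.
have [i [n [_ _ gE]]] := Gg.
rewrite (@cdeg_truncM _ i) ?gE; last exact: chomog_ccoef.
by rewrite -gE; apply: ideal_cons.
Qed.

(** For [kap = 0] all coefficients of e(z)^1, that is, all variables, are relations: the ideal is
    the augmentation ideal. *)
Lemma ideal_const P : ideal (crel 0 (fun=> 0%N)) (P - P@_mone *: 1).
Proof.
set J := ideal _; have iJ : is_ideal J by exact: ideal_is_ideal.
rewrite {1}(malgEZ P).
have -> : P@_mone *: 1 = \sum_(m <- msupp P) P@_m *: ((m == mone)%:R : cpoly K).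
  have [m1|m1] := boolP (mone \in msupp P).
    rewrite (big_fsetD1 _ m1) /= eqxx big1_seq ?addr0 // => m.
    by rewrite in_fsetD1 andbA => /andP[/andP[_ /negbTE ->] _]; rewrite scaler0.
  rewrite mcoeff_outdom // scale0r big1_seq // => m /andP[_ mP].
  by case: eqP mP m1 => [-> ->|]//; rewrite scaler0.
rewrite -sumrB; apply: ideal_sum => // m _; rewrite -scalerBr -mulr_algl.
apply: ideal_Ml => //; have [->|m1] := eqVneq m mone; first by rewrite subrr; apply: ideal_0.
rewrite subr0.
have [t tm] : exists t, t \in finsupp m.
  apply/fset0Pn; apply: contra m1 => /eqP m0; rewrite -mdeg_eq0 mdegE m0.
  by rewrite big_seq_fset0.
have -> : m = mmul (divcm m (ucm t)) (ucm t).
  apply/eqP/cmP => s; rewrite cmM divcmE cmU subnK //.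
  by case: eqP => // <-; rewrite lt0n cmE_neq0.
rewrite -malgMUU; apply: ideal_gen; exists 1%N, t; split=> //.
by rewrite /ccoef expr1 coef_poly ltnSn.
Qed.

End DegreeTruncation.

Definition nondecr (k : nat) (c : nat -> nat) : Prop :=
  forall a b, (a <= b)%N -> (b < k)%N -> (c a <= c b)%N.

(** Letting [T] grow isolates the first [kap] entries. *)
Definition cut (kap T : nat) (c : nat -> nat) (a : nat) : nat :=
  if (a < kap)%N then c a else T.

Definition bump_at (a t : nat) (c : nat -> nat) (b : nat) : nat :=
  (c b + (b == a) * t)%N.

Definition raise2 (kap : nat) (c : nat -> nat) (a : nat) : nat :=
  (c a + (a < kap) * 2)%N.

Section CsumLemmas.

Lemma eq_csum c c' i : (forall a, (a < i)%N -> c a = c' a) -> csum c i = csum c' i.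
Proof. by move=> cc; apply: eq_bigr => a _; rewrite cc. Qed.

Lemma csum_bump a t c i : csum (bump_at a t c) i = (csum c i + (a < i) * t)%N.
Proof.
elim: i => [|i IH]; first by rewrite /csum !big_ord0 ltn0.
rewrite !csumS IH /bump_at ltnS eq_sym; case: (ltngtP a i) => _ /=;
  rewrite ?mul0n ?mul1n; lia.
Qed.

Lemma nondecr_bump kap t c : nondecr kap.+1 c -> nondecr kap.+1 (bump_at kap t c).
Proof.
move=> nc a b ab bk; rewrite /bump_at; have := nc a b ab bk.
case: (a =P kap) => ak; case: (b =P kap) => bk'; lia.
Qed.

End CsumLemmas.

(** * The annihilator of a vector *)

Section Presentation.
Variables (K : numFieldType) (V : lmodType K) (E : nat -> V -> V).
Hypothesis linE : forall t, linear (E t).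
Hypothesis commE : forall s t v, E s (E t v) = E t (E s v).
Variables (k : nat) (w : (nat -> nat) -> V).

Local Notation "P '.*' v" := (act E P v) (at level 40).

Hypothesis w_ext : forall c c', (forall a, (a < k)%N -> c a = c' a) -> w c = w c'.
Hypothesis w_neq0 : forall c, w c != 0.
Hypothesis w_raise : forall c a (P : cpoly K), (a < k)%N -> P .* w c = 0 ->
  P .* w (bump_at a 1 c) = 0.
Hypothesis w_rel : forall c i n, nondecr k c -> (0 < i <= k)%N -> (n < csum c i)%N ->
  ccoef K i n .* w c = 0.
Hypothesis w_rel_top : forall c n, nondecr k c -> ccoef K k.+1 n .* w c = 0.
Hypothesis w_lead : forall c kap, (0 < kap <= k)%N -> nondecr k c ->
  ((kap < k)%N -> (c kap.-1 < c kap)%N) ->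
  exists2 x : K, x != 0 & ccoef K kap (csum c kap) .* w c = x *: w (raise2 kap c).

Let acts0 P : P .* 0 = 0.
Proof. by rewrite lin0 //; apply: act_is_linear. Qed.

Let actD P Q v : (P + Q) .* v = P .* v + Q .* v.
Proof. by have := linD (act_is_linearl E v) P Q. Qed.

(** Annihilation in the limit of a large tail; for [kap = k] there is no tail and this is plain
    annihilation of [w c]. *)
Definition kills_cut kap c P := exists t0, forall T, (t0 <= T)%N ->
  P .* w (cut kap T c) = 0.

Lemma w_raise_bump c a t P : (a < k)%N -> P .* w c = 0 -> P .* w (bump_at a t c) = 0.
Proof.
move=> ak Pw; elim: t => [|t IH].
  by rewrite -(w_ext (c := c)) // => b _; rewrite /bump_at muln0 addn0.
rewrite (@w_ext _ (bump_at a 1 (bump_at a t c))); first exact: w_raise.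
by move=> b _; rewrite /bump_at; lia.
Qed.

Lemma nondecr_cut kap T c : nondecr kap c -> (forall a, (a < kap)%N -> c a <= T)%N ->
  nondecr k (cut kap T c).
Proof.
move=> nc cT a b ab bk; rewrite /cut; case: ltnP => [ak|ka].
  by case: ltnP => bk'; [apply: nc | apply: cT].
by case: ltnP => // bk'; move: (leq_ltn_trans ab bk'); lia.
Qed.

Let cmax (kap : nat) (c : nat -> nat) := (\sum_(a < kap) c a)%N.
Let le_cmax kap c a : (a < kap)%N -> (c a <= cmax kap c)%N.
Proof. by move=> ak; rewrite /cmax (bigD1 (Ordinal ak)) //= leq_addr. Qed.

(** For [kap < k] the coefficient of z^n in e(z)^(kap+1) is a relation of [w] as soon as [T > n],
    since the sum of the first [kap + 1] entries is at least [T]. *)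
Lemma crel_kills kap c P : (kap <= k)%N -> nondecr kap c -> ideal (crel kap c) P ->
  kills_cut kap c P.
Proof.
move=> kk nc; elim=> [|q g x [i [n [i0 ikn ->]]] _ [t0 Ht0]].
  by exists 0%N => T _; rewrite (lin0 (act_is_linearl E _)).
exists (maxn (maxn t0 n.+1) (cmax kap c)) => T; rewrite !geq_max => /andP[/andP[t0T nT] cT].
rewrite actD Ht0 // addr0 actM //.
have nw : nondecr k (cut kap T c).
  by apply: nondecr_cut => // a ak; apply: leq_trans cT; apply: le_cmax.
suff -> : ccoef K i n .* w (cut kap T c) = 0 by rewrite acts0.
case/orP: ikn => [/andP[ik ni]|/eqP ik].
  apply: w_rel => //; first by rewrite i0 (leq_trans ik kk).
  rewrite (@eq_csum _ c) // => a ai; rewrite /cut ifT //; exact: leq_trans ik.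
have [kk'|kk'] := eqVneq kap k; first by (have -> : i = k.+1 by lia); apply: w_rel_top.
apply: w_rel => //; first by rewrite ik /=; lia.
by rewrite ik csumS /cut ltnn; lia.
Qed.

(** Modulo the relations a polynomial is its constant term, and a nonzero constant does not kill
    [w]. *)
Lemma presentation0 c P : kills_cut 0 c P -> ideal (crel 0 c) P.
Proof.
have cc x : ideal (crel 0 c) x <-> ideal (crel 0 (fun=> 0%N)) x.
  have h c1 c2 : ideal (crel 0 c1) x -> ideal (crel 0 c2) x.
    apply: ideal_le; first exact: ideal_is_ideal.
    move=> g [i [n [i0 ikn ->]]]; apply: ideal_gen1.
    exists i, n; split=> //; move: ikn; lia.
  by split; apply: h.
move=> [t0 Ht0]; have iP := ideal_const P; move/cc: (iP) => iP'.
have n0 : nondecr 0 c by [].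
have [t1 Ht1] := crel_kills (leq0n k) n0 iP'.
have := Ht1 (maxn t0 t1) (leq_maxr _ _).
rewrite (linB (act_is_linearl E _)) Ht0 ?leq_maxl // sub0r.
rewrite (linZ (act_is_linearl E _)) act1 => /eqP; rewrite oppr_eq0 scaler_eq0.
rewrite (negbTE (w_neq0 _)) orbF => /eqP P1.
by move: iP'; rewrite P1 scale0r subr0.
Qed.

Lemma nondecr_add2 kap c : nondecr kap c -> nondecr kap (fun a => c a + 2)%N.
Proof. by move=> nc a b ab bk; rewrite leq_add2r nc. Qed.

(** Only the sum of the first [kap + 1] entries changes, and by one, so there is a single new
    generator. *)
Lemma crel_bumpS kap t c P :
  ideal (crel kap.+1 (bump_at kap t.+1 c)) P ->
  ideal (fun g => crel kap.+1 (bump_at kap t c) g \/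
     g = ccoef K kap.+1 (csum (bump_at kap t c) kap.+1)) P.
Proof.
apply: ideal_le; first exact: ideal_is_ideal.
move=> g [i [n [i0 ikn ->]]]; apply: ideal_gen1.
have [[-> ->]|ne] : (i = kap.+1 /\ n = csum (bump_at kap t c) kap.+1) \/
    ~ (i = kap.+1 /\ n = csum (bump_at kap t c) kap.+1) by lia.
  by right.
left; exists i, n; split=> //; move: ikn ne; rewrite !csum_bump ltnSn mul1n.
have [ki|ki] := ltnP kap i; rewrite ?mul1n ?mul0n; last by lia.
have [->|ik] := eqVneq i kap.+1; lia.
Qed.

Theorem presentation_cut kap c P : (kap <= k)%N -> nondecr kap c -> kills_cut kap c P ->
  ideal (crel kap c) P.
Proof.
elim: kap c P => [|kap IHk] c P kk nc; first exact: presentation0.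
have [r Pr] := cdeg_trunc_id P.
elim/ltn_ind: r c nc P Pr => r IHr c nc P Pr Pk.
have iI t := ideal_is_ideal (@crel K kap.+1 (bump_at kap t c)).
have kt t : kills_cut kap.+1 (bump_at kap t c) P.
  have [t0 Ht0] := Pk; exists t0 => T tT.
  rewrite (@w_ext _ (bump_at kap t (cut kap.+1 T c))).
    by apply: w_raise_bump => //; apply: Ht0.
  by move=> a _; rewrite /cut /bump_at; case: ltnP => // ka; rewrite gtn_eqF // addn0.
(* With the last entry at infinity, [P] lies in the ideal for [kap] by induction. It involves
   finitely many coefficients of e(z)^(kap+1), and these are relations for [kap + 1] once the last
   entry is large. *)
have [M PM] : exists M, ideal (crel kap.+1 (bump_at kap M c)) P.
  have : ideal (crel kap c) P.
    apply: IHk; [exact: ltnW| by move=> a b ab bk; apply: nc => //; apply: ltnW|].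
    have [t0 Ht0] := Pk; exists (maxn t0 (c kap)) => T; rewrite geq_max => /andP[tT cT].
    rewrite (@w_ext _ (bump_at kap (T - c kap) (cut kap.+1 T c))).
      by apply: w_raise_bump => //; apply: Ht0.
    move=> a _; rewrite /cut /bump_at ltnS; case: (ltngtP a kap) => [ak|ak|->] /=.
    - by rewrite mul0n addn0.
    - by rewrite mul0n addn0.
    - by rewrite mul1n subnKC.
  elim=> [|q g x [i [n [i0 ikn ->]]] _ [M PM]]; first by exists 0%N; apply: ideal_nil.
  exists (M + n.+1)%N; apply: ideal_cons.
    exists i, n; split=> //; rewrite csum_bump.
    by move: ikn; case: (ltngtP kap i) => ki /=; rewrite ?orbF; lia.
  move: PM; apply: ideal_le => // g' [i' [n' [i0' ikn' ->]]].
  apply: ideal_gen1; exists i', n'; split=> //.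
  move: ikn'; rewrite !csum_bump; case: (ltnP kap i') => /= _; lia.
suff desc t : ideal (crel kap.+1 (bump_at kap t c)) P -> ideal (crel kap.+1 c) P.
  exact: desc PM.
elim: t => [|t IHt] Pt.
  move: Pt; apply: ideal_le; first exact: ideal_is_ideal.
  move=> g [i [n [i0 ikn ->]]]; apply: ideal_gen1.
  by exists i, n; split=> //; move: ikn; rewrite csum_bump muln0 addn0.
apply: IHt; set c' := bump_at kap t c.
have nc' : nondecr kap.+1 c' by apply: nondecr_bump.
(* Lowering the last entry by one loses one generator [X], homogeneous of degree [kap + 1]. Its
   cofactor can be truncated to degrees below [r - kap - 1], where the induction on [r] applies. *)
have [Q0 [R0 [iR0 PE]]] := ideal_addgen (crel_bumpS Pt).
set X := ccoef _ _ _ in PE.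
have [Q [R [QK iR {}PE]]] : exists Q R, [/\ cdeg_trunc (r - kap.+1) Q = Q,
    ideal (crel kap.+1 c') R & P = Q * X + R].
  exists (cdeg_trunc (r - kap.+1) Q0), (cdeg_trunc r R0); split.
  - exact: cdeg_truncK.
  - exact: ideal_cdeg_trunc.
  - rewrite -Pr PE (linD (@cdeg_trunc_linear _ _)) (@cdeg_truncM _ _ kap.+1) //.
    exact: chomog_ccoef.
rewrite PE; apply: (ideal_D (iI t) _ iR).
(* By [crel_shift], [X] times a relation of the raised sequence is a relation of [c']. And [Q] kills
   the raised vector, because [X] maps [w] to a nonzero multiple of it while [P] and [R] kill
   [w]. *)
suff : ideal (crel kap.+1 (fun a => c' a + 2)%N) Q.
  elim=> [|q g x Gg _ IH]; first by rewrite mul0r; apply: ideal_nil.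
  rewrite mulrDl -mulrA; apply: (ideal_D (iI t) _ IH).
  by apply: (ideal_Ml (iI t)); apply: crel_shift.
case: r => [|r] in IHr Pr QK *.
  by rewrite -QK sub0n cdeg_trunc0; exact: ideal_nil.
apply: (IHr (r.+1 - kap.+1)%N); first by lia.
- exact: nondecr_add2.
- exact: QK.
have [t1 Ht1] := kt t; have [t2 Ht2] := crel_kills kk nc' iR.
exists (maxn (maxn t1 t2) (cmax kap.+1 c').+1) => T.
rewrite !geq_max => /andP[/andP[T1 T2] T3].
(* [T] exceeds every entry of [c'], which gives the strict increase required by [w_lead]. *)
have [|||x x0 Xw] := @w_lead (cut kap.+1 T c') kap.+1.
- by rewrite kk.
- by apply: nondecr_cut => // a ak; apply: leq_trans (ltnW T3); apply: le_cmax.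
- move=> _; rewrite /cut ltnn /= ltnSn; apply: leq_ltn_trans T3; exact: le_cmax.
have EX : csum (cut kap.+1 T c') kap.+1 = csum c' kap.+1.
  by apply: eq_csum => a ak; rewrite /cut ak.
rewrite EX -/X in Xw.
have := Ht1 T T1; rewrite -/c' => /eqP.
rewrite PE actD (Ht2 T T2) [X in X == _]addr0 (actM linE commE) Xw.
rewrite (linZ (act_is_linear linE Q)) scaler_eq0 (negbTE x0) /= => /eqP.
rewrite (@w_ext _ (cut kap.+1 T (fun a => c' a + 2)%N)) //.
move=> a _; rewrite /raise2 /cut; case: (a < kap.+1)%N; lia.
Qed.

Corollary presentation c P : nondecr k c -> P .* w c = 0 -> ideal (crel k c) P.
Proof.
move=> nc Pw; apply: presentation_cut => //; exists 0%N => T _.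
by rewrite (@w_ext _ c) // => a ak; rewrite /cut ak.
Qed.

End Presentation.

(** * Fermions and currents *)

Section FiniteSums.
Variables (K : fieldType) (V : lmodType K).
Implicit Types F G : int -> V.

Definition fsum F : V := \sum_(i \in [set: int]) F i.
Definition fsupp F := finite_set [set i | F i <> 0]%classic.

Lemma fsumE (A : {fset int}) F : (forall i, i \notin A -> F i = 0) ->
  fsum F = \sum_(i <- A) F i.
Proof. exact: fsbigTE. Qed.

Lemma fsuppP F : fsupp F -> exists A : {fset int}, forall i, i \notin A -> F i = 0.
Proof.
move=> fF; exists (fset_set [set i | F i <> 0]%classic) => i; rewrite in_fset_set //.
by move=> iF; apply: contrapT => nF; move/negP: iF; apply; rewrite inE.
Qed.

Lemma fsuppW (A : {fset int}) F : (forall i, i \notin A -> F i = 0) -> fsupp F.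
Proof.
move=> FA; apply: (@sub_finite_set _ _ [set` A]%classic); last exact: finite_fset.
by move=> i /= nF; apply: contrapT => /negP iA; apply/nF/FA.
Qed.

Lemma fsumB F G : fsupp F -> fsupp G -> fsum F - fsum G = fsum (fun i => F i - G i).
Proof.
move=> /fsuppP[A FA] /fsuppP[B GB].
rewrite !(@fsumE (A `|` B)%fset) ?sumrB // => i; rewrite in_fsetU negb_or => /andP[iA iB].
- by rewrite FA // GB // subrr.
- exact: GB.
- exact: FA.
Qed.

Lemma eq_fsum F G : F =1 G -> fsum F = fsum G.
Proof. by move=> FG; apply: eq_fsbigr => i _; apply: FG. Qed.

Lemma fsumD F G : fsupp F -> fsupp G -> fsum F + fsum G = fsum (fun i => F i + G i).
Proof.
move=> /fsuppP[A FA] /fsuppP[B GB].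
rewrite !(@fsumE (A `|` B)%fset) ?big_split // => i; rewrite in_fsetU negb_or => /andP[iA iB].
- by rewrite FA // GB // addr0.
- exact: GB.
- exact: FA.
Qed.

Lemma fsum0 : fsum (fun=> 0) = 0.
Proof. by rewrite (@fsumE fset0) // big_seq_fset0. Qed.

Lemma fsum_rev (a : int) F : fsum F = fsum (fun i => F (a - i)).
Proof.
apply: (@reindex_fsbigT _ _ _ _ _ (fun i : int => a - i) F).
by exists (fun i => a - i) => i; rewrite subKr.
Qed.

Lemma fsum_exchange (A : {fset int}) (F : int -> int -> V) :
  (forall i j, (i \notin A) || (j \notin A) -> F i j = 0) ->
  fsum (fun i => fsum (F i)) = fsum (fun j => fsum (F^~ j)).
Proof.
move=> FA; rewrite (@fsumE A) => [|i iA]; last first.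
  rewrite -fsum0; apply: eq_fsum => j; apply: FA; by rewrite iA.
rewrite [RHS](@fsumE A) => [|j jA]; last first.
  rewrite -fsum0; apply: eq_fsum => i; apply: FA; by rewrite jA orbT.
rewrite (eq_bigr (fun i => \sum_(j <- A) F i j)); last first.
  by move=> i _; apply: fsumE => j jA; apply: FA; rewrite jA orbT.
rewrite exchange_big; apply: eq_bigr => j _; apply/esym/fsumE => i iA.
by apply: FA; rewrite iA.
Qed.

Lemma fsum_ord n F : (forall i : int, ~~ (0 <= i <= n%:Z) -> F i = 0) ->
  fsum F = \sum_(j < n.+1) F (j : nat)%:Z.
Proof.
move=> F0; set s := [seq i%:Z | i <- iota 0 n.+1].
have us : uniq s by rewrite map_inj_uniq ?iota_uniq // => i j [].
have -> : fsum F = \sum_(i \in [set` s]) F i.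
  apply/esym/fsbig_widen => // i [_ /= /negP is_]; apply: F0; apply: contra is_ => /andP[i0 lin].
  by apply/mapP; exists `|i|%N; rewrite ?mem_iota; lia.
by rewrite -fsbig_seq // big_map -/(index_iota 0 n.+1) big_mkord.
Qed.

Lemma fsum1 (i0 : int) F : (forall i, i != i0 -> F i = 0) -> fsum F = F i0.
Proof.
move=> F0; rewrite (@fsumE [fset i0]%fset) ?big_seq_fset1 // => i.
by rewrite inE; apply: F0.
Qed.

Lemma fsum_shift (a : int) F : fsum F = fsum (fun i => F (i + a)).
Proof.
apply: (@reindex_fsbigT _ _ _ _ _ (fun i : int => i + a) F).
by exists (fun i => i - a) => i; rewrite ?addrK ?subrK.
Qed.

End FiniteSums.

Section FsumLinear.
Variables (K : fieldType) (V W : lmodType K).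

Lemma fsum_lin (f : V -> W) (F : int -> V) : linear f -> fsupp F ->
  f (fsum F) = fsum (fun i => f (F i)).
Proof.
move=> lf /fsuppP[A FA]; rewrite (fsumE FA) lin_sum //; apply/esym/fsbigTE.
by move=> i /FA ->; apply: lin0.
Qed.

Lemma fsupp_lin (f : V -> W) (F : int -> V) :
  linear f -> fsupp F -> fsupp (fun i => f (F i)).
Proof. by move=> lf /fsuppP[A FA]; apply: (fsuppW (A := A)) => i /FA ->; apply: lin0. Qed.

End FsumLinear.

(** * Anticommutation relations of the fermions *)

Lemma occ_inj X Y : occ X =1 occ Y -> X = Y.
Proof.
move=> XY; apply/fsetP => p; have := XY p; rewrite /occ.
by case: (p < 0) => /=; [move/negb_inj|].
Qed.

Lemma toggleK p : involutive (toggle^~ p).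
Proof. by move=> X; apply: occ_inj => q; rewrite !occ_toggle addKb. Qed.

Lemma toggleC X p q : toggle (toggle X p) q = toggle (toggle X q) p.
Proof. by apply: occ_inj => r; rewrite !occ_toggle addbCA. Qed.

Lemma in_nright X p q :
  (q \in fset_set [set q : int | occ X q /\ p < q]%classic) = occ X q && (p < q).
Proof.
rewrite in_fset_set; last exact: finite_nright.
by apply/idP/andP; rewrite inE.
Qed.

Section FermionRelations.
Variable K : fieldType.
Implicit Types (X : semimon) (u : Fock K).

Definition nsign X (p : int) : K := (-1) ^+ nright X p.

(** Toggling [p] changes the number of occupied positions to the right of [q], by one, exactly when
    [q < p]. All signs in the relations below come from this. *)
Lemma nsign_toggle X p q : nsign (toggle X p) q = (if q < p then -1 else 1) * nsign X q.
Proof.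
rewrite /nsign /nright; set A := fset_set _; set B := fset_set _.
have AE r : (r \in A) = ((r == p) (+) occ X r) && (q < r) by rewrite in_nright occ_toggle.
have BE r : (r \in B) = occ X r && (q < r) by rewrite in_nright.
have [qp|pq] := ltP q p; last first.
  rewrite mul1r; congr (_ ^+ #|` _|); apply/fsetP => r; rewrite AE BE.
  by case: eqP => // ->; rewrite ltNge pq !andbF.
rewrite mulN1r; case oX: (occ X p).
  have -> : B = (p |` A)%fset.
    apply/fsetP => r; rewrite in_fset1U AE BE.
    by case: eqP => //= ->; rewrite oX.
  by rewrite cardfsU1 AE eqxx oX /= exprS mulN1r opprK.
have -> : A = (p |` B)%fset.
  apply/fsetP => r; rewrite in_fset1U AE BE.
  by case: eqP => //= ->; rewrite oX.
by rewrite cardfsU1 BE oX /= exprS mulN1r.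
Qed.

Lemma nsign_sqr X p : nsign X p * nsign X p = 1.
Proof. by rewrite -expr2 /nsign sqrr_sign. Qed.

Lemma rmul_linear p : linear (@rmul_var K p). Proof. exact: lin_ext_is_linear. Qed.
Lemma rder_linear p : linear (@rder_var K p). Proof. exact: lin_ext_is_linear. Qed.

Lemma rmulU p X : rmul_var p << X >> =
  if occ X p then 0 else nsign X p *: << toggle X p >> :> Fock K.
Proof. exact: lin_extU. Qed.

Lemma rderU p X : rder_var p << X >> =
  if occ X p then nsign X p *: << toggle X p >> else 0 :> Fock K.
Proof. exact: lin_extU. Qed.

Lemma rmul0 p : rmul_var p 0 = 0 :> Fock K. Proof. exact: lin0 (rmul_linear p). Qed.
Lemma rder0 p : rder_var p 0 = 0 :> Fock K. Proof. exact: lin0 (rder_linear p). Qed.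

Lemma rmul_anti p q u : rmul_var p (rmul_var q u) = - rmul_var q (rmul_var p u).
Proof.
move: u; apply: linear_malg_ext.
- by move=> a u v; rewrite !rmul_linear.
- by move=> a u v; rewrite !rmul_linear opprD scalerN.
move=> X; rewrite !rmulU.
case oq: (occ X q); case op: (occ X p); rewrite ?rmul0 ?oppr0 //.
- by rewrite (linZ (rmul_linear q)) rmulU occ_toggle oq addbT; case: eqVneq oq op => [->->|_ _ _]//=; rewrite ?scaler0 oppr0.
- by rewrite (linZ (rmul_linear p)) rmulU occ_toggle op addbT; case: eqVneq oq op => [->->|_ _ _]//=; rewrite ?scaler0.
rewrite !(linZ (rmul_linear _)) !rmulU !occ_toggle op oq !addbF eq_sym.
case: (ltgtP p q) => pq; rewrite ?scaler0 ?oppr0 //= !scalerA -scaleNr toggleC;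
  congr (_ *: _); rewrite !nsign_toggle; [rewrite pq ltNge (ltW pq)|rewrite pq ltNge (ltW pq)] => /=; ring.
Qed.

Let neq_sign (p q : int) : p != q ->
  (if q < p then -1 else 1) = - (if p < q then -1 else 1) :> K.
Proof. by case: (ltgtP p q) => //; rewrite opprK. Qed.

Lemma rder_anti p q u : rder_var p (rder_var q u) = - rder_var q (rder_var p u).
Proof.
move: u; apply: linear_malg_ext.
- by move=> a u v; rewrite !rder_linear.
- by move=> a u v; rewrite !rder_linear opprD scalerN.
move=> X; have [->|pq] := eqVneq p q.
  rewrite rderU; case oq: (occ X q); last by rewrite rder0 oppr0.
  by rewrite (linZ (rder_linear _)) rderU occ_toggle eqxx oq scaler0 oppr0.
have qp : q != p by rewrite eq_sym.
rewrite !rderU; case oq: (occ X q); case op: (occ X p); rewrite ?rder0 ?oppr0 //;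
  rewrite ?(linZ (rder_linear _)) ?rderU !occ_toggle ?oq ?op ?(negbTE pq) ?(negbTE qp) /=
    ?scaler0 ?oppr0 //.
rewrite !scalerA toggleC -scaleNr; congr (_ *: _).
by rewrite !nsign_toggle (neq_sign pq); ring.
Qed.

Lemma rder_rmul p q u : rder_var p (rmul_var q u) =
  (if p == q then u else 0) - rmul_var q (rder_var p u).
Proof.
move: u; apply: linear_malg_ext.
- by move=> a u v; rewrite !(rder_linear, rmul_linear).
- move=> a u v; rewrite !(rder_linear, rmul_linear) scalerBr.
  by case: (p == q); [rewrite opprD addrACA | rewrite scaler0 !sub0r opprD].
move=> X; have [->|pq] := eqVneq p q.
  rewrite rderU rmulU; case oq: (occ X q).
    rewrite rder0 (linZ (rmul_linear _)) rmulU occ_toggle eqxx oq /= scalerA.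
    by rewrite nsign_toggle ltxx mul1r nsign_sqr scale1r toggleK subrr.
  rewrite rmul0 subr0 (linZ (rder_linear _)) rderU occ_toggle eqxx oq /= scalerA.
  by rewrite nsign_toggle ltxx mul1r nsign_sqr scale1r toggleK.
have qp : q != p by rewrite eq_sym.
rewrite rderU rmulU sub0r; case oq: (occ X q); case op: (occ X p); rewrite ?rder0 ?rmul0 ?oppr0 //;
  rewrite ?(linZ (rder_linear _)) ?(linZ (rmul_linear _)) ?rderU ?rmulU !occ_toggle
    ?oq ?op ?(negbTE pq) ?(negbTE qp) /= ?scaler0 ?oppr0 //.
rewrite !scalerA toggleC -scaleNr; congr (_ *: _).
by rewrite !nsign_toggle (neq_sign pq); ring.
Qed.

End FermionRelations.

Lemma int_parity (q : int) :
  (exists i : int, q = i *+ 2) \/ (exists i : int, q = i *+ 2 + 1).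
Proof.
case: q => n; rewrite -(odd_double_half n).
  case: (odd n) => /=; [right|left]; exists (n./2 : int); lia.
case: (odd n) => /=; [left|right]; exists (- (n./2 : int) - 1); lia.
Qed.

(** * Commutators of the currents *)

Section Currents.
Variables (K : numFieldType) (V : lmodType K) (r d : int -> V -> V).
Implicit Types (p q n m : int) (u : V).

(** The formulas of [e_mode], [f_mode] and [h_mode] for arbitrary operators [r] and [d]: the
    computations use only the anticommutation relations and the other hypotheses listed, not the
    monomials. *)
Definition ecur n u := fsum (fun i => r (i *+ 2) (r ((n - i) *+ 2 + 1) u)).
Definition fcur n u := fsum (fun i => d ((- i) *+ 2 + 1) (d ((- (n - i)) *+ 2) u)).
Definition hcur n u := ecur n (fcur 0 u) - fcur 0 (ecur n u).

Hypothesis r_linear : forall p, linear (r p).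
Hypothesis d_linear : forall p, linear (d p).
Hypothesis r_anti : forall p q u, r p (r q u) = - r q (r p u).
Hypothesis d_anti : forall p q u, d p (d q u) = - d q (d p u).
Hypothesis dr_car : forall p q u, d p (r q u) = (if p == q then u else 0) - r q (d p u).
Hypothesis e_supp : forall n u, fsupp (fun i => r (i *+ 2) (r ((n - i) *+ 2 + 1) u)).
Hypothesis f_supp : forall n u,
  fsupp (fun i => d ((- i) *+ 2 + 1) (d ((- (n - i)) *+ 2) u)).

(** The sign of contracting psi phi with a derivative: psi remains when phi, at an odd position, is
    removed, and -phi when psi, at an even position, is. *)
Definition psign (q : int) : K := if odd `|q|%N then 1 else -1.

Lemma rd_car p q u : r p (d q u) = (if p == q then u else 0) - d q (r p u).
Proof. by rewrite dr_car eq_sym opprB addrCA subrr addr0. Qed.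

Lemma fsum_linear (F : int -> V -> V) : (forall i, linear (F i)) ->
  (forall u, fsupp (fun i => F i u)) -> linear (fun u => fsum (fun i => F i u)).
Proof.
move=> Fl Fs a u v; have [A uA] := fsuppP (Fs u); have [B vB] := fsuppP (Fs v).
rewrite !(@fsumE _ _ (A `|` B)%fset); first last.
- by move=> i; rewrite in_fsetU negb_or => /andP[iA iB]; rewrite Fl uA // vB // scaler0 addr0.
- by move=> i; rewrite in_fsetU negb_or => /andP[/uA].
- by move=> i; rewrite in_fsetU negb_or => /andP[_ /vB].
by rewrite scaler_sumr -big_split; apply: eq_bigr => i _; rewrite Fl.
Qed.

Lemma ecur_linear n : linear (ecur n).
Proof. by apply: fsum_linear => // i a u v; rewrite !r_linear. Qed.

Lemma fcur_linear n : linear (fcur n).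
Proof. by apply: fsum_linear => // i a u v; rewrite !d_linear. Qed.

Lemma hcur_linear n : linear (hcur n).
Proof.
by move=> a u v; rewrite /hcur !(ecur_linear, fcur_linear) scalerBr opprD addrACA.
Qed.

Lemma ecur_r n p u : ecur n (r p u) = r p (ecur n u).
Proof.
rewrite /ecur (fsum_lin (r_linear p)) //; apply: eq_fsum => i.
by rewrite [r (_ + 1) _]r_anti (linN (r_linear _)) r_anti opprK.
Qed.

Lemma fcur_d n p u : fcur n (d p u) = d p (fcur n u).
Proof.
rewrite /fcur (fsum_lin (d_linear p)) //; apply: eq_fsum => i.
by rewrite [d (_ *+ 2) (d _ _)]d_anti (linN (d_linear _)) d_anti opprK.
Qed.

Let ifr p b u : r p (if b then u else 0) = if b then r p u else 0.
Proof. by case: b => //; apply: lin0. Qed.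

Let ifd p b u : d p (if b then u else 0) = if b then d p u else 0.
Proof. by case: b => //; apply: lin0. Qed.

Let sub_cancel (x y z : V) : x - (y - z) - z = x - y.
Proof. by rewrite opprB addrA addrAC addrK. Qed.

(** Exactly one term of the sum contains the variable at position [q], as psi or as phi according to
    the parity of [q]. *)
Lemma ecur_d n q u : ecur n (d q u) = d q (ecur n u) + psign q *: r (n *+ 2 + 1 - q) u.
Proof.
apply/eqP; rewrite addrC -subr_eq; apply/eqP.
rewrite /ecur (fsum_lin (d_linear q)) // fsumB //; last exact: fsupp_lin.
have E i : r (i *+ 2) (r ((n - i) *+ 2 + 1) (d q u)) - d q (r (i *+ 2) (r ((n - i) *+ 2 + 1) u))
   = (if (n - i) *+ 2 + 1 == q then r (i *+ 2) u else 0)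
     - (if q == i *+ 2 then r ((n - i) *+ 2 + 1) u else 0).
  by rewrite [r (_ + 1) (d _ _)]rd_car (linB (r_linear _)) ifr rd_car sub_cancel; congr (_ - _); rewrite eq_sym.
rewrite (eq_fsum E); case: (int_parity q) => -[j qE].
  rewrite (fsum1 (i0 := j)) => [|i ij]; last by rewrite !ifF ?subr0 //; apply/negbTE; lia.
  rewrite ifF ?qE ?eqxx; last by apply/negbTE; lia.
  rewrite /psign ifF; last by apply/negbTE; lia.
  by rewrite sub0r scaleN1r; congr (- r _ _); lia.
rewrite (fsum1 (i0 := n - j)) => [|i ij]; last by rewrite !ifF ?subr0 //; apply/negbTE; lia.
rewrite ifT ?ifF ?subr0 ?qE; [|by apply/negbTE; lia|by apply/eqP; lia].
rewrite /psign ifT; last by lia.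
by rewrite scale1r; congr (r _ _); lia.
Qed.

Lemma fcur_r n q u : fcur n (r q u) = r q (fcur n u) - psign q *: d (1 - n *+ 2 - q) u.
Proof.
apply/eqP; rewrite addrC -subr_eq; apply/eqP.
rewrite /fcur (fsum_lin (r_linear q)) // fsumB //; last exact: fsupp_lin.
have E i : d ((- i) *+ 2 + 1) (d ((- (n - i)) *+ 2) (r q u))
      - r q (d ((- i) *+ 2 + 1) (d ((- (n - i)) *+ 2) u))
   = (if (- (n - i)) *+ 2 == q then d ((- i) *+ 2 + 1) u else 0)
     - (if q == (- i) *+ 2 + 1 then d ((- (n - i)) *+ 2) u else 0).
  by rewrite [d (_ *+ 2) (r _ _)]dr_car (linB (d_linear _)) ifd dr_car sub_cancel; congr (_ - _); rewrite eq_sym.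
rewrite (eq_fsum E); case: (int_parity q) => -[j qE].
  rewrite (fsum1 (i0 := n + j)) => [|i ij]; last by rewrite !ifF ?subr0 //; apply/negbTE; lia.
  rewrite ifT ?ifF ?subr0 ?qE; [|by apply/negbTE; lia|by apply/eqP; lia].
  rewrite /psign ifF; last by apply/negbTE; lia.
  by rewrite scaleN1r opprK; congr (d _ _); lia.
rewrite (fsum1 (i0 := - j)) => [|i ij]; last by rewrite !ifF ?subr0 //; apply/negbTE; lia.
rewrite ifF ?ifT ?sub0r ?qE; [|by apply/eqP; lia|by apply/negbTE; lia].
rewrite /psign ifT; last by lia.
by rewrite scale1r; congr (- d _ _); lia.
Qed.

Lemma ecurC n m u : ecur n (ecur m u) = ecur m (ecur n u).
Proof.
rewrite -[ecur m u]/(fsum _) (fsum_lin (ecur_linear n)) //; apply: eq_fsum => i.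
by rewrite !ecur_r.
Qed.

Lemma fcurC n m u : fcur n (fcur m u) = fcur m (fcur n u).
Proof.
rewrite -[fcur m u]/(fsum _) (fsum_lin (fcur_linear n)) //; apply: eq_fsum => i.
by rewrite !fcur_d.
Qed.

Let ef n m u := ecur n (fcur m u) - fcur m (ecur n u).

Lemma psign_odd p q : odd `|(p + q)%R|%N -> psign p * psign q = -1.
Proof.
move=> pq; have : odd `|p|%N (+) odd `|q|%N by lia.
by rewrite /psign; case: odd; case: odd; rewrite ?mul1r ?mulr1.
Qed.

(** The commutator shifts a fermion by 2(n+m) positions. Only n + m enters, so [e_n, f_m] and
    h_(n+m) have the same commutators with all fermions. *)
Lemma ef_r n m q u : ef n m (r q u) = r q (ef n m u) + r (q + (n + m) *+ 2) u.
Proof.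
rewrite /ef fcur_r (linB (ecur_linear n)) (linZ (ecur_linear n)) !ecur_r ecur_d fcur_r.
rewrite (linB (r_linear q)) scalerDr scalerA psign_odd; last by lia.
have -> : n *+ 2 + 1 - (1 - m *+ 2 - q) = q + (n + m) *+ 2 by lia.
rewrite scaleN1r; move: (r q _) (r q _) (r _ u) (_ *: _) => x y z t.
by rewrite !opprB -addrA subrKA addrA addrAC.
Qed.

Lemma ef_d n m q u : ef n m (d q u) = d q (ef n m u) - d (q - (n + m) *+ 2) u.
Proof.
rewrite /ef fcur_d !ecur_d (linD (fcur_linear m)) (linZ (fcur_linear m)) fcur_r.
rewrite fcur_d (linB (d_linear q)) scalerBr scalerA psign_odd; last by lia.
have -> : 1 - m *+ 2 - (n *+ 2 + 1 - q) = q - (n + m) *+ 2 by lia.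
rewrite scaleN1r opprK; move: (d q _) (d q _) (d _ u) (_ *: _) => x y z t.
by rewrite addrCA addrKA opprD addrA.
Qed.

Lemma hcur_r n q u : hcur n (r q u) = r q (hcur n u) + r (q + n *+ 2) u.
Proof. by have := ef_r n 0 q u; rewrite addr0. Qed.

Lemma hcur_d n q u : hcur n (d q u) = d q (hcur n u) - d (q - n *+ 2) u.
Proof. by have := ef_d n 0 q u; rewrite addr0. Qed.

Let add_cancel (x y z : V) : x + y + z - x = y + z.
Proof. by rewrite -[x + y + z]addrA addrAC subrr add0r. Qed.

Let sub_cancel2 (x y z : V) : x - (x - y - z) = y + z.
Proof. by rewrite -addrA -opprD subKr. Qed.

Lemma hcur_e i j u : hcur i (ecur j u) - ecur j (hcur i u) = ecur (i + j) u *+ 2.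
Proof.
rewrite {1}/ecur (fsum_lin (hcur_linear i)) // fsumB //; last exact: fsupp_lin (hcur_linear i) _.
pose F k := r (k *+ 2) (r ((i + j - k) *+ 2 + 1) u).
rewrite mulr2n {1}[ecur (i + j) u](fsum_shift i F) [ecur (i + j) u]/(fsum F) fsumD //; last first.
- exact: e_supp.
- have [A FA] := fsuppP (e_supp (i + j) u).
  apply: (fsuppW (A := [fset (k - i)%R | k in A]%fset)) => k kA.
  by apply: FA; apply: contra kA => kA; apply/imfsetP; exists (k + i); rewrite ?addrK.
apply: eq_fsum => k; rewrite !hcur_r (linD (r_linear _)) add_cancel.
by rewrite addrC; congr (r _ (r _ u) + r _ (r _ u)); lia.
Qed.

Lemma hcur_f i j u : hcur i (fcur j u) - fcur j (hcur i u) = - (fcur (i + j) u *+ 2).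
Proof.
apply/eqP; rewrite -[_ == _]eqr_opp opprK opprB; apply/eqP.
rewrite {2}/fcur (fsum_lin (hcur_linear i)) // fsumB //; last exact: fsupp_lin (hcur_linear i) _.
pose F k := d ((- k) *+ 2 + 1) (d ((- (i + j - k)) *+ 2) u).
rewrite mulr2n {1}[fcur (i + j) u](fsum_shift i F) [fcur (i + j) u]/(fsum F) fsumD //; last first.
- exact: f_supp.
- have [A FA] := fsuppP (f_supp (i + j) u).
  apply: (fsuppW (A := [fset (k - i)%R | k in A]%fset)) => k kA.
  by apply: FA; apply: contra kA => kA; apply/imfsetP; exists (k + i); rewrite ?addrK.
apply: eq_fsum => k; rewrite !hcur_d (linB (d_linear ((- k) *+ 2 + 1)) (d _ (hcur i u))) sub_cancel2 /F addrC.
by congr (d _ (d _ u) + d _ (d _ u)); lia.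
Qed.

(* [L] is the energy operator and [w m] the vector v(m). *)
Variables (L : V -> V) (w : int -> V).
Hypothesis L_linear : linear L.
Hypothesis L_r : forall p u, L (r p u) = r p (L u) + p%:~R *: r p u.
Hypothesis L_d : forall p u, L (d p u) = d p (L u) - p%:~R *: d p u.
Hypothesis schur : forall T : V -> V, linear T ->
  (forall p u, T (r p u) = r p (T u)) -> (forall p u, T (d p u) = d p (T u)) ->
  exists a : K, forall u, T u = a *: u.
Hypothesis w_neq0 : forall m, w m != 0.
Hypothesis w_r : forall m p, p <= m -> r p (w m) = 0.
Hypothesis w_d : forall m p, m < p -> d p (w m) = 0.
Hypothesis w_up : forall m, r (m + 1) (w m) = w (m + 1).
Hypothesis w_uniq : forall m u, (forall p, p <= m -> r p u = 0) ->
  (forall p, m < p -> d p u = 0) -> exists a, u = a *: w m.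

(** psi(i) and phi(n-i) sit at the positions 2i and 2(n-i)+1, whose sum 2n+1 is independent of i. *)
Lemma L_ecur n u : L (ecur n u) = ecur n (L u) + (n *+ 2 + 1)%:~R *: ecur n u.
Proof.
rewrite {1}/ecur (fsum_lin L_linear) //; apply/eqP; rewrite addrC -subr_eq; apply/eqP.
rewrite fsumB //; last exact: fsupp_lin L_linear _.
rewrite {1}/ecur (fsum_lin (f := *:%R _)) //; last by move=> a x y; rewrite scalerDr !scalerA mulrC.
apply: eq_fsum => i; rewrite !L_r (linD (r_linear _)) (linZ (r_linear _)) add_cancel -scalerDl.
by congr (_ *: _); rewrite -intrD; congr (_%:~R); lia.
Qed.

Lemma L_fcur n u : L (fcur n u) = fcur n (L u) + (n *+ 2 - 1)%:~R *: fcur n u.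
Proof.
rewrite {1}/fcur (fsum_lin L_linear) //; apply/eqP; rewrite addrC -subr_eq; apply/eqP.
rewrite fsumB //; last exact: fsupp_lin L_linear _.
rewrite {1}/fcur (fsum_lin (f := *:%R _)) //; last by move=> a x y; rewrite scalerDr !scalerA mulrC.
apply: eq_fsum => i; rewrite !L_d (linB (d_linear _)) (linZ (d_linear _)).
rewrite -!scaleNr add_cancel -scalerDl.
by congr (_ *: _); rewrite -!intrN -intrD; congr (_%:~R); lia.
Qed.

Let ef_linear n m : linear (ef n m).
Proof.
by move=> a x y; rewrite /ef !(ecur_linear, fcur_linear) opprD addrACA -scalerBr.
Qed.

Lemma L_ef n m u : L (ef n m u) = ef n m (L u) + ((n + m) *+ 2)%:~R *: ef n m u.
Proof.
have efE : L (ecur n (fcur m u)) = ecur n (fcur m (L u)) + ((n + m) *+ 2)%:~R *: ecur n (fcur m u).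
  rewrite L_ecur L_fcur (linD (ecur_linear _)) (linZ (ecur_linear _)) -addrA -scalerDl.
  by rewrite -intrD; congr (_ + _%:~R *: _); lia.
have feE : L (fcur m (ecur n u)) = fcur m (ecur n (L u)) + ((n + m) *+ 2)%:~R *: fcur m (ecur n u).
  rewrite L_fcur L_ecur (linD (fcur_linear _)) (linZ (fcur_linear _)) -addrA -scalerDl.
  by rewrite -intrD; congr (_ + _%:~R *: _); lia.
by rewrite /ef (linB L_linear) efE feE opprD addrACA -scalerBr.
Qed.

Lemma L_hcur n u : L (hcur n u) = hcur n (L u) + (n *+ 2)%:~R *: hcur n u.
Proof. by have := L_ef n 0 u; rewrite addr0. Qed.

(** For n <= 0, commuting h_n past [r p] lowers the position and past [d p] raises it, so both still
    kill v(m); the image satisfies the conditions that determine v(m) up to a scalar. *)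
Lemma hcur_w n m : n <= 0 -> exists a, hcur n (w m) = a *: w m.
Proof.
move=> n0; apply: w_uniq => p pm.
  have := hcur_r n p (w m); rewrite !w_r // ?(lin0 (hcur_linear n)); last by lia.
  by rewrite addr0 => <-.
have := hcur_d n p (w m); rewrite !w_d // ?(lin0 (hcur_linear n)); last by lia.
by rewrite subr0 => <-.
Qed.

Lemma L_w m : exists a, L (w m) = a *: w m.
Proof.
apply: w_uniq => p pm.
  have := L_r p (w m); rewrite !w_r // (lin0 L_linear) scaler0 addr0.
  by move=> <-.
have := L_d p (w m); rewrite !w_d // (lin0 L_linear) scaler0 subr0.
by move=> <-.
Qed.

(** The image is a multiple of v(m), yet h_n changes the energy by 2n. *)
Lemma hcur_w_lt0 n m : n < 0 -> hcur n (w m) = 0.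
Proof.
move=> n0; have [a aE] := hcur_w m (ltW n0); have [b bE] := L_w m.
have := L_hcur n (w m); rewrite bE (linZ (hcur_linear n)) aE (linZ L_linear) bE.
rewrite !scalerA [b * a]mulrC -[LHS]addr0 => /addrI /esym/eqP.
rewrite scaler_eq0 (negbTE (w_neq0 m)) orbF mulf_eq0 intr_eq0 => /orP[|/eqP ->].
  by move=> /eqP; lia.
by rewrite scale0r.
Qed.

Lemma ecur_w n m : n <= m -> ecur n (w m) = 0.
Proof.
move=> nm; rewrite /ecur -(fsum0 V); apply: eq_fsum => i.
have [bm|bm] := leP ((n - i) *+ 2 + 1) m; first by rewrite (w_r bm) (lin0 (r_linear _)).
by rewrite r_anti w_r ?(lin0 (r_linear _)) ?oppr0 //; lia.
Qed.

Lemma fcur_w n m : n < 1 - m -> fcur n (w m) = 0.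
Proof.
move=> nm; rewrite /fcur -(fsum0 V); apply: eq_fsum => i.
have [bm|bm] := ltP m ((- (n - i)) *+ 2); first by rewrite (w_d bm) (lin0 (d_linear _)).
by rewrite d_anti w_d ?(lin0 (d_linear _)) ?oppr0 //; lia.
Qed.

(** h_0 measures the charge: it grows by 1 with each added fermion, and it is 0 on v(0), which e_0
    and f_0 both kill. *)
Lemma hcur0_w m : hcur 0 (w m) = m%:~R *: w m.
Proof.
have step p a : hcur 0 (w p) = a *: w p <-> hcur 0 (w (p + 1)) = (a + 1) *: w (p + 1).
  have [b bE] := hcur_w p (lexx 0).
  have E : hcur 0 (w (p + 1)) = (b + 1) *: w (p + 1).
    rewrite -w_up hcur_r bE mul0rn addr0 (linZ (r_linear _)) scalerDl scale1r //.
  have inj q x y : x *: w q = y *: w q -> x = y.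
    move/eqP; rewrite -subr_eq0 -scalerBl scaler_eq0 (negbTE (w_neq0 q)) orbF subr_eq0.
    by move/eqP.
  rewrite bE E; split=> /inj; first by move=> ->.
  by move/addIr => ->.
have base : hcur 0 (w 0) = 0%:~R *: w 0.
  by rewrite /hcur ecur_w // fcur_w // (lin0 (ecur_linear _)) (lin0 (fcur_linear _)) subr0 scale0r.
elim/int_rec: m => [|n IH|n IH] //.
  by rewrite -addn1 PoszD intrD; apply/(step n); exact: IH.
have -> : - (n.+1 : int) = - (n : int) - 1 by lia.
apply/(step (- (n : int) - 1)); rewrite subrK intrB subrK; exact: IH.
Qed.

(** The difference from h_(n+m) is a scalar by [schur]. It shifts the energy by 2(n+m), hence is 0
    unless m = -n; then it is read off on v(n), which e_n and f_(-n) kill and on which h_0 is n. *)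
Lemma comm_ef n m u : ecur n (fcur m u) - fcur m (ecur n u) =
  hcur (n + m) u - (if n + m == 0 then n%:~R else 0) *: u.
Proof.
rewrite -[LHS]/(ef n m u).
have [|p v|p v|a aE] := schur (T := fun v => ef n m v - hcur (n + m) v).
- by move=> a x y; rewrite ef_linear hcur_linear opprD addrACA -scalerBr.
- by rewrite ef_r hcur_r opprD addrACA subrr addr0 (linB (r_linear _)).
- by rewrite ef_d hcur_d opprB addrA subrK (linB (d_linear _)).
suff -> : (if n + m == 0 then n%:~R else 0) = - a :> K.
  by rewrite scaleNr opprK -aE addrC subrK.
case: eqP => [nm|/eqP nm]; last first.
  have := L_ef n m (w 0); have [b bE] := L_w 0.
  have efE v : ef n m v = hcur (n + m) v + a *: v by rewrite -aE addrC subrK.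
  rewrite !efE (linD L_linear) L_hcur (linZ L_linear) (scalerDr _ (hcur _ _)) [RHS]addrA.
  rewrite [X in _ = X + _]addrAC -[LHS]addr0 => /addrI/esym/eqP; rewrite scalerA scaler_eq0 (negbTE (w_neq0 _)).
  rewrite orbF mulf_eq0 intr_eq0 mulrn_eq0 (negbTE nm) /= => /eqP ->.
  by rewrite oppr0.
have := aE (w n); rewrite /ef ecur_w // fcur_w ?(lin0 (ecur_linear _)) ?(lin0 (fcur_linear _)); last by lia.
rewrite subr0 sub0r nm hcur0_w => /eqP.
by rewrite -scaleNr -subr_eq0 -scalerBl scaler_eq0 (negbTE (w_neq0 n)) orbF subr_eq0 => /eqP <-; rewrite opprK.
Qed.

(** Substitute h_j = [e_j, f_0]. The brackets with h_i leave twice the difference of [e_(i+j), f_0]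
    and [e_j, f_i], which is a central term. *)
Lemma hcurC i j u : hcur i (hcur j u) - hcur j (hcur i u) =
  - (2 * (if i + j == 0 then i%:~R else 0)) *: u.
Proof.
have he k x : hcur i (ecur k x) = ecur k (hcur i x) + ecur (i + k) x *+ 2.
  by rewrite -hcur_e addrC subrK.
have hf k x : hcur i (fcur k x) = fcur k (hcur i x) - fcur (i + k) x *+ 2.
  by rewrite -hcur_f addrC subrK.
have E1 : hcur i (ecur j (fcur 0 u)) = ecur j (fcur 0 (hcur i u)) - ecur j (fcur i u) *+ 2
    + ecur (i + j) (fcur 0 u) *+ 2.
  rewrite he hf addr0 (linB (ecur_linear j)) -!scaler_nat (linZ (ecur_linear j)).
  by [].
have E2 : hcur i (fcur 0 (ecur j u)) = fcur 0 (ecur j (hcur i u)) + fcur 0 (ecur (i + j) u) *+ 2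
    - fcur i (ecur j u) *+ 2.
  rewrite hf he addr0 (linD (fcur_linear 0)) -!scaler_nat (linZ (fcur_linear 0)).
  by [].
have -> : hcur i (hcur j u) = hcur i (ecur j (fcur 0 u)) - hcur i (fcur 0 (ecur j u)).
  by rewrite /(hcur j u) (linB (hcur_linear i)).
have -> : hcur j (hcur i u) = ecur j (fcur 0 (hcur i u)) - fcur 0 (ecur j (hcur i u)) by [].
rewrite E1 E2; have C := comm_ef j i u; rewrite [j + i]addrC in C.
have H : hcur (i + j) u = ecur (i + j) (fcur 0 u) - fcur 0 (ecur (i + j) u) by [].
rewrite H in C.
move: (ecur j (fcur 0 _)) (fcur 0 (ecur j _)) (ecur j (fcur i u)) (fcur i (ecur j u))
  (ecur (i + j) _) (fcur 0 (ecur (i + j) u)) C => A B X Y P Q C.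
have -> : A - X *+ 2 + P *+ 2 - (B + Q *+ 2 - Y *+ 2) - (A - B) = (P - Q - (X - Y)) *+ 2.
  rewrite !mulrnBl; move: (X *+ 2) (Y *+ 2) (P *+ 2) (Q *+ 2) => x y p q.
  rewrite !opprB opprD !addrA.
  by rewrite [LHS](ACl (1*8*5*7*3*6*4*2)%AC) /= subrr add0r addNr add0r.
rewrite C subKr -scaler_nat scalerA; congr (_ *: u).
by case: eqP => ij; rewrite ?mulr0 ?oppr0 // (_ : j = - i) ?intrN ?mulrN //; lia.
Qed.

(** At this mode only the pair of variables at the first free positions m+1 and m+2 survives; the
    sign records whether psi or phi comes first. *)
Lemma ecur_w_next m : ecur (m + 1) (w m) = psign (m + 1) *: w (m + 2).
Proof.
have w2 : r (m + 2) (r (m + 1) (w m)) = w (m + 2).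
  by rewrite w_up -[2]/(1 + 1) addrA w_up.
case: (int_parity m) => -[j mE].
  rewrite /ecur (fsum1 (i0 := j + 1)) => [|i ij]; last first.
    have [bm|bm] := leP ((m + 1 - i) *+ 2 + 1) m; first by rewrite (w_r bm) (lin0 (r_linear _)).
    by rewrite r_anti w_r ?(lin0 (r_linear _)) ?oppr0 //; lia.
  rewrite /psign ifT; last by lia.
  by rewrite scale1r -w2; congr (r _ (r _ _)); lia.
rewrite /ecur (fsum1 (i0 := j + 1)) => [|i ij]; last first.
  have [bm|bm] := leP ((m + 1 - i) *+ 2 + 1) m; first by rewrite (w_r bm) (lin0 (r_linear _)).
  by rewrite r_anti w_r ?(lin0 (r_linear _)) ?oppr0 //; lia.
rewrite /psign ifF; last by apply/negbTE; lia.
by rewrite scaleN1r -w2 r_anti; congr (- r _ (r _ _)); lia.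
Qed.

Let r3_w m p q s : (p <= m) || (q <= m) || (s <= m) -> r p (r q (r s (w m))) = 0.
Proof.
have r0 x : r x 0 = 0 by exact: lin0.
case/orP => [/orP[pm|qm]|sm]; last by rewrite (w_r sm) !r0.
  by rewrite r_anti [r p _]r_anti (linN (r_linear _)) (w_r pm) !(r0, oppr0).
by rewrite [r q _]r_anti (linN (r_linear _)) (w_r qm) !(r0, oppr0).
Qed.

Let r3_rev p q s u : r p (r q (r s u)) = - r s (r q (r p u)).
Proof. by rewrite (r_anti p q) (r_anti p s) (linN (r_linear q)) opprK r_anti. Qed.

Let fsum_anti (F : int -> V) (a : int) : fsupp F -> (forall i, F (a - i) = - F i) -> fsum F = 0.
Proof.
move=> Fs Fa; have : fsum F = - fsum F.
  rewrite {1}(fsum_rev a) (fsum_lin (f := -%R)) //; last by move=> b x y; rewrite opprD scalerN.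
  exact: eq_fsum.
move/eqP; rewrite -subr_eq0 opprK -mulr2n -scaler_nat scaler_eq0 pnatr_eq0 /=.
by move/eqP.
Qed.

(** A window outside which the terms of the double sums below vanish; its size is generous, only
    finiteness matters. *)
Let box (m N : int) : {fset int} :=
  fset_set [set i | - ((`|m| + `|N|)%N *+ 4 + 4)%:Z <= i /\ i <= ((`|m| + `|N|)%N *+ 4 + 4)%:Z]%classic.

Let notin_box m N i : i \notin box m N ->
  i < - ((`|m| + `|N|)%N *+ 4 + 4)%:Z \/ ((`|m| + `|N|)%N *+ 4 + 4)%:Z < i.
Proof.
rewrite in_fset_set; last exact: finite_int_itv.
move=> /negP ni; have [|h1] := ltP i (- ((`|m| + `|N|)%N *+ 4 + 4)%:Z); first by left.
have [|h2] := ltP ((`|m| + `|N|)%N *+ 4 + 4)%:Z i; first by right.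
by case: ni; rewrite inE.
Qed.

Let r_ecur_w m M : fsum (fun j => r ((M - j) *+ 2 + 1) (ecur j (w m))) = 0.
Proof.
rewrite (eq_fsum (G := fun j => fsum (fun i =>
    r ((M - j) *+ 2 + 1) (r (i *+ 2) (r ((j - i) *+ 2 + 1) (w m)))))); last first.
  by move=> j; rewrite /ecur (fsum_lin (r_linear _)).
rewrite (@fsum_exchange _ _ (box m M)) => [|j i /orP[]/notin_box h]; last 2 first.
- by apply: r3_w; lia.
- by apply: r3_w; lia.
rewrite -(fsum0 V); apply: eq_fsum => i; apply: (@fsum_anti _ (M + i)).
  by apply: (fsuppW (A := box m M)) => j /notin_box h; apply: r3_w; lia.
move=> j; have -> : (M - (M + i - j)) *+ 2 + 1 = (j - i) *+ 2 + 1 by lia.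
have -> : (M + i - j - i) *+ 2 + 1 = (M - j) *+ 2 + 1 by lia.
move: (_ + 1) (_ + 1) => a b.
exact: r3_rev.
Qed.

(** e(z)^2 contains phi(z) twice, and the terms of phi(z)^2 cancel in pairs by anticommutativity, as
    in [r_ecur_w]. *)
Lemma ecur_sq_w m N : fsum (fun j => ecur j (ecur (N - j) (w m))) = 0.
Proof.
pose G j i := r (i *+ 2) (r ((N - i - j) *+ 2 + 1) (ecur j (w m))).
have G0 j i : (i *+ 2 <= m) || ((N - i - j) *+ 2 + 1 <= m) || (j <= m) -> G j i = 0.
  rewrite /G -orbA => /or3P[h|h|h]; last by rewrite ecur_w // !(lin0 (r_linear _)).
    by rewrite -!ecur_r r_anti (w_r h) !(lin0 (r_linear _), lin0 (ecur_linear _), oppr0).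
  by rewrite -ecur_r (w_r h) !(lin0 (r_linear _), lin0 (ecur_linear _)).
rewrite (eq_fsum (G := fun j => fsum (G j))); last first.
  by move=> j; rewrite ecurC /ecur; apply: eq_fsum => i; congr (r _ (r _ _)); lia.
rewrite (@fsum_exchange _ _ (box m N)) => [|j i /orP[]/notin_box h]; last 2 first.
- by apply: G0; lia.
- by apply: G0; lia.
rewrite -(fsum0 V); apply: eq_fsum => i.
have [im|mi] := leP (i *+ 2) m; first by rewrite -[RHS](fsum0 V); apply: eq_fsum => j; apply: G0; rewrite im.
rewrite /G -(fsum_lin (f := r (i *+ 2))) //; first by rewrite r_ecur_w (lin0 (r_linear _)).
apply: (fsuppW (A := box m (N - i))) => j /notin_box h.
have [jm|mj] := leP j m; first by rewrite ecur_w // (lin0 (r_linear _)).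
by rewrite -ecur_r w_r ?(lin0 (ecur_linear _)) //; lia.
Qed.

Lemma ecur_sq_sum m (t : int) (n : nat) : t <= m + 1 ->
  \sum_(j < n.+1) ecur (t + (j : nat)%:Z) (ecur (t + (n - j)%N%:Z) (w m)) = 0.
Proof.
move=> tm; have := ecur_sq_w m (t *+ 2 + n%:Z); rewrite (fsum_shift t) (@fsum_ord _ _ n) => [E|i ni].
  rewrite -[RHS]E; apply: eq_bigr => j _.
  by congr (ecur _ (ecur _ _)); have := ltn_ord j; lia.
have [im|mi] := leP (i + t) m; first by rewrite ecurC ecur_w // (lin0 (ecur_linear _)).
by rewrite ecur_w ?(lin0 (ecur_linear _)) //; lia.
Qed.

End Currents.

Lemma lin_addZ (K : fieldType) (V : lmodType K) (a b : K) (x y z t : V) :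
  a *: x + y + b *: (a *: z + t) = a *: (x + b *: z) + (y + b *: t).
Proof. by rewrite !scalerDr !scalerA mulrC addrACA. Qed.

Lemma scaler_swap (K : fieldType) (V : lmodType K) (a b : K) (x : V) :
  a *: (b *: x) = b *: (a *: x).
Proof. by rewrite !scalerA mulrC. Qed.

(** * The currents on the Fock space *)

Section FockCurrents.
Variable K : numFieldType.
Local Notation r := (@rmul_var K).
Local Notation d := (@rder_var K).

(** The total position relative to the sea of all p < 0: an added p >= 0 counts p, a removed p < 0
    counts -p. *)
Definition energy (X : semimon) : int := \sum_(p <- X) `|p|.

Lemma energy_toggle X p : energy (toggle X p) = energy X + (if occ X p then - p else p).
Proof.
rewrite /energy /toggle /occ; case: (boolP (p \in X)) => pX.
  rewrite [in RHS](big_fsetD1 _ pX) /= addrAC.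
  by case: (ltP p 0) => p0 /=; [rewrite ltr0_norm | rewrite ger0_norm]; rewrite ?addNr ?subrr ?add0r.
rewrite big_fsetU1 //= addrC addbF; congr (_ + _).
by case: (ltP p 0) => p0; [rewrite ltr0_norm | rewrite ger0_norm].
Qed.

Definition energy_op : Fock K -> Fock K := lin_ext (fun X => (energy X)%:~R *: << X >>).

Lemma energy_op_linear : linear energy_op. Proof. exact: lin_ext_is_linear. Qed.

Lemma energy_opU X : energy_op << X >> = (energy X)%:~R *: << X >>.
Proof. exact: lin_extU. Qed.

Lemma energy_rmul p u : energy_op (r p u) = r p (energy_op u) + p%:~R *: r p u.
Proof.
move: u; apply: linear_malg_ext.
- by move=> a u v; rewrite rmul_linear energy_op_linear.
- by move=> a u v; rewrite !(rmul_linear, energy_op_linear) lin_addZ.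
move=> X; rewrite energy_opU (linZ (rmul_linear _)) -scalerDl rmulU.
case oX: (occ X p); first by rewrite scaler0 (lin0 energy_op_linear).
by rewrite (linZ energy_op_linear) energy_opU energy_toggle oX !scalerA intrD mulrC.
Qed.

Lemma energy_rder_opp p u :
  energy_op (d p u) = d p (energy_op u) + (- p)%:~R *: d p u.
Proof.
move: u; apply: linear_malg_ext.
- by move=> a u v; rewrite rder_linear energy_op_linear.
- by move=> a u v; rewrite (energy_op_linear a u v) !rder_linear lin_addZ.
move=> X; rewrite energy_opU (linZ (rder_linear _)) -scalerDl rderU.
case oX: (occ X p); last by rewrite scaler0 (lin0 energy_op_linear).
by rewrite (linZ energy_op_linear) energy_opU energy_toggle oX !scalerA intrD mulrC.
Qed.

Lemma energy_rder p u : energy_op (d p u) = d p (energy_op u) - p%:~R *: d p u.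
Proof. by rewrite energy_rder_opp intrN scaleNr. Qed.

Definition vvec (m : int) : Fock K := << vmon m >>.

Lemma vvec_neq0 m : vvec m != 0.
Proof. by rewrite monalgU_eq0 oner_eq0. Qed.

Lemma rmul_vvec m p : p <= m -> r p (vvec m) = 0.
Proof. by move=> pm; rewrite /vvec rmulU occ_vmon pm. Qed.

Lemma rder_vvec m p : m < p -> d p (vvec m) = 0.
Proof. by move=> pm; rewrite /vvec rderU occ_vmon leNgt pm. Qed.

Lemma rmul_vvec_next m : r (m + 1) (vvec m) = vvec (m + 1).
Proof.
rewrite /vvec rmulU occ_vmon ifF; last by apply/negbTE; lia.
have -> : nsign K (vmon m) (m + 1) = 1.
  rewrite /nsign; suff -> : nright (vmon m) (m + 1) = 0%N by [].
  apply/eqP; rewrite cardfs_eq0; apply/eqP/fsetP => q.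
  by rewrite in_nright occ_vmon in_fset0; lia.
rewrite scale1r; congr << _ >>; apply: occ_inj => q.
by rewrite occ_toggle !occ_vmon; lia.
Qed.

Lemma coef_rmul p u X : (r p u)@_(toggle X p) = if occ X p then 0 else nsign K X p * u@_X.
Proof.
move: u; apply: (@linear_malg_ext _ _ K^o).
- by move=> a u v; rewrite rmul_linear mcoeffD mcoeffZ.
- move=> a u v; case: (occ X p); first by rewrite scaler0 addr0.
  by rewrite mcoeffD mcoeffZ mulrDr mulrCA.
move=> Y; rewrite rmulU; have [->|XY] := eqVneq Y X.
  by case: (occ X p); rewrite ?mcoeff0 // mcoeffZ !mcoeffUU.
rewrite mcoeffU (negbTE XY) mulr0 if_same; case: (occ Y p); first by rewrite mcoeff0.
by rewrite mcoeffZ mcoeffU (inj_eq (can_inj (toggleK p))) (negbTE XY) mulr0.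
Qed.

Lemma coef_rder p u X : (d p u)@_(toggle X p) = if occ X p then nsign K X p * u@_X else 0.
Proof.
move: u; apply: (@linear_malg_ext _ _ K^o).
- by move=> a u v; rewrite rder_linear mcoeffD mcoeffZ.
- move=> a u v; case: (occ X p); last by rewrite scaler0 addr0.
  by rewrite mcoeffD mcoeffZ mulrDr mulrCA.
move=> Y; rewrite rderU; have [->|XY] := eqVneq Y X.
  by case: (occ X p); rewrite ?mcoeff0 // mcoeffZ !mcoeffUU.
rewrite mcoeffU (negbTE XY) mulr0 if_same; case: (occ Y p); last by rewrite mcoeff0.
by rewrite mcoeffZ mcoeffU (inj_eq (can_inj (toggleK p))) (negbTE XY) mulr0.
Qed.

(** A monomial other than v(m) differs from it at some position p, and then [r p] or [d p] preserves
    its coefficient up to sign. *)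
Lemma vvec_uniq m u : (forall p, p <= m -> r p u = 0) -> (forall p, m < p -> d p u = 0) ->
  exists a, u = a *: vvec m.
Proof.
move=> ru du; exists u@_(vmon m); apply/malgP => X; rewrite mcoeffZ mcoeffU.
have [->|Xm] := eqVneq (vmon m) X; first by rewrite mulr1.
rewrite mulr0; apply/eqP/negPn/negP => uX.
have nz p : nsign K X p * u@_X != 0 by rewrite mulf_neq0 // signr_eq0.
case/eqP: Xm; apply: occ_inj => p; rewrite occ_vmon.
have [pm|mp] := leP p m; apply/esym.
  have := coef_rmul p u X; rewrite ru // mcoeff0.
  by case: (occ X p) => // /esym/eqP; rewrite (negbTE (nz p)).
have := coef_rder p u X; rewrite du // mcoeff0.
by case: (occ X p) => // /esym/eqP; rewrite (negbTE (nz p)).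
Qed.

(** [T] is scalar on v(-1) by [vvec_uniq], and the fermions reach every monomial from v(-1), encoded
    by the empty set, by toggling one position at a time. *)
Lemma Fock_schur (T : Fock K -> Fock K) : linear T ->
  (forall p u, T (r p u) = r p (T u)) -> (forall p u, T (d p u) = d p (T u)) ->
  exists a : K, forall u, T u = a *: u.
Proof.
move=> Tl Tr Td; have [|p pm|a aE] := @vvec_uniq (-1) (T (vvec (-1))).
- by move=> p pm; rewrite -Tr rmul_vvec // (lin0 Tl).
- by rewrite -Td rder_vvec // (lin0 Tl).
exists a; apply: (linear_malg_ext Tl (lin_scale a)).
move=> X; move: {2}#|` X| (erefl #|` X|) => n; elim: n X => [|n IH] X.
  move/eqP; rewrite cardfs_eq0 => /eqP ->.
  suff E : vmon (-1) = fset0 by rewrite -E; exact: aE.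
  by apply: occ_inj => p; rewrite occ_vmon /occ in_fset0 addbF; lia.
move=> cX; have /fset0Pn[p pX] : X != fset0 by rewrite -cardfs_eq0 cX.
have E : X = toggle (X `\ p)%fset p by rewrite /toggle !inE eqxx /= fsetD1K.
have /IH TX : #|` (X `\ p)%fset| = n by have := cardfsD1 p X; rewrite pX cX; lia.
have nz q Y : nsign K Y q != 0 by rewrite signr_eq0.
case oX: (occ (X `\ p)%fset p).
  have -> : << X >> = (nsign K (X `\ p)%fset p)^-1 *: d p << (X `\ p)%fset >>.
    by rewrite rderU oX scalerA (mulVf (nz _ _)) scale1r -E.
  rewrite (linZ Tl) Td TX (linZ (rder_linear p)); exact: scaler_swap.
have -> : << X >> = (nsign K (X `\ p)%fset p)^-1 *: r p << (X `\ p)%fset >>.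
  by rewrite rmulU oX scalerA (mulVf (nz _ _)) scale1r -E.
rewrite (linZ Tl) Tr TX (linZ (rmul_linear p)); exact: scaler_swap.
Qed.

Let rl := @rmul_linear K.
Let dl := @rder_linear K.
Let ra := @rmul_anti K.
Let da := @rder_anti K.
Let car := @rder_rmul K.
Let es : forall n u, fsupp (fun i => r (i *+ 2) (r ((n - i) *+ 2 + 1) u)) :=
  @finite_e_mode K.
Let fs : forall n u, fsupp (fun i => d ((- i) *+ 2 + 1) (d ((- (n - i)) *+ 2) u)) :=
  @finite_f_mode K.

Lemma e_mode_linear n : linear (@e_mode K n).
Proof. exact: (ecur_linear rl es). Qed.

Lemma f_mode_linear n : linear (@f_mode K n).
Proof. exact: (fcur_linear dl fs). Qed.

Lemma h_mode_linear n : linear (@h_mode K n).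
Proof. exact: (hcur_linear rl dl es fs). Qed.

Lemma e_modeC n m u : e_mode n (e_mode m u) = e_mode m (e_mode n u) :> Fock K.
Proof. exact: (ecurC rl ra es). Qed.

Lemma f_modeC n m u : f_mode n (f_mode m u) = f_mode m (f_mode n u) :> Fock K.
Proof. exact: (fcurC dl da fs). Qed.

Lemma e_mode_rmul n p u : e_mode n (r p u) = r p (e_mode n u).
Proof. exact: (ecur_r rl ra es). Qed.

Lemma comm_e_f n m u : e_mode n (f_mode m u) - f_mode m (e_mode n u) =
  h_mode (n + m) u - (if n + m == 0 then n%:~R else 0) *: u :> Fock K.
Proof.
exact: (comm_ef rl dl ra da car es fs energy_op_linear energy_rmul energy_rder Fock_schur
  vvec_neq0 rmul_vvec rder_vvec rmul_vvec_next vvec_uniq).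
Qed.

Lemma comm_h_e i j u : h_mode i (e_mode j u) - e_mode j (h_mode i u) =
  e_mode (i + j) u *+ 2 :> Fock K.
Proof. exact: (hcur_e rl dl ra car es fs). Qed.

Lemma comm_h_f i j u : h_mode i (f_mode j u) - f_mode j (h_mode i u) =
  - (f_mode (i + j) u *+ 2) :> Fock K.
Proof. exact: (hcur_f rl dl da car es fs). Qed.

Lemma comm_h_h i j u : h_mode i (h_mode j u) - h_mode j (h_mode i u) =
  - (2 * (if i + j == 0 then i%:~R else 0)) *: u :> Fock K.
Proof.
exact: (hcurC rl dl ra da car es fs energy_op_linear energy_rmul energy_rder Fock_schur
  vvec_neq0 rmul_vvec rder_vvec rmul_vvec_next vvec_uniq).
Qed.

Lemma energy_e n u : energy_op (e_mode n u) =
  e_mode n (energy_op u) + (n *+ 2 + 1)%:~R *: e_mode n u.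
Proof. exact: (L_ecur rl es energy_op_linear energy_rmul). Qed.

Lemma e_vvec n m : n <= m -> e_mode n (vvec m) = 0.
Proof. exact: (ecur_w rl ra rmul_vvec). Qed.

Lemma f_vvec n m : n < 1 - m -> f_mode n (vvec m) = 0.
Proof. exact: (fcur_w dl da rder_vvec). Qed.

Lemma h_vvec n m : n < 0 -> h_mode n (vvec m) = 0.
Proof.
exact: (hcur_w_lt0 rl dl ra da car es fs energy_op_linear energy_rmul energy_rder
  vvec_neq0 rmul_vvec rder_vvec vvec_uniq).
Qed.

Lemma e_vvec_next m : e_mode (m + 1) (vvec m) = psign K (m + 1) *: vvec (m + 2).
Proof. exact: (ecur_w_next rl ra rmul_vvec rmul_vvec_next). Qed.

Lemma e_sq_vvec m (t : int) (n : nat) : t <= m + 1 ->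
  \sum_(j < n.+1) e_mode (t + (j : nat)%:Z) (e_mode (t + (n - j)%N%:Z) (vvec m)) = 0.
Proof. exact: (ecur_sq_sum rl ra es rmul_vvec). Qed.

End FockCurrents.

(** * Operators on the tensor power *)

Lemma lin_addZr (K : fieldType) (V : lmodType K) (a b : K) (x y z t : V) :
  a *: (b *: x + y) + (b *: z + t) = b *: (a *: x + z) + (a *: y + t).
Proof. by rewrite !scalerDr !scalerA mulrC addrACA. Qed.

Lemma sum_commute (K : fieldType) (V : lmodType K) (k : nat) (A B : 'I_k -> V -> V) (u : V) :
  (forall a, linear (A a)) -> (forall a, linear (B a)) ->
  (forall a b, a != b -> A a (B b u) = B b (A a u)) ->
  \sum_(a < k) A a (\sum_(b < k) B b u) - \sum_(b < k) B b (\sum_(a < k) A a u)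
  = \sum_(a < k) (A a (B a u) - B a (A a u)).
Proof.
move=> Al Bl AB.
under eq_bigr => a _ do rewrite lin_sum //.
under [X in _ - X]eq_bigr => b _ do rewrite lin_sum //.
rewrite [X in _ - X]exchange_big -sumrB; apply: eq_bigr => a _ /=.
rewrite -sumrB (bigD1 a) //= big1 ?addr0 // => b ba.
by rewrite AB ?subrr // eq_sym.
Qed.

(** The operator [T] in the tensor factor [a], without sign. Locked so that conversion does not
    unfold the linear extension. *)
HB.lock Definition place (K : numFieldType) (k : nat) (a : 'I_k) (T : Fock K -> Fock K)
  : FockT K k -> FockT K k := lin_ext (fun t => put t a (T << t a >>)).

Section TensorPower.
Variables (K : numFieldType) (k : nat).
Local Notation F := (Fock K).
Local Notation FT := (FockT K k).
Local Notation idx := {ffun 'I_k -> semimon}.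
Implicit Types (T S : F -> F) (t : idx) (a b : 'I_k).

Definition upd t a (X : semimon) : idx := [ffun b => if b == a then X else t b].

Lemma updE t a X b : upd t a X b = if b == a then X else t b.
Proof. by rewrite ffunE. Qed.

Lemma upd_id t a : upd t a (t a) = t.
Proof. by apply/ffunP => b; rewrite updE; case: eqP => // ->. Qed.

Lemma upd_upd t a X Y : upd (upd t a X) a Y = upd t a Y.
Proof. by apply/ffunP => b; rewrite !updE; case: eqP. Qed.

Lemma updC t a b X Y : a != b -> upd (upd t a X) b Y = upd (upd t b Y) a X.
Proof.
move=> ab; apply/ffunP => c; rewrite !updE; case: (eqVneq c b) => // ->.
by rewrite eq_sym (negbTE ab).
Qed.

Local Notation place := (@place K k).

Lemma place_linear a T : linear (place a T).
Proof. by rewrite place.unlock; exact: lin_ext_is_linear. Qed.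

Lemma put_linear t a : linear (@put K k t a). Proof. exact: lin_ext_is_linear. Qed.

Lemma putU t a X : put t a << X >> = << upd t a X >> :> FT.
Proof. exact: lin_extU. Qed.

Lemma placeU a T t : place a T << t >> = put t a (T << t a >>).
Proof. by rewrite place.unlock; exact: lin_extU. Qed.

Lemma put_upd t a X (u : F) : put (upd t a X) a u = put t a u.
Proof.
move: u; apply: linear_malg_ext; [exact: put_linear|exact: put_linear|].
by move=> Y; rewrite !putU upd_upd.
Qed.

Lemma place_put a T t u : linear T -> place a T (put t a u) = put t a (T u).
Proof.
move=> Tl; move: u; apply: linear_malg_ext.
- exact: lin_comp (place_linear a T) (put_linear t a).
- exact: lin_comp (put_linear t a) Tl.
by move=> X; rewrite putU placeU updE eqxx put_upd.
Qed.

Lemma place_comp a T S u : linear T -> place a T (place a S u) = place a (T \o S) u.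
Proof.
move=> Tl; move: u; apply: linear_malg_ext.
- exact: lin_comp (place_linear a T) (place_linear a S).
- exact: place_linear.
by move=> t; rewrite !placeU place_put.
Qed.

(** On a basis vector both sides are the same double sum over the supports of the two images. *)
Lemma placeC a b T S u : a != b -> place a T (place b S u) = place b S (place a T u).
Proof.
move=> ab; have ba : b != a by rewrite eq_sym.
have E c d (P Q : F -> F) t : c != d -> place c P (place d Q << t >>) =
    \sum_(Y <- msupp (Q << t d >>)) \sum_(X <- msupp (P << t c >>))
      ((Q << t d >>)@_Y * (P << t c >>)@_X) *: << upd (upd t c X) d Y >>.
  move=> cd; rewrite placeU {1}(malgEZ (Q << t d >>)) (lin_sum (put_linear t d)).
  rewrite (lin_sum (place_linear c P)); apply: eq_bigr => Y _.
  rewrite (linZ (put_linear t d)) putU (linZ (place_linear c P)) placeU.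
  rewrite updE (negbTE cd) {1}(malgEZ (P << t c >>)) (lin_sum (put_linear _ c)) scaler_sumr.
  apply: eq_bigr => X _; rewrite (linZ (put_linear _ c)) putU scalerA.
  by rewrite updC // eq_sym.
move: u; apply: linear_malg_ext.
- exact: lin_comp (place_linear a T) (place_linear b S).
- exact: lin_comp (place_linear b S) (place_linear a T).
move=> t; rewrite (E a b T S t ab) (E b a S T t ba) exchange_big.
apply: eq_bigr => X _; apply: eq_bigr => Y _.
by rewrite mulrC updC.
Qed.

Lemma coproductE T u : coproduct T u = \sum_(a < k) place a T u.
Proof.
move: u; apply: linear_malg_ext; first exact: lin_ext_is_linear.
  move=> c u v; rewrite scaler_sumr -big_split; apply: eq_bigr => a _; exact: place_linear.
move=> t; rewrite /coproduct lin_extU; apply: eq_bigr => a _; by rewrite placeU.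
Qed.

Lemma coproduct_linear T : linear (@coproduct K k T).
Proof. exact: lin_ext_is_linear. Qed.

Lemma place_linear_op a (x : K) T S u :
  place a (fun v => x *: T v + S v) u = x *: place a T u + place a S u.
Proof.
move: u; apply: linear_malg_ext; first exact: place_linear.
- move=> y u v; rewrite !place_linear; exact: lin_addZr.
by move=> t; rewrite !placeU put_linear.
Qed.

Lemma coproduct_linear_op (x : K) T S u :
  coproduct (fun v => x *: T v + S v) u = x *: coproduct T u + coproduct S u :> FT.
Proof.
rewrite !coproductE scaler_sumr -big_split; apply: eq_bigr => a _.
exact: place_linear_op.
Qed.

Lemma coproduct_comm T S u : linear T -> linear S ->
  coproduct T (coproduct S u) - coproduct S (coproduct T u)
  = coproduct (fun v => T (S v) - S (T v)) u :> FT.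
Proof.
move=> Tl Sl; rewrite !coproductE.
apply: etrans (sum_commute (place_linear^~ T) (place_linear^~ S) _) _.
  by move=> a b ab; apply: placeC.
apply: eq_bigr => a _; apply: etrans (_ : place a (T \o S) u - place a (S \o T) u = _).
  by congr (_ - _); apply: place_comp.
rewrite addrC -scaleN1r; apply: etrans (esym (place_linear_op _ _ _ _ _)) _.
by congr (place a _ u); apply: funext => v /=; rewrite scaleN1r addrC.
Qed.

Lemma coproduct_lin_ext (I : choiceType) (G : I -> F -> F) (z : {malg K[I]}) u :
  coproduct (fun v => lin_ext (G^~ v) z) u = lin_ext (fun c => coproduct (G c) u) z :> FT.
Proof.
move: z; apply: linear_malg_ext.
- move=> x z z'; rewrite -coproduct_linear_op; congr (coproduct _ u).
  by apply: funext => v; rewrite lin_ext_is_linear.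
- exact: lin_ext_is_linear.
move=> c; rewrite lin_extU; congr (coproduct _ u).
by apply: funext => v; rewrite lin_extU.
Qed.

End TensorPower.

(** * The action of the affine algebra *)

Lemma linear_comb4 (K : fieldType) (U V : lmodType K) (f : U -> V) (a b c d : K) (x y z t : U) :
  linear f -> f (a *: x + b *: y + c *: z - d *: t) =
  a *: f x + b *: f y + c *: f z - d *: f t.
Proof. by move=> lf; rewrite (linB lf) !(linD lf) !(linZ lf). Qed.

Section LieAction.
Variables (K : numFieldType).
Local Notation gen := (option (sl2_basis * int)).

Lemma Fock_act_linear (b : gen) : linear (@Fock_act K b).
Proof.
case: b => [[[] i]|]; [exact: e_mode_linear|exact: f_mode_linear|exact: h_mode_linear|].
by move=> a u v.
Qed.

Lemma comb4_eq (V : lmodType K) (a' b' c' d' a b c d : K) (x y z t v : V) :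
  a = a' -> b = b' -> c = c' -> d = d' -> a' *: x + b' *: y + c' *: z - d' *: t = v ->
  a *: x + b *: y + c *: z - d *: t = v.
Proof. by move=> -> -> -> ->. Qed.

Local Ltac scale_coefs := do ?ring;
  rewrite !scale0r ?scaleN1r ?scale1r ?scaleNr ?scaler_nat
    ?(add0r, subr0, sub0r, addr0, oppr0).

(** The nine brackets read off from the matrices; (e,f) = 1 and (h,h) = 2 give the central terms.
    With the action as [G] they are compared with the commutators of the modes. *)
Lemma bracket_basis_ext (V : lmodType K) (G : gen -> V) (x y : sl2_basis) (i j : int) :
  lin_ext G (bracket_basis K (Some (x, i)) (Some (y, j))) =
  (match x, y with
   | sl2_e, sl2_f => G (Some (sl2_h, i + j)) - (if i + j == 0 then i%:~R else 0) *: G None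
   | sl2_f, sl2_e => - G (Some (sl2_h, i + j)) - (if i + j == 0 then i%:~R else 0) *: G None
   | sl2_h, sl2_e => G (Some (sl2_e, i + j)) *+ 2
   | sl2_e, sl2_h => - (G (Some (sl2_e, i + j)) *+ 2)
   | sl2_h, sl2_f => - (G (Some (sl2_f, i + j)) *+ 2)
   | sl2_f, sl2_h => G (Some (sl2_f, i + j)) *+ 2
   | sl2_h, sl2_h => - (2 * (if i + j == 0 then i%:~R else 0)) *: G None
   | _, _ => 0
   end).
Proof.
set c := (if i + j == 0 then i%:~R else 0).
have E (A : 'M[K]_2) (t : K) : lin_ext G (loop A (i + j) - (c * t) *: << None >>) =
  A 0 1 *: G (Some (sl2_e, i + j)) + A 1 0 *: G (Some (sl2_f, i + j))
  + A 0 0 *: G (Some (sl2_h, i + j)) - (c * t) *: G None.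
  apply: etrans (linear_comb4 _ _ _ _ _ _ _ _ (lin_ext_is_linear G)) _.
  by rewrite !lin_extU.
rewrite /bracket_basis -/c E /mxtrace !big_ord_recl big_ord0 !mxE !big_ord_recl !big_ord0.
case: x; case: y; rewrite /= !mxE /=.
all: clear E; clearbody c.
all: move: (G (Some (sl2_e, _))) (G (Some (sl2_f, _))) (G (Some (sl2_h, _))) (G None) => ge gf gh gc.
by apply: (@comb4_eq _ 0 0 0 0); scale_coefs.
by apply: (@comb4_eq _ 0 0 1 c); scale_coefs.
by apply: (@comb4_eq _ (- 2) 0 0 0); scale_coefs.
by apply: (@comb4_eq _ 0 0 (- 1) c); scale_coefs.
by apply: (@comb4_eq _ 0 0 0 0); scale_coefs.
by apply: (@comb4_eq _ 0 2 0 0); scale_coefs.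
by apply: (@comb4_eq _ 2 0 0 0); scale_coefs.
by apply: (@comb4_eq _ 0 (- 2) 0 0); scale_coefs.
by apply: (@comb4_eq _ 0 0 0 (2 * c)); scale_coefs.
Qed.

Lemma Fock_bracket (a b : gen) (u : Fock K) :
  Fock_act a (Fock_act b u) - Fock_act b (Fock_act a u)
  = lin_ext (fun c => Fock_act c u) (bracket_basis K a b).
Proof.
have lin_ext0 (G : gen -> Fock K) : lin_ext G 0 = 0.
  exact: lin0 (lin_ext_is_linear G).
case: a => [[x i]|]; last by rewrite /= lin_ext0 subrr.
case: b => [[y j]|]; last by rewrite [bracket_basis _ _ _]/= lin_ext0 subrr.
apply: etrans (esym (bracket_basis_ext (fun c => Fock_act c u) x y i j)).
case: x; case: y => /=.
- by rewrite e_modeC subrr.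
- exact: comm_e_f.
- by rewrite -[LHS]opprB comm_h_e [j + i]addrC.
- rewrite -[LHS]opprB comm_e_f opprB [i + j]addrC [LHS]addrC; congr (_ + _).
  case: eqP => [ij|_]; last by rewrite scale0r oppr0.
  by rewrite -scaleNr -intrN; congr (_%:~R *: _); lia.
- by rewrite f_modeC subrr.
- by rewrite -[LHS]opprB comm_h_f [j + i]addrC opprK.
- exact: comm_h_e.
- exact: comm_h_f.
- exact: comm_h_h.
Qed.

Variable k : nat.
Local Notation FT := (FockT K k).

Lemma FockT_act_linearl (u : FT) : linear (fun x => FockT_act x u).
Proof. exact: lin_ext_is_linear. Qed.

Lemma FockT_act_linear (x : sl2hat K) : linear (@FockT_act K k x).
Proof.
move=> a u v; rewrite /FockT_act.
move: x; apply: linear_malg_ext.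
- exact: lin_ext_is_linear.
- move=> c x y; rewrite !(lin_ext_is_linear _ c); exact: lin_addZr.
by move=> b; rewrite !lin_extU; apply: coproduct_linear.
Qed.

Lemma FockT_actU (b : gen) (u : FT) : FockT_act << b >> u = coproduct (Fock_act b) u.
Proof. exact: lin_extU. Qed.

Lemma FockT_bracket (x y : sl2hat K) (u : FT) :
  FockT_act (bracket x y) u = FockT_act x (FockT_act y u) - FockT_act y (FockT_act x u).
Proof.
have sub_lin (U V : lmodType K) (f g : U -> V) : linear f -> linear g ->
    linear (fun z => f z - g z).
  by move=> lf lg a z t; rewrite lf lg scalerBr opprD addrACA.
move: x; apply: linear_malg_ext.
- by apply: (lin_comp (FockT_act_linearl u)); apply: lin_ext_is_linear.
- apply: sub_lin; first exact: FockT_act_linearl.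
  exact: (lin_comp (FockT_act_linear y) (FockT_act_linearl u)).
move=> a; move: y; apply: linear_malg_ext.
- apply: (lin_comp (FockT_act_linearl u)) => c y z.
  by rewrite /bracket !lin_extU lin_ext_is_linear.
- apply: sub_lin; last exact: FockT_act_linearl.
  exact: (lin_comp (FockT_act_linear _) (FockT_act_linearl u)).
move=> b; rewrite !FockT_actU /bracket !lin_extU.
apply: etrans (esym (coproduct_lin_ext (@Fock_act K) (bracket_basis K a b) u)) _.
apply: etrans (esym (coproduct_comm u (Fock_act_linear a) (Fock_act_linear b))).
by congr (coproduct _ u); apply: funext => v; rewrite Fock_bracket.
Qed.

End LieAction.

(** * Sums of currents of square zero *)

Lemma leading_term_id (R : comNzRingType) (t s z x P b : R) j :
  t + (z *+ j.+1 + s) - P * b *+ (j.+1)`! =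
  t + s + (z - x * b) *+ j.+1 + b * (x - P *+ j`!) *+ j.+1.
Proof. by rewrite factS mulnC; move: (j`!) (j.+1) => f n; ring. Qed.

Section SquareZeroSums.
Variables (K : numFieldType) (V : lmodType K) (k : nat) (y : nat -> nat -> V -> V).
Variable w : (nat -> nat) -> V.
Variable sg : nat -> K.
Hypothesis y_linear : forall a j, linear (y a j).
Hypothesis yC : forall a i b j v, y a i (y b j v) = y b j (y a i v).
Hypothesis w_ext : forall c c', (forall a, (a < k)%N -> c a = c' a) -> w c = w c'.
Hypothesis w_kill : forall c a j, (a < k)%N -> (j < c a)%N -> y a j (w c) = 0.
Hypothesis w_sq : forall c a n, (a < k)%N -> \sum_(j < n.+1) y a j (y a (n - j)%N (w c)) = 0.
Hypothesis w_next : forall c a, (a < k)%N -> y a (c a) (w c) = sg (c a) *: w (bump_at a 2 c).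

Definition ysum j v := \sum_(a < k) y a j v.

(** The modes of the single currents commute, so powers of their sum are computed in the polynomial
    ring on these modes; [corr] translates from polynomials in the modes of the sum. *)
Let B : comNzRingType := {malg K[{cmonom (nat * nat)%type}]}.
Let yy (t : (nat * nat)%type) := y t.1 t.2.
Let yy_linear t : linear (yy t). Proof. exact: y_linear. Qed.
Let yyC s t v : yy s (yy t v) = yy t (yy s v). Proof. exact: yC. Qed.

Lemma ysum_linear j : linear (ysum j).
Proof.
move=> x u v; rewrite /ysum scaler_sumr -big_split; apply: eq_bigr => a _; exact: y_linear.
Qed.

Lemma ysumC i j v : ysum i (ysum j v) = ysum j (ysum i v).
Proof.
rewrite /ysum; apply: (@etrans _ _ (\sum_(a < k) \sum_(b < k) y a i (y b j v))).
  by apply: eq_bigr => a _; apply: lin_sum.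
rewrite exchange_big; apply: eq_bigr => b _; rewrite (lin_sum (y_linear b j)).
by apply: eq_bigr => a _; rewrite yC.
Qed.

Let bvar a j : B := << ucm (a, j) >>.
Let Y N a : {poly B} := \poly_(j < N) bvar a j.
Let S N j : {poly B} := \sum_(a < j) Y N a.

Let coefY N a j : (j < N)%N -> (Y N a)`_j = bvar a j.
Proof. by rewrite coef_poly => ->. Qed.

Let actB (P : B) v := act yy P v.
Let actBl v : linear (fun P : {malg K[{cmonom (nat * nat)%type}]} => actB P v).
Proof. exact: act_is_linearl. Qed.
Let actBM (P Q : B) v : actB (P * Q) v = actB P (actB Q v).
Proof. exact: (actM yy_linear yyC). Qed.
Let actB0 (P : B) : actB P 0 = 0.
Proof. exact: (lin0 (act_is_linear yy_linear P)). Qed.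

Let corr (p : {poly cpoly K}) (q : {poly B}) := forall n v, act ysum p`_n v = actB q`_n v.

Let corrM p p' q q' : corr p q -> corr p' q' -> corr (p * p') (q * q').
Proof.
move=> pq pq' n v; rewrite !coefM (lin_sum (act_is_linearl ysum v)) (lin_sum (actBl v)).
apply: eq_bigr => i _; rewrite (actM ysum_linear ysumC) pq' pq; exact/esym/actBM.
Qed.

Let corrX p q i : corr p q -> corr (p ^+ i) (q ^+ i).
Proof.
move=> pq; elim: i => [|i IH]; last by rewrite !exprS; apply: corrM.
move=> n v; rewrite !expr0 !coef1; case: (n == 0%N).
  by apply: etrans (act1 _ _) (esym (act1 _ _)).
by rewrite (lin0 (act_is_linearl ysum v)) (lin0 (actBl v)).
Qed.

Let corr_series N : corr (cseries K N) (S N k).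
Proof.
move=> n v; rewrite /S coef_sum (lin_sum (actBl v)) coef_poly.
case nN: (n < N)%N; last first.
  rewrite (lin0 (act_is_linearl ysum v)) big1 // => a _.
  by rewrite coef_poly nN (lin0 (actBl v)).
apply: etrans (actX ysumC _ _) _; rewrite /ysum; apply: eq_bigr => a _; rewrite coef_poly nN.
exact/esym/(actX yyC).
Qed.

Lemma act_ccoef i n v : act ysum (ccoef K i n) v = actB (S n.+1 k ^+ i)`_n v.
Proof. exact/corrX/corr_series. Qed.

Section Annihilator.
Variable c : nat -> nat.
Let J (b : B) := actB b (w c) = 0.

Let idJ : is_ideal J.
Proof.
split.
- exact: (lin0 (actBl _)).
- by move=> b b' Jb Jb'; rewrite /J (linD (actBl _)) Jb Jb' addr0.
- by move=> b b' Jb'; rewrite /J actBM Jb' actB0.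
Qed.

Let smallY N a : (a < k)%N -> small J (minn (c a) N) (Y N a).
Proof.
move=> ak j; rewrite leq_min coef_poly => /andP[jc ->].
by apply: etrans (actX yyC _ _) _; apply: w_kill.
Qed.

Let smallYY N a p : (a < k)%N -> (1 < p)%N -> small J N (Y N a ^+ p).
Proof.
move=> ak p1; have -> : p = (p - 2 + 2)%N by lia.
rewrite exprD; apply: (smallMl idJ) => n nN.
rewrite expr2 coefM /J (lin_sum (actBl _)) -[RHS](w_sq c n ak); apply: eq_bigr => j _.
have jn := ltn_ord j.
have jN : (j < N)%N by lia.
have njN : (n - j < N)%N by lia.
rewrite (coefY a jN) (coefY a njN) actBM; apply: etrans (actX yyC _ _) _; congr (y _ _ _).
exact: (actX yyC).
Qed.

Hypothesis cn : nondecr k c.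

Let SS N j : S N j.+1 = S N j + Y N j.
Proof. by rewrite /S big_ord_recr. Qed.

Let binom_small N j i d : (j < k)%N -> (d <= N)%N -> small J d (S N j ^+ i) ->
  ((0 < i)%N -> small J d (S N j ^+ i.-1 * Y N j)) -> small J d (S N j.+1 ^+ i).
Proof.
move=> jk dN s0 s1; rewrite SS exprDn; apply: (small_sum idJ) => -[[|[|p]] pi] _ /=.
- by rewrite subn0 expr0 mulr1 bin0.
- by rewrite subn1 expr1; apply/(smallMn idJ)/s1.
- by apply/(smallMn idJ)/(smallMl idJ)/(smallW dN)/smallYY.
Qed.

Let csum_le i j : (i < j)%N -> (j < k)%N -> (csum c i.+1 <= csum c i + c j)%N.
Proof. by move=> ij jk; rewrite csumS leq_add2l; apply: cn => //; apply: ltnW. Qed.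

(** Squares vanish, so S^i consists of products of i distinct currents: it is 0 for i > j, and
    otherwise its order is at least the sum of the i smallest entries, which are the first i. The
    minimum with [N] accounts for the truncation. *)
Let small_S N j i : (j <= k)%N ->
  small J (if (i <= j)%N then minn (csum c i) N else N) (S N j ^+ i).
Proof.
elim: j i => [|j IH] i jk.
  rewrite leqn0 /S big_ord0; case: eqP => [->|/eqP i0]; first by rewrite /csum big_ord0 min0n.
  by move=> n _; rewrite expr0n (negbTE i0) coef0; apply: (ideal_0 idJ).
have Yj := smallY (N := N) (a := j) jk.
apply: binom_small => //; first by case: ifP => // _; lia.
- have := IH i (ltnW jk); apply: smallW; case: (leqP i j) => ij; last by case: ifP => _; lia.
  by rewrite ifT //; lia.
case: i => // i _ /=; have := smallM idJ (IH i (ltnW jk)) Yj.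
apply: smallW; case: (leqP i j) => ij; last by rewrite ifF //; lia.
rewrite ifT //; move: ij; rewrite leq_eqVlt => /predU1P[->|ij].
  by rewrite csumS; lia.
by have := csum_le ij jk; lia.
Qed.

Lemma annih_rel i n : (i <= k)%N -> (n < csum c i)%N -> act ysum (ccoef K i n) (w c) = 0.
Proof.
move=> ik ni; rewrite act_ccoef.
by have /(_ n) := @small_S n.+1 k i (leqnn k); rewrite ik; apply; lia.
Qed.

Lemma annih_rel_top n : act ysum (ccoef K k.+1 n) (w c) = 0.
Proof.
rewrite act_ccoef; have /(_ n) := @small_S n.+1 k k.+1 (leqnn k).
by rewrite ltnn; apply.
Qed.

(** The lowest term takes each of the j currents once, at its first mode not known to kill [w c];
    the j! orders give the factor. *)
Let lead N j : (j <= k)%N -> (csum c j < N)%N ->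
  J ((S N j ^+ j)`_(csum c j) - (\prod_(a < j) bvar a (c a)) *+ j`!).
Proof.
elim: j => [|j IH] jk jN.
  by rewrite expr0 big_ord0 /csum big_ord0 coef1 eqxx fact0 subrr; apply: (ideal_0 idJ).
have cjN : (csum c j < N)%N by move: jN; rewrite csumS; lia.
have cN : (c j < N)%N by move: jN; rewrite csumS; lia.
rewrite SS exprDn coef_sum [X in X - _]big_ord_recl [X in _ + X - _]big_ord_recl /=.
rewrite subn0 expr0 mulr1 bin0 mulr1n /bump /= addn0 expr1 subn1 bin1 /=.
set s := \sum_(i < _) _.
have Js : J s.
  rewrite /s; apply: (ideal_sum idJ) => p _; rewrite /= coefMn.
  by apply/(ideal_Mn idJ)/(smallMl idJ); [exact: smallYY|].
have J0 : J (S N j ^+ j.+1)`_(csum c j.+1).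
  by have /(_ (csum c j.+1)) := @small_S N j j.+1 (ltnW jk); rewrite ltnn; apply.
have Y0 := smallY (N := N) (a := j) jk.
have S0 := @small_S N j j (ltnW jk); rewrite leqnn in S0.
have E1 : minn (csum c j) N = csum c j by lia.
have E2 : minn (c j) N = c j by lia.
rewrite E1 in S0; rewrite E2 in Y0.
have J1 := coefM_lead idJ S0 Y0.
rewrite -csumS coef_poly cN in J1.
set P := \prod_(a < j) _ in IH; have {}IH := IH (ltnW jk) cjN.
rewrite big_ord_recr /= -/P coefMn.
set x := (S N j ^+ j)`_ _ in IH J1; set z := (S N j ^+ j * Y N j)`_ _ in J1 *.
set t := (S N j ^+ j.+1)`_ _ in J0 *; set b := bvar _ _ in J1 *.
have -> : t + (z *+ j.+1 + s) - P * b *+ (j.+1)`! =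
  t + s + (z - x * b) *+ j.+1 + b * (x - P *+ j`!) *+ j.+1.
  exact: leading_term_id.
apply: (ideal_D idJ); first apply: (ideal_D idJ); first exact: (ideal_D idJ).
  exact: (ideal_Mn idJ).
by apply/(ideal_Mn idJ)/(ideal_Ml idJ).
Qed.

(** A product that involves a later current has higher degree, because the entry at [kap] is
    strictly larger than the one before it. *)
Let lead_le N kap j : (0 < kap <= j)%N -> (j <= k)%N -> (csum c kap < N)%N ->
  ((kap < k)%N -> (c kap.-1 < c kap)%N) ->
  J ((S N j ^+ kap)`_(csum c kap) - (\prod_(a < kap) bvar a (c a)) *+ kap`!).
Proof.
move=> /andP[k0]; elim: j => [|j IH]; first by rewrite leqNgt k0.
rewrite leq_eqVlt => /predU1P[<-|kj] jk cN cc; first exact: lead.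
have {}IH := IH kj (ltnW jk) cN cc.
have kk : (kap < k)%N by apply: leq_trans jk; rewrite ltnS.
rewrite SS exprDn coef_sum big_ord_recl /= subn0 expr0 mulr1 bin0 mulr1n addrAC.
apply: (ideal_D idJ) => //; apply: (ideal_sum idJ) => -[p pk] _ /=.
rewrite /bump /= add1n coefMn; apply: (ideal_Mn idJ).
case: p pk => [|p] pk; last by apply: (smallMl idJ) (cN); apply: smallYY.
rewrite expr1 subn1; have Y0 := smallY (N := N) (a := j) jk.
have S0 := @small_S N j kap.-1 (ltnW jk).
apply: (smallM idJ S0 Y0); rewrite ifT; last by lia.
have ckj : (c kap <= c j)%N by apply: cn.
have := cc kk; have := csumS c kap.-1; rewrite prednK // => E; lia.
Qed.

Lemma annih_lead kap : (0 < kap <= k)%N -> ((kap < k)%N -> (c kap.-1 < c kap)%N) ->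
  act ysum (ccoef K kap (csum c kap)) (w c)
  = (kap`!%:R * \prod_(a < kap) sg (c a)) *: w (raise2 kap c).
Proof.
move=> kk cc; rewrite act_ccoef.
have := lead_le (N := (csum c kap).+1) kk (leqnn k) (ltnSn _) cc.
rewrite /J (linB (actBl _)) => /eqP; rewrite subr_eq0 => /eqP ->.
rewrite -scaler_nat (linZ (actBl _)) -scalerA; congr (_ *: _).
case/andP: kk => _; elim: (kap) => [|j IH] jk.
  rewrite !big_ord0 scale1r; apply: etrans (act1 _ _) _.
  by apply: w_ext => a _; rewrite /raise2 ltn0 mul0n addn0.
rewrite !big_ord_recr /= mulrC actBM IH; last exact: ltnW.
apply: etrans (linZ (act_is_linear yy_linear _) _ _) _.
rewrite -scalerA; congr (_ *: _).
apply: etrans (actX yyC _ _) _; rewrite /yy /=.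
have rj : raise2 j c j = c j by rewrite /raise2 ltnn addn0.
rewrite -{1}rj w_next // rj; congr (_ *: _); apply: w_ext => a _.
by rewrite /bump_at /raise2; case: (ltngtP a j); lia.
Qed.

End Annihilator.

End SquareZeroSums.

HB.lock Definition et (K : numFieldType) (k : nat) (n : int) : FockT K k -> FockT K k :=
  coproduct (@e_mode K n).

Section TensorVectors.
Variables (K : numFieldType) (k : nat).
Local Notation FT := (FockT K k).

Definition tvec (m : nat -> int) : FT := << [ffun a : 'I_k => vmon (m a)] >>.

Lemma tvec_neq0 m : tvec m != 0.
Proof. by rewrite /tvec monalgU_eq0 oner_eq0. Qed.

Lemma eq_tvec m m' : (forall a, (a < k)%N -> m a = m' a) -> tvec m = tvec m'.
Proof. by move=> mm; congr << _ >>; apply/ffunP => a; rewrite !ffunE mm. Qed.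

Definition setm (m : nat -> int) (a : nat) (x : int) (b : nat) : int :=
  if b == a then x else m b.

Lemma put_tvec (m : nat -> int) (b : 'I_k) (x : int) :
  put [ffun a : 'I_k => vmon (m a)] b (vvec K x) = tvec (setm m b x).
Proof.
rewrite putU; congr << _ >>; apply/ffunP => a; rewrite !ffunE /setm.
by rewrite (inj_eq val_inj); case: eqP.
Qed.

Lemma place_tvec (m : nat -> int) (b : 'I_k) (T : Fock K -> Fock K) :
  place b T (tvec m) = put [ffun a : 'I_k => vmon (m a)] b (T (vvec K (m b))).
Proof. by rewrite /tvec placeU ffunE. Qed.

Lemma place_tvec0 (m : nat -> int) (b : 'I_k) (T : Fock K -> Fock K) :
  T (vvec K (m b)) = 0 -> place b T (tvec m) = 0.
Proof. by move=> T0; rewrite place_tvec T0; apply/lin0/put_linear. Qed.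

Lemma place_tvecZ (m : nat -> int) (b : 'I_k) (T : Fock K -> Fock K) (a : K) (x : int) :
  T (vvec K (m b)) = a *: vvec K x -> place b T (tvec m) = a *: tvec (setm m b x).
Proof.
by move=> Tx; rewrite place_tvec Tx (linZ (put_linear _ _)) put_tvec.
Qed.

Lemma et_linear n : linear (@et K k n).
Proof. by rewrite et.unlock; apply: coproduct_linear. Qed.

Lemma etE n u : et n u = \sum_(a < k) place a (@e_mode K n) u.
Proof. by rewrite et.unlock coproductE. Qed.

Lemma place_eC (a b : 'I_k) i j u :
  place a (@e_mode K i) (place b (@e_mode K j) u) = place b (@e_mode K j) (place a (@e_mode K i) u).
Proof.
have [->|ab] := eqVneq a b; last exact: placeC.
apply: etrans (place_comp b (@e_mode K j) u (@e_mode_linear K i)) _.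
apply: etrans (esym (place_comp b (@e_mode K i) u (@e_mode_linear K j))).
apply: (f_equal (fun T => place b T u)); apply: funext => v; exact: e_modeC.
Qed.

(** * Vectors of the tensor power *)

Section FixedTop.
Variable top : int.

Definition etop (j : nat) : FT -> FT := et (top + j%:Z).

(* [e_(top+j)] kills the factor [a] of this vector exactly when [j < c a]. *)
Definition wtop (c : nat -> nat) : FT := tvec (fun a => top + (c a)%:Z - 1).

Definition wsign (j : nat) : K := psign K (top + j%:Z).

(** Indexed by all natural numbers, with value 0 beyond [k], to match the shape of the preceding
    section. *)
Let y (a j : nat) : FT -> FT :=
  if insub a is Some b then place (b : 'I_k) (@e_mode K (top + j%:Z)) else fun=> 0.

Let yE (b : 'I_k) j : y b j = place b (@e_mode K (top + j%:Z)).
Proof. by rewrite /y valK. Qed.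

Let yk a j : (k <= a)%N -> y a j = fun=> 0.
Proof. by move=> ka; rewrite /y insubN // -leqNgt. Qed.

Let y_linear a j : linear (y a j).
Proof.
have [ak|ka] := ltnP a k; first by rewrite (yE (Ordinal ak)); apply: place_linear.
by rewrite yk // => x u v; rewrite scaler0 addr0.
Qed.

Let yC a i b j v : y a i (y b j v) = y b j (y a i v).
Proof.
have [ak|ka] := ltnP a k; last by rewrite (yk _ ka) (lin0 (y_linear b j)).
have [bk|kb] := ltnP b k; last by rewrite (yk _ kb) (lin0 (y_linear a i)).
by rewrite (yE (Ordinal ak)) (yE (Ordinal bk)); apply: place_eC.
Qed.

Let w_ext c c' : (forall a, (a < k)%N -> c a = c' a) -> wtop c = wtop c'.
Proof. by move=> cc; apply: eq_tvec => a ak; rewrite cc. Qed.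

Let w_kill c a j : (a < k)%N -> (j < c a)%N -> y a j (wtop c) = 0.
Proof.
move=> ak jc; rewrite (yE (Ordinal ak)); apply: place_tvec0; apply: e_vvec => /=; lia.
Qed.

Let w_sq c a n : (a < k)%N -> \sum_(j < n.+1) y a j (y a (n - j)%N (wtop c)) = 0.
Proof.
move=> ak; set b := Ordinal ak; set m := fun a => top + (c a)%:Z - 1.
have E (j : 'I_n.+1) : y a j (y a (n - j)%N (wtop c)) = put [ffun a : 'I_k => vmon (m a)] b
    (e_mode (top + (j : nat)%:Z) (e_mode (top + (n - j)%N%:Z) (vvec K (m b)))).
  rewrite !(yE b); apply: etrans (place_comp b _ (wtop c) (@e_mode_linear K _)) _.
  exact: place_tvec.
rewrite (eq_bigr _ (fun j _ => E j)) -(lin_sum (put_linear _ b)).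
by rewrite e_sq_vvec ?(lin0 (put_linear _ b)) //= /m; lia.
Qed.

Let w_next c a : (a < k)%N -> y a (c a) (wtop c) = wsign (c a) *: wtop (bump_at a 2 c).
Proof.
move=> ak; rewrite (yE (Ordinal ak)).
have E : e_mode (top + (c a)%:Z) (vvec K (top + (c a)%:Z - 1)) =
    wsign (c a) *: vvec K (top + (c a)%:Z + 1).
  have := @e_vvec_next K (top + (c a)%:Z - 1); rewrite subrK => ->.
  by congr (_ *: vvec K _); lia.
apply: etrans (@place_tvecZ (fun a => top + (c a)%:Z - 1) (Ordinal ak) _ _ _ E) _.
congr (_ *: _); apply: eq_tvec => b bk; rewrite /setm /bump_at /=.
by case: eqP => [->|_]; lia.
Qed.

Let yetop j : ysum k y j = etop j.
Proof. by apply: funext => v; rewrite /etop etE; apply: eq_bigr => b _; rewrite yE. Qed.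

Let actE P v : act (ysum k y) P v = act etop P v.
Proof. by congr (act _ P v); apply: funext => j; rewrite yetop. Qed.

Lemma etop_linear j : linear (etop j).
Proof. exact: et_linear. Qed.

Lemma etopC i j v : etop i (etop j v) = etop j (etop i v).
Proof. by rewrite -!yetop (ysumC k y_linear yC). Qed.

(** The fermion fills the first free position of factor [a]. Being placed without sign, it also
    commutes with the modes of e(z) on the other factors. *)
Let w_raise c a P : (a < k)%N -> act (ysum k y) P (wtop c) = 0 ->
  act (ysum k y) P (wtop (bump_at a 1 c)) = 0.
Proof.
move=> ak Pw; set b := Ordinal ak; pose T := place b (@rmul_var K (top + (c a)%:Z)).
have Tw : T (wtop c) = wtop (bump_at a 1 c).
  have E : rmul_var (top + (c a)%:Z) (vvec K (top + (c a)%:Z - 1)) =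
      1 *: vvec K (top + (c a)%:Z).
    have := @rmul_vvec_next K (top + (c a)%:Z - 1); rewrite subrK => ->.
    by rewrite scale1r.
  apply: etrans (@place_tvecZ (fun a => top + (c a)%:Z - 1) b _ _ _ E) _.
  rewrite scale1r; apply: eq_tvec => a' ak'; rewrite /setm /bump_at /=.
  by case: eqP => [->|_]; lia.
have Tl : linear T by exact: place_linear.
have TE j v : T (ysum k y j v) = ysum k y j (T v).
  rewrite /ysum (lin_sum Tl); apply: eq_bigr => a' _; rewrite yE.
  rewrite /T; have [->|ab] := eqVneq b a'; last exact: placeC.
  apply: etrans (place_comp a' (@e_mode K _) v (@rmul_linear K _)) _.
  apply: etrans (esym (place_comp a' (@rmul_var K _) v (@e_mode_linear K _))).
  apply: (f_equal (fun T => place a' T v)); apply: funext => u; exact/esym/e_mode_rmul.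
by rewrite -Tw -(act_comm Tl TE) Pw (lin0 Tl).
Qed.

Theorem wtop_annih c P : nondecr k c -> act etop P (wtop c) = 0 -> ideal (crel k c) P.
Proof.
rewrite -actE => cn; apply: (presentation (ysum_linear k y_linear) (ysumC k y_linear yC) w_ext _ w_raise) cn.
- by move=> c'; apply: tvec_neq0.
- move=> c' i n cn' /andP[_ ik]; exact: annih_rel.
- by move=> c' n cn'; exact: annih_rel_top.
move=> c' kap kk cn' cc; exists (kap`!%:R * \prod_(a < kap) wsign (c' a)).
  rewrite mulf_neq0 ?pnatr_eq0 -?lt0n ?fact_gt0 // prodf_seq_neq0; apply/allP => a _ /=.
  by rewrite /wsign /psign; case: ifP; rewrite ?oppr_eq0 oner_eq0.
exact: annih_lead.
Qed.

Lemma crel_wtop c P : nondecr k c -> ideal (crel k c) P -> act etop P (wtop c) = 0.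
Proof.
move=> cn; elim=> [|q g x [i [n [_ ikn ->]]] _ IH].
  exact: (lin0 (act_is_linearl _ _)).
rewrite (linD (act_is_linearl etop _)) IH addr0 (actM etop_linear etopC).
suff -> : act etop (ccoef K i n) (wtop c) = 0.
  exact: (lin0 (act_is_linear etop_linear _)).
rewrite -actE; case/orP: ikn => [/andP[ik ni]|/eqP ->].
  exact: (annih_rel y_linear yC w_kill w_sq cn ik ni).
exact: (annih_rel_top y_linear yC w_kill w_sq cn).
Qed.

Lemma lead_wtop c kap : nondecr k c -> (0 < kap <= k)%N ->
  ((kap < k)%N -> (c kap.-1 < c kap)%N) ->
  act etop (ccoef K kap (csum c kap)) (wtop c)
  = (kap`!%:R * \prod_(a < kap) wsign (c a)) *: wtop (raise2 kap c).
Proof. by move=> cn kk cc; rewrite -actE; apply: annih_lead. Qed.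

End FixedTop.

End TensorVectors.

(** * Increasing unions of cyclic modules *)

Section CyclicSpan.
Variables (K : numFieldType) (U : lmodType K) (E : int -> U -> U).
Hypothesis E_linear : forall i, linear (E i).
Hypothesis EC : forall i j u, E i (E j u) = E j (E i u).

(** The set [S] of admissible modes is kept explicit, because large modes will be traded for a
    larger index s. *)
Inductive cyc (S : pred int) (w : U) : U -> Prop :=
| cyc_base : cyc S w w
| cyc_op i u : S i -> cyc S w u -> cyc S w (E i u)
| cyc_lin a u v : cyc S w u -> cyc S w v -> cyc S w (a *: u + v).

Lemma cyc0 S w : cyc S w 0.
Proof.
have := cyc_lin (-1) (cyc_base S w) (cyc_base S w).
by rewrite scaleN1r addNr.
Qed.

Lemma cycZ S w a u : cyc S w u -> cyc S w (a *: u).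
Proof. by move=> h; rewrite -[a *: u]addr0; apply: cyc_lin => //; apply: cyc0. Qed.

Lemma cycD S w u v : cyc S w u -> cyc S w v -> cyc S w (u + v).
Proof. by move=> h h'; rewrite -[u]scale1r; apply: cyc_lin. Qed.

Lemma cyc_sum S w (I : Type) (r : seq I) (P : pred I) F :
  (forall i, P i -> cyc S w (F i)) -> cyc S w (\sum_(i <- r | P i) F i).
Proof. by move=> h; elim/big_ind: _ => //; [exact: cyc0 | move=> *; exact: cycD]. Qed.

Lemma cyc_sub (S S' : pred int) w u : (forall i, S i -> S' i) -> cyc S w u -> cyc S' w u.
Proof.
move=> SS; elim=> [|i {}u Si _ IH|a u1 u2 _ h1 _ h2].
- exact: cyc_base.
- by apply: cyc_op => //; apply: SS.
- exact: cyc_lin.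
Qed.

Lemma cyc_trans S w w' u : cyc S w' w -> cyc S w u -> cyc S w' u.
Proof.
move=> h; elim=> [//|i {}u Si _ IH|a u1 u2 _ h1 _ h2]; [exact: cyc_op | exact: cyc_lin].
Qed.

Lemma cyc_act (S : pred int) w j n P (top : int) : (forall i : nat, S (top + i%:Z)) \/
    (forall i : nat, (i < j)%N -> S (top + i%:Z)) /\ (exists i, P = (cseries K j ^+ i)`_n) ->
  cyc S w (act (fun i : nat => E (top + i%:Z)) P w).
Proof.
pose good Q := forall v, cyc S w v -> cyc S w (act (fun i : nat => E (top + i%:Z)) Q v).
have El i : linear ((fun i : nat => E (top + i%:Z)) i) by [].
have ECt i i' u : E (top + i%:Z) (E (top + i'%:Z) u) = E (top + i'%:Z) (E (top + i%:Z) u) by [].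
have gD Q Q' : good Q -> good Q' -> good (Q + Q').
  move=> g g' v h; rewrite (linD (act_is_linearl _ v)).
  by apply: cycD; [exact: g | exact: g'].
have g0 : good 0.
  by move=> v h; rewrite (lin0 (act_is_linearl _ v)); apply: cyc0.
have gM Q Q' : good Q -> good Q' -> good (Q * Q').
  by move=> g g' v h; rewrite (actM El ECt); apply/g/g'.
have g1 : good 1 by move=> v h; rewrite act1.
case=> [Sall|[Sj [i ->]]].
  rewrite /act; apply: cyc_sum => m _; apply: cycZ.
  rewrite /act_monom; elim: (finsupp m : seq nat) => [|t s IH] /=; first exact: cyc_base.
  by elim: (m t) => //= q IHq; apply: cyc_op.
suff: good (cseries K j ^+ i)`_n by apply; apply: cyc_base.
elim: i n => [|i IH] n; first by rewrite expr0 coef1; case: (n == 0%N).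
rewrite exprS coefM; apply: (big_ind good) => // l _; apply: (gM _ _ _ (IH _)).
rewrite coef_poly; case lj: (_ < j)%N; last exact: g0.
by move=> v h; rewrite (actX ECt); apply: cyc_op h; apply: Sj.
Qed.

(** A mode below [top] commutes with the others and kills [w], so it contributes the polynomial
    0. *)
Lemma act_of_cyc w u (top : int) : (forall i, i < top -> E i w = 0) -> cyc xpredT w u ->
  exists P : cpoly K, u = act (fun i : nat => E (top + i%:Z)) P w.
Proof.
pose Et (i : nat) := E (top + i%:Z).
have El i : linear (Et i) by exact: E_linear.
have ECt i i' v : Et i (Et i' v) = Et i' (Et i v) by exact: EC.
move=> w0; elim=> [|i {}u _ _ [P ->]|a u1 u2 _ [P1 ->] _ [P2 ->]].
- by exists 1; rewrite act1.
- have [it|ti] := ltP i top.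
    have c0 : E i (act Et P w) = act Et P (E i w).
      by apply: (act_comm (E_linear i)) => t v; apply: EC.
    exists 0; rewrite (lin0 (act_is_linearl Et w)) c0 (w0 i it).
    exact: (lin0 (act_is_linear El P)).
  exists (cvar K `|i - top|%N * P); rewrite (actM El ECt).
  apply/esym; apply: etrans (actX ECt _ _) _; congr (E _ _); lia.
- by exists (a *: P1 + P2); rewrite (act_is_linearl Et).
Qed.

Lemma cyc_comm (T : U -> U) S w u : linear T -> (forall i v, T (E i v) = E i (T v)) ->
  cyc S w u -> cyc S (T w) (T u).
Proof.
move=> Tl TE; elim=> [|i {}u Si _ IH|a u1 u2 _ h1 _ h2].
- exact: cyc_base.
- by rewrite TE; apply: cyc_op.
- by rewrite Tl; apply: cyc_lin.
Qed.

Section Sequence.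
Variables (k : nat) (c : nat -> nat) (t0 : int) (om : nat -> U) (x : nat -> K).
(** The generators [om] stay abstract so that this section serves both for the vectors w_s and for
    pairs of them. The step 2 matches the raising of all entries by the leading coefficient of
    e(z)^k. *)
Definition seqtop (s : nat) : int := t0 - (s *+ 2)%:Z.
Let Et s (j : nat) := E (seqtop s + j%:Z).
Hypothesis k0 : (0 < k)%N.
Hypothesis annih : forall s P, ideal (crel k c) P -> act (Et s) P (om s) = 0.
Hypothesis x0 : forall s, x s != 0.
Hypothesis step : forall s, act (Et s.+1) (ccoef K k (csum c k)) (om s.+1) = x s *: om s.

Let cmax := (\sum_(a < k) c a)%N.
Let c_lt j : (cmax < j)%N -> forall a, (a < k)%N -> (c a < j)%N.
Proof. by move=> cj a ak; apply: leq_ltn_trans cj; rewrite /cmax (bigD1 (Ordinal ak)) //= leq_addr. Qed.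

(** By [ccoef_trunc], [om s] and its image under the [j]-th mode both come from [om s.+1] through
    modes below that one, after division by [x s] and by k+1. *)
Let step_trunc s j : (cmax < j)%N ->
  cyc (fun i => i < seqtop s.+1 + j%:Z) (om s.+1) (om s) /\
  cyc (fun i => i < seqtop s.+1 + j%:Z) (om s.+1) (Et s.+1 j (om s)).
Proof.
move=> cj; have [I1 I2] := ccoef_trunc K k0 (c_lt cj).
have El i : linear (Et s.+1 i) by exact: E_linear.
have ECt i i' v : Et s.+1 i (Et s.+1 i' v) = Et s.+1 i' (Et s.+1 i v) by exact: EC.
have al := act_is_linearl (Et s.+1) (om s.+1).
have cyc_coef i n : cyc (fun i => i < seqtop s.+1 + j%:Z) (om s.+1)
    (act (Et s.+1) (cseries K j ^+ i)`_n (om s.+1)).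
  by apply: (cyc_act _ (j := j) (n := n)); right; split; [move=> i' i'j; lia | exists i].
split.
  have /eqP := annih s.+1 I1; rewrite (linB al) subr_eq0 step => /eqP E1.
  by rewrite -[om s](scalerK (x0 s)) E1; apply: cycZ.
have := annih s.+1 I2; rewrite (linD al) -scaler_nat (linZ al) (actM El ECt) step.
rewrite (linZ (act_is_linear El _)) scalerA => /eqP; rewrite addr_eq0 => /eqP E1.
have nz : k.+1%:R * x s != 0 by rewrite mulf_neq0 ?pnatr_eq0.
have -> : Et s.+1 j (om s) = (k.+1%:R * x s)^-1 *: (k.+1%:R * x s *: Et s.+1 j (om s)).
  by rewrite scalerK.
apply: cycZ; have <- : act (Et s.+1) (cvar K j) (om s) = Et s.+1 j (om s) by exact: (actX ECt).
by rewrite E1 -scaleN1r; apply: cycZ.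
Qed.

(** [b] lies above the modes needed to pass from [om s.+1] to [om s]; the condition weakens as s
    grows. *)
Let good b s := seqtop s.+1 + cmax%:Z < b.

Let goodW b s s' : (s <= s')%N -> good b s -> good b s'.
Proof. by rewrite /good /seqtop; lia. Qed.

Let mono1 b s : good b s -> cyc (fun i => i < b) (om s.+1) (om s).
Proof.
move=> g; have [|h _] := @step_trunc s `|b - seqtop s.+1|%N; first by rewrite /good in g *; lia.
by apply: cyc_sub h => i; rewrite /good in g; lia.
Qed.

Let mono b s s' u : good b s -> (s <= s')%N -> cyc (fun i => i < b) (om s) u ->
  cyc (fun i => i < b) (om s') u.
Proof.
move=> g ss h; rewrite -(subnKC ss); elim: (s' - s)%N => [|n IH]; first by rewrite addn0.
by rewrite addnS; apply: cyc_trans IH; apply/mono1/(goodW _ g)/leq_addr.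
Qed.

(** Induction on the excess of [i] over [b]: [step_trunc] replaces the mode [i] by smaller ones at
    the index s+1, and each of these is then treated at a still larger index. *)
Let op_below b s i : good b s ->
  exists2 s', (s <= s')%N & cyc (fun i => i < b) (om s') (E i (om s)).
Proof.
move=> g; have [n ni] : exists n : nat, i < b + n%:Z by exists `|i - b|%N.+1; lia.
elim: n => [|n IHn] in s i g ni *.
  by exists s => //; apply: cyc_op; [rewrite addr0 in ni|exact: cyc_base].
have [ib|bi] := ltP i (b + n%:Z); first exact: IHn.
have [|_ h] := @step_trunc s `|i - seqtop s.+1|%N; first by rewrite /good in g *; lia.
rewrite /Et in h; have iE : seqtop s.+1 + `|i - seqtop s.+1|%N%:Z = i.
  by rewrite /good in g; lia.
rewrite iE in h; have g1 : good b s.+1 by apply: goodW g.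
elim: h => [|j u ji _ [s1 ss1 h1]|a u v _ [s1 ss1 h1] _ [s2 ss2 h2]].
- by exists s.+1 => //; exact: cyc_base.
- have [||s2 s12 h2] := IHn s1 j; [exact: goodW ss1 g|by lia|].
  exists s2; first exact: leq_trans s12.
  by apply: cyc_trans h2 _; apply: cyc_comm h1.
- exists (maxn s1 s2); first by rewrite leq_max ss1.
  apply: cyc_lin; [apply: (mono _ _ h1) | apply: (mono _ _ h2)];
    rewrite ?leq_maxl ?leq_maxr //; [exact: goodW ss1 g | exact: goodW ss2 g].
Qed.

Definition seqspan u := exists s, cyc xpredT (om s) u.

(** The price for small modes is a large s. The case b = 1 gives the comparison with L^D, where only
    e_0, e_(-1), ... occur; bounds b <= 0 serve for f. *)
Lemma seqspan_below b u : seqspan u ->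
  exists s0, forall s, (s0 <= s)%N -> cyc (fun i => i < b) (om s) u.
Proof.
have [sb gb] : exists sb, good b sb.
  by exists `|(t0 + cmax%:Z - b)%R|%N; rewrite /good /seqtop; lia.
have up s : cyc (fun i => i < seqtop s.+1 + cmax%:Z + 1) (om (maxn s sb)) (om s).
  apply: (@mono _ s); rewrite ?leq_maxl //; last exact: cyc_base.
  by rewrite /good; lia.
have all_s s : exists2 s', (sb <= s')%N & cyc (fun i => i < b) (om s') (om s).
  have : exists2 s', (sb <= s')%N & cyc xpredT (om s') (om s).
    by exists (maxn s sb); [exact: leq_maxr | apply: cyc_sub (up s)].
  case=> s1 ss1; elim=> [|i v _ _ [s2 ss2 h2]|a v v' _ [s2 ss2 h2] _ [s3 ss3 h3]].
  - by exists s1 => //; exact: cyc_base.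
  - have [|s3 s23 h3] := @op_below b s2 i; first exact: goodW ss2 gb.
    exists s3; first exact: leq_trans s23.
    by apply: cyc_trans h3 _; apply: cyc_comm h2.
  - exists (maxn s2 s3); first by rewrite leq_max ss2.
    apply: cyc_lin; [apply: (mono _ _ h2) | apply: (mono _ _ h3)];
      rewrite ?leq_maxl ?leq_maxr //; [exact: goodW ss2 gb | exact: goodW ss3 gb].
case=> s; elim=> [|i v _ _ [s1 h1]|a v v' _ [s1 h1] _ [s2 h2]].
- have [s1 ss1 h1] := all_s s; exists s1 => s' ss'.
  by apply: (mono _ ss' h1); apply: goodW ss1 gb.
- have [|s2 s12 h2] := @op_below b (maxn s1 sb) i; first exact: goodW (leq_maxr _ _) gb.
  exists s2 => s' ss'; apply: (mono _ ss').
    by apply: goodW s12 _; apply: goodW (leq_maxr _ _) gb.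
  by apply: cyc_trans h2 _; apply: cyc_comm (h1 _ (leq_maxl _ _)).
- exists (maxn s1 s2) => s'; rewrite geq_max => /andP[ss1 ss2].
  by apply: cyc_lin; [apply: h1 | apply: h2].
Qed.

Lemma seqspan_lin a u v : seqspan u -> seqspan v -> seqspan (a *: u + v).
Proof.
move=> /(seqspan_below 0)[s1 h1] /(seqspan_below 0)[s2 h2]; exists (maxn s1 s2).
by apply: cyc_lin; apply: cyc_sub (fun _ _ => isT) _; [apply: h1; rewrite leq_maxl|apply: h2; rewrite leq_maxr].
Qed.

Lemma seqspan_op i u : seqspan u -> seqspan (E i u).
Proof. by case=> s h; exists s; apply: cyc_op. Qed.

Lemma seqspan0 : seqspan 0.
Proof. by exists 0%N; apply: cyc0. Qed.

Variables (f h : int -> U -> U) (lam : nat -> K) (fb : int).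
Hypothesis f_linear : forall i, linear (f i).
Hypothesis h_linear : forall i, linear (h i).
Hypothesis fe : forall j l u, l + j < 0 -> f j (E l u) = E l (f j u) - h (l + j) u.
Hypothesis he : forall i j u, h i (E j u) = E j (h i u) + E (i + j) u *+ 2.
Hypothesis f_om : forall s j, j < fb + (s *+ 2)%:Z -> f j (om s) = 0.
Hypothesis h_om : forall s i, i < 0 -> h i (om s) = 0.

(** Write the vector with modes e_l, l < -|j|. Moving f_j past e_l then leaves only h_(l+j), of
    negative index and without central term; it kills the generator and preserves the span of such
    modes. For large s, f_j kills the generator too. *)
Lemma seqspan_f j u : seqspan u -> seqspan (f j u).
Proof.
move=> /(seqspan_below (- `|j|%:Z))[s0 hs0].
pose s := maxn s0 `|(j - fb)%R|.+1%N.
have hs := hs0 s (leq_maxl _ _); exists s.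
have fj : f j (om s) = 0 by apply: f_om; rewrite /s; lia.
have hcyc i v : i < 0 -> cyc (fun i => i < - `|j|%:Z) (om s) v ->
    cyc (fun i => i < - `|j|%:Z) (om s) (h i v).
  move=> i0; elim=> [|l {}v lj cv IH|a v1 v2 _ h1 _ h2].
  - by rewrite h_om //; apply: cyc0.
  - rewrite he mulr2n; apply: cycD; first exact: cyc_op.
    by apply: cycD; apply: cyc_op => //; lia.
  - by rewrite h_linear; apply: cyc_lin.
apply: (@cyc_sub (fun i => i < - `|j|%:Z)) => //.
elim: hs => [|l v lj cv IH|a v1 v2 _ h1 _ h2].
- by rewrite fj; apply: cyc0.
- rewrite fe; last by lia.
  apply: cycD; first exact: cyc_op.
  by rewrite -scaleN1r; apply/cycZ/hcyc => //; lia.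
- by rewrite f_linear; apply: cyc_lin.
Qed.

End Sequence.
End CyclicSpan.

(** * The modes of f and h on the tensor power *)

HB.lock Definition ft (K : numFieldType) (k : nat) (n : int) : FockT K k -> FockT K k :=
  coproduct (@f_mode K n).
HB.lock Definition ht (K : numFieldType) (k : nat) (n : int) : FockT K k -> FockT K k :=
  coproduct (@h_mode K n).

Lemma lin_ext_ind2 (K : fieldType) (T : choiceType) (V : lmodType K) (P : V -> V -> Prop)
    (g g' : T -> V) x :
  (forall a u v u' v', P u u' -> P v v' -> P (a *: u + v) (a *: u' + v')) -> P 0 0 ->
  (forall b, P (g b) (g' b)) -> P (lin_ext g x) (lin_ext g' x).
Proof.
move=> Pl P0 Pg; rewrite /lin_ext; elim/big_ind2: _ => [//|v v' w w' Pv Pw|b _].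
  by rewrite -[v]scale1r -[v']scale1r; apply: Pl.
by rewrite -[_ *: g b]addr0 -[_ *: g' b]addr0; apply: Pl.
Qed.

Section TensorLie.
Variables (K : numFieldType) (k : nat).
Local Notation FT := (FockT K k).

Lemma ft_linear n : linear (@ft K k n).
Proof. by rewrite ft.unlock; apply: coproduct_linear. Qed.

Lemma ht_linear n : linear (@ht K k n).
Proof. by rewrite ht.unlock; apply: coproduct_linear. Qed.

Lemma etC i j (u : FT) : et i (et j u) = et j (et i u).
Proof.
have := @etopC K k (- (`|i| + `|j|)) `|(i + `|i| + `|j|)%R|%N `|(j + `|i| + `|j|)%R|%N u.
rewrite /etop.
have -> : - (`|i| + `|j|) + `|(i + `|i| + `|j|)%R|%N%:Z = i by lia.
by have -> : - (`|i| + `|j|) + `|(j + `|i| + `|j|)%R|%N%:Z = j by lia.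
Qed.

Lemma et_ftE n (u : FT) : et n (ft 0 u) - ft 0 (et n u) = ht n u.
Proof.
rewrite et.unlock ft.unlock ht.unlock.
by apply: etrans (coproduct_comm u (@e_mode_linear K n) (@f_mode_linear K 0)) _.
Qed.

Lemma ft_et l j (u : FT) : l + j < 0 -> ft j (et l u) = et l (ft j u) - ht (l + j) u.
Proof.
move=> lj; have E : et l (ft j u) - ft j (et l u) = ht (l + j) u.
  rewrite et.unlock ft.unlock ht.unlock.
  apply: etrans (coproduct_comm u (@e_mode_linear K l) (@f_mode_linear K j)) _.
  apply: (f_equal (fun T => coproduct T u)); apply: funext => v.
  apply: etrans (comm_e_f l j v) _; case: eqP => [lj0|_]; first by lia.
  by rewrite scale0r subr0.
by rewrite -E opprB addrC subrK.
Qed.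

Lemma coproduct_dbl (T : Fock K -> Fock K) (u : FT) :
  coproduct (fun v => T v *+ 2) u = coproduct T u *+ 2.
Proof.
apply: etrans (_ : coproduct (fun v => 1 *: T v + T v) u = _).
  by apply: (f_equal (fun T => coproduct T u)); apply: funext => v; rewrite scale1r mulr2n.
by rewrite coproduct_linear_op scale1r mulr2n.
Qed.

Lemma ht_et i j (u : FT) : ht i (et j u) = et j (ht i u) + et (i + j) u *+ 2.
Proof.
apply/eqP; rewrite addrC -subr_eq; apply/eqP.
rewrite et.unlock ht.unlock -coproduct_dbl.
apply: etrans (coproduct_comm u (@h_mode_linear K i) (@e_mode_linear K j)) _.
by apply: (f_equal (fun T => coproduct T u)); apply: funext => v; exact: comm_h_e.
Qed.

Lemma coproduct_tvec0 (T : Fock K -> Fock K) m :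
  (forall a, (a < k)%N -> T (vvec K (m a)) = 0) -> coproduct T (tvec K k m) = 0.
Proof. by move=> T0; rewrite coproductE big1 // => a _; apply: place_tvec0; apply: T0. Qed.

Lemma et_tvec n m : (forall a, (a < k)%N -> n <= m a) -> et n (tvec K k m) = 0.
Proof. by move=> nm; rewrite et.unlock; apply: coproduct_tvec0 => a ak; apply/e_vvec/nm. Qed.

Lemma ft_tvec n m : (forall a, (a < k)%N -> n < 1 - m a) -> ft n (tvec K k m) = 0.
Proof. by move=> nm; rewrite ft.unlock; apply: coproduct_tvec0 => a ak; apply/f_vvec/nm. Qed.

Lemma ht_tvec n m : n < 0 -> ht n (tvec K k m) = 0.
Proof. by move=> n0; rewrite ht.unlock; apply: coproduct_tvec0 => a ak; apply/h_vvec. Qed.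

Lemma coproduct_id (u : FT) : coproduct (fun v => v) u = k%:R *: u.
Proof.
move: u; apply: linear_malg_ext; [exact: coproduct_linear|exact: lin_scale|].
move=> t; rewrite coproductE (eq_bigr (fun=> << t >>)); last first.
  by move=> a _; rewrite placeU putU upd_id.
by rewrite sumr_const card_ord scaler_nat.
Qed.

(** The modes of e and f suffice, as h_n = [e_n, f_0] and c acts by the scalar k. The binary form
    applies to graphs of homomorphisms. *)
Lemma FockT_act_closed2 (P : FT -> FT -> Prop) :
  (forall a u v u' v', P u u' -> P v v' -> P (a *: u + v) (a *: u' + v')) -> P 0 0 ->
  (forall i u u', P u u' -> P (et i u) (et i u')) ->
  (forall i u u', P u u' -> P (ft i u) (ft i u')) ->
  forall x u u', P u u' -> P (FockT_act x u) (FockT_act x u').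
Proof.
move=> Pl P0 Pe Pf x u u' Pu.
apply: lin_ext_ind2 => // b; case: b => [[[] i]|] /=.
- by have := Pe i u u' Pu; rewrite et.unlock.
- by have := Pf i u u' Pu; rewrite ft.unlock.
- suff : P (ht i u) (ht i u') by rewrite ht.unlock.
  rewrite -!et_ftE ![_ - ft 0 _]addrC -!scaleN1r; apply: Pl; first exact/Pf/Pe.
  exact/Pe/Pf.
- have idE (v : FT) : coproduct (@Fock_act K None) v = k%:R *: v by exact: coproduct_id.
  by rewrite !idE -[_ *: u]addr0 -[_ *: u']addr0; apply: Pl.
Qed.

Lemma FockT_act_closed (P : FT -> Prop) :
  (forall a u v, P u -> P v -> P (a *: u + v)) -> P 0 ->
  (forall i u, P u -> P (et i u)) -> (forall i u, P u -> P (ft i u)) ->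
  forall x u, P u -> P (FockT_act x u).
Proof.
move=> Pl P0 Pe Pf x u Pu.
apply: (@FockT_act_closed2 (fun v _ => P v) _ P0 _ _ x u u Pu) => [a v w _ _|i v _|i v _].
- exact: Pl.
- exact: Pe.
- exact: Pf.
Qed.

End TensorLie.

(** * The module of a nondecreasing sequence *)

Section WedgeModule.
Variables (K : numFieldType) (k : nat) (t0 : int) (c : nat -> nat).
Local Notation FT := (FockT K k).

Definition wseq (s : nat) : FT := wtop K k (seqtop t0 s) c.

Definition wspan : FT -> Prop := seqspan (@et K k) wseq.

Definition wmod : premodule K := @Premodule K FT (@FockT_act K k) [set u | wspan u]%classic.

Definition wscal (s : nat) : K := k`!%:R * \prod_(a < k) wsign K (seqtop t0 s.+1) (c a).

Lemma wseq_ft m s j : (forall a, (a < k)%N -> (c a <= m)%N) ->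
  j < 1 - t0 - m%:Z + (s *+ 2)%:Z -> ft j (wseq s) = 0.
Proof. by move=> cm h; apply: ft_tvec => a ak; have := cm a ak; rewrite /seqtop; lia. Qed.

Lemma wseq_ht s i : i < 0 -> ht i (wseq s) = 0.
Proof. exact: ht_tvec. Qed.

Lemma wseq_et s i : i < seqtop t0 s -> et i (wseq s) = 0.
Proof. by move=> h; apply: et_tvec => a ak; lia. Qed.

Hypothesis cn : nondecr k c.

Lemma wseq_annih s P : ideal (crel k c) P ->
  act (fun j : nat => @et K k (seqtop t0 s + j%:Z)) P (wseq s) = 0.
Proof. exact: crel_wtop. Qed.

Lemma wscal_neq0 s : wscal s != 0.
Proof.
rewrite mulf_neq0 ?pnatr_eq0 -?lt0n ?fact_gt0 // prodf_seq_neq0; apply/allP => a _ /=.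
by rewrite /wsign /psign; case: ifP; rewrite ?oppr_eq0 oner_eq0.
Qed.

Lemma wseq_shift s : wtop K k (seqtop t0 s.+1) (raise2 k c) = wseq s.
Proof. by apply: eq_tvec => a ak; rewrite /raise2 ak /seqtop; lia. Qed.

Hypothesis k0 : (0 < k)%N.

Lemma wseq_step s :
  act (fun j : nat => @et K k (seqtop t0 s.+1 + j%:Z)) (ccoef K k (csum c k)) (wseq s.+1)
  = wscal s *: wseq s.
Proof.
have kk : (0 < k <= k)%N by rewrite k0 leqnn.
have kn : (k < k)%N -> (c k.-1 < c k)%N by rewrite ltnn.
by rewrite -(wseq_shift s); exact: (lead_wtop K (seqtop t0 s.+1) cn kk kn).
Qed.

Let span_lin := seqspan_lin (@et_linear K k) (@etC K k) k0 wseq_annih wscal_neq0 wseq_step.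

Lemma wspan_f j u : wspan u -> wspan (ft j u).
Proof.
pose m := (\max_(a < k) c a)%N.
apply: (seqspan_f (@et_linear K k) (@etC K k) k0 wseq_annih wscal_neq0 wseq_step
  (@ft_linear K k) (@ht_linear K k) (fb := 1 - t0 - m%:Z)).
- by move=> i l v; exact: ft_et.
- exact: ht_et.
- move=> s i; apply: wseq_ft => a ak.
  exact: (@leq_bigmax _ (fun a : 'I_k => c a) (Ordinal ak)).
- exact: wseq_ht.
Qed.

Lemma wspan_act x u : wspan u -> wspan (FockT_act x u).
Proof.
apply: FockT_act_closed; first exact: span_lin.
- exact: seqspan0.
- by move=> i v; apply: seqspan_op.
- exact: wspan_f.
Qed.

Lemma wmod_module : is_module wmod.
Proof.
split=> /=.
- exact: seqspan0.
- by move=> a u v; exact: span_lin.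
- exact: wspan_act.
- by move=> x a u v _ _; exact: FockT_act_linear.
- by move=> x y a u _; exact: (FockT_act_linearl u).
- by move=> x y u _; exact: FockT_bracket.
Qed.

Lemma wspan_lin a u v : wspan u -> wspan v -> wspan (a *: u + v).
Proof. exact: span_lin. Qed.

Lemma wspan_below b u : wspan u ->
  exists s0, forall s, (s0 <= s)%N -> cyc (@et K k) (fun i => i < b) (wseq s) u.
Proof. exact: (seqspan_below (@et_linear K k) (@etC K k) k0 wseq_annih wscal_neq0 wseq_step). Qed.

End WedgeModule.

Lemma sum_terms_lin (K : fieldType) (V : lmodType K) (T : Type) (f : T -> V) (a : K)
    (P1 P2 : seq (K * T)) :
  a *: \sum_(m <- P1) m.1 *: f m.2 + \sum_(m <- P2) m.1 *: f m.2
  = \sum_(m <- [seq (a * m.1, m.2) | m <- P1] ++ P2) m.1 *: f m.2.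
Proof.
rewrite big_cat big_map scaler_sumr /=; congr (_ + _).
by apply: eq_bigr => m _; rewrite scalerA.
Qed.

(** * Comparison with L^D *)

Section LDModule.
Variables (K : numFieldType) (k : nat) (D : k.+1.-tuple nat).

Lemma leq_beta i : (i <= k.+1)%N -> (beta D i <= Defs.total D)%N.
Proof.
move=> ik; by rewrite /Defs.total /beta (@big_cat_nat _ _ _ i.+1 1 k.+2) //= leq_addl.
Qed.

Lemma e_actE i : e_act i = @et K k i.
Proof. by apply: funext => u; rewrite /e_act FockT_actU et.unlock. Qed.

Lemma Mspace_cyc s (u : FockT K k) : Mspace D s u -> cyc (@et K k) xpredT (wvec K D s) u.
Proof.
case=> P ->; apply: cyc_sum => m _; apply: cycZ.
elim: m.2 => [|j r IH] /=; first exact: cyc_base.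
by rewrite e_actE; apply: cyc_op.
Qed.

(** A mode e_i with i <= -(n+2s) kills w_s, because every beta is at most n; so the bound on the
    factors in M_s loses nothing. *)
Lemma cyc_Mspace s (u : FockT K k) :
  cyc (@et K k) (fun i => i < 1) (wvec K D s) u -> Mspace D s u.
Proof.
pose N := (Defs.total D + 2 * s)%N.
pose f (r : seq 'I_N) := foldr (fun j : 'I_N => @e_act K k (- (j : nat)%:Z)) (wvec K D s) r.
have key u' : cyc (@et K k) (fun i => i < 1) (wvec K D s) u' ->
    exists P : seq (K * seq 'I_N), u' = \sum_(m <- P) m.1 *: f m.2.
  elim=> [|i {}u i1 _ [P ->]|a u1 u2 _ [P1 ->] _ [P2 ->]].
  - by exists [:: (1, [::])]; rewrite big_seq1 scale1r.
  - rewrite (lin_sum (et_linear i)).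
    have [iN|iN] := ltnP `|i|%N N.
      exists [seq (m.1, Ordinal iN :: m.2) | m <- P]; rewrite big_map.
      apply: eq_bigr => m _; rewrite (linZ (et_linear i)) /= e_actE.
      by congr (_ *: et _ _); lia.
    exists [::]; rewrite big_nil big1 // => m _; rewrite (linZ (et_linear i)).
    suff -> : et i (f m.2) = 0 by rewrite scaler0.
    elim: m.2 => [|j r IH] /=.
      apply: (@et_tvec K k i (fun a => - (beta D a.+1)%:Z - (s *+ 2)%:Z)) => a ak.
      by have := @leq_beta a.+1; rewrite /N in iN; lia.
    by rewrite e_actE etC IH (lin0 (et_linear _)).
  - exists ([seq (a * m.1, m.2) | m <- P1] ++ P2).
    exact: sum_terms_lin.
exact: key.
Qed.

Lemma LD_wmod0 t0 c : (0 < k)%N -> nondecr k c ->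
  (forall a, (a < k)%N -> t0 + (c a)%:Z - 1 = - (beta D a.+1)%:Z) ->
  LD K D = wmod K k t0 c.
Proof.
move=> k0 cn cD; congr Premodule.
have wE s : wseq K k t0 c s = wvec K D s.
  apply: (@eq_tvec K k (fun a => seqtop t0 s + (c a)%:Z - 1)
    (fun a => - (beta D a.+1)%:Z - (s *+ 2)%:Z)) => a ak.
  by have := cD a ak; rewrite /seqtop; lia.
apply/seteqP; split=> u /=; first by case=> s s0 /Mspace_cyc h; exists s; rewrite wE.
(* The successor of [s0] is taken because the union defining L^D starts at s = 1. *)
case/(wspan_below cn k0 1) => s0 h; exists s0.+1 => //; apply: cyc_Mspace.
by rewrite -wE; apply: h.
Qed.

End LDModule.

Lemma wmod_shift (K : numFieldType) (k : nat) t0 c q : (0 < k)%N -> nondecr k c ->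
  wmod K k (t0 - (q *+ 2)%:Z) c = wmod K k t0 c.
Proof.
move=> k0 cn; congr Premodule.
have wE s : wseq K k (t0 - (q *+ 2)%:Z) c s = wseq K k t0 c (s + q).
  by apply: eq_tvec => a ak; rewrite /seqtop; lia.
apply/seteqP; split=> u /=; first by case=> s h; exists (s + q)%N; rewrite -wE.
case/(wspan_below cn k0 0) => s0 h; exists s0; rewrite wE.
by apply: (cyc_sub _ (h _ (leq_addr _ _))).
Qed.

(** The chain for t0 - 2q is a tail of the chain for t0, so an even shift of all factors does not
    change the union. *)
Lemma LD_wmod (K : numFieldType) (k : nat) (D : k.+1.-tuple nat) t0 c q :
  (0 < k)%N -> nondecr k c ->
  (forall a, (a < k)%N -> t0 + (c a)%:Z - 1 = - (beta D a.+1)%:Z - (q *+ 2)%:Z) ->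
  LD K D = wmod K k t0 c.
Proof.
move=> k0 cn cD; rewrite -(addrK (q *+ 2)%:Z t0) wmod_shift //.
by apply: LD_wmod0 => // a ak; have := cD a ak; lia.
Qed.

(** * Permutations of the tensor factors *)

HB.lock Definition ptens (K : numFieldType) (k : nat) (s : {perm 'I_k}) : FockT K k -> FockT K k :=
  lin_ext (fun t : {ffun 'I_k -> semimon} => << [ffun a => t (s a)] >>).

Section Permute.
Variables (K : numFieldType) (k : nat).
Local Notation FT := (FockT K k).
Implicit Types (s : {perm 'I_k}) (u : FT).

Lemma ptens_linear s : linear (@ptens K k s).
Proof. by rewrite ptens.unlock; exact: lin_ext_is_linear. Qed.

Lemma ptensU s (t : {ffun 'I_k -> semimon}) : ptens s << t >> = << [ffun a => t (s a)] >> :> FT.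
Proof. by rewrite ptens.unlock; exact: lin_extU. Qed.

Lemma ptensK s u : ptens s^-1%g (ptens s u) = u.
Proof.
move: u; apply: linear_malg_ext.
- exact: lin_comp (ptens_linear _) (ptens_linear _).
- by move=> a u v.
by move=> t; rewrite !ptensU; congr << _ >>; apply/ffunP => a; rewrite !ffunE permKV.
Qed.

Lemma ptens_put s (t : {ffun 'I_k -> semimon}) a (u : Fock K) :
  ptens s (put t (s a) u) = put [ffun b => t (s b)] a u :> FT.
Proof.
move: u; apply: linear_malg_ext.
- exact: lin_comp (ptens_linear _) (@put_linear K k _ _).
- exact: put_linear.
move=> X; rewrite !putU ptensU; congr << _ >>; apply/ffunP => b.
by rewrite !ffunE (inj_eq perm_inj).
Qed.

Lemma ptens_coproduct s T u : ptens s (coproduct T u) = coproduct T (ptens s u) :> FT.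
Proof.
move: u; apply: linear_malg_ext.
- exact: lin_comp (ptens_linear _) (coproduct_linear _).
- exact: lin_comp (coproduct_linear _) (ptens_linear _).
move=> t; rewrite ptensU !coproductE (lin_sum (ptens_linear s)) (reindex_inj (@perm_inj _ s)).
by apply: eq_bigr => a _; rewrite !placeU ffunE; exact: ptens_put.
Qed.

Lemma ptens_act s x u : ptens s (FockT_act x u) = FockT_act x (ptens s u).
Proof.
rewrite /FockT_act /lin_ext (lin_sum (ptens_linear s)); apply: eq_bigr => b _.
by rewrite (linZ (ptens_linear s)); congr (_ *: _); exact: ptens_coproduct.
Qed.

Lemma ptens_et s i u : ptens s (et i u) = et i (ptens s u).
Proof. by rewrite et.unlock; exact: ptens_coproduct. Qed.

Lemma ptens_tvec s (m m' : nat -> int) : (forall a : 'I_k, m' a = m (s a)) ->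
  ptens s (tvec K k m) = tvec K k m'.
Proof. by move=> mm; rewrite /tvec ptensU; congr << _ >>; apply/ffunP => a; rewrite !ffunE mm. Qed.

End Permute.

(** * Isomorphisms from relations, and split submodules *)

Lemma dsum_module (K : fieldType) (M N : premodule K) :
  is_module M -> is_module N -> is_module (dsum M N).
Proof.
move=> hM hN; split=> /=.
- by split; exact: module0.
- by move=> a u v [u1 u2] [v1 v2]; split; exact: module_lin.
- by move=> x u [u1 u2]; split; exact: module_act.
- move=> x a u v [u1 u2] [v1 v2].
  by rewrite (module_linr hM) // (module_linr hN).
- move=> x y a u [u1 u2].
  by rewrite (module_linl hM) // (module_linl hN).
- move=> x y u [u1 u2].
  by rewrite (module_bracket hM) // (module_bracket hN).
Qed.

(** A relation can be generated by pairs of generators, and single-valuedness is then only checked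
    at 0. The map is chosen from it, with value 0 off the carrier. *)
Lemma module_iso_relation (K : fieldType) (M N : premodule K) (R : mspace M -> mspace N -> Prop) :
  is_module M -> is_module N ->
  (forall u y, R u y -> mcarrier u /\ mcarrier y) ->
  (forall a u v y z, R u y -> R v z -> R (a *: u + v) (a *: y + z)) ->
  (forall x u y, R u y -> R (maction x u) (maction x y)) ->
  (forall u, mcarrier u -> exists y, R u y) -> (forall y, mcarrier y -> exists u, R u y) ->
  (forall y, R 0 y -> y = 0) -> (forall u, R u 0 -> u = 0) ->
  module_iso M N.
Proof.
move=> hM hN Rc Rl Ra Rtot Ronto Rfun Rinj.
have Rsub u v y z : R u y -> R v z -> R (u - v) (y - z).
  by move=> h h'; have := Rl (-1) _ _ _ _ h' h; rewrite !scaleN1r ![- _ + _]addrC.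
have Runiq u y z : R u y -> R u z -> y = z.
  by move=> h h'; apply/eqP; rewrite -subr_eq0; apply/eqP/Rfun; rewrite -(subrr u); apply: Rsub.
have [phi phiP] : exists phi, forall u, mcarrier u -> R u (phi u).
  suff /choice[phi h] : forall u, exists y, mcarrier u -> R u y by exists phi.
  move=> u; have [|nu] := pselect (mcarrier u); last by exists 0.
  by move=> /Rtot[y Ry]; exists y.
split=> //; exists phi; split.
- split.
  + by move=> u /= Mu; apply: (Rc _ _ (phiP u Mu)).2.
  + move=> u v; rewrite !inE => Mu Mv E; apply/eqP; rewrite -subr_eq0; apply/eqP/Rinj.
    by have := Rsub _ _ _ _ (phiP u Mu) (phiP v Mv); rewrite E subrr.
  + move=> y Ny; have [u Ru] := Ronto y Ny; have [Mu _] := Rc _ _ Ru.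
    by exists u => //; apply: Runiq (phiP u Mu) Ru.
- move=> a u v Mu Mv; apply: Runiq (phiP _ _) (Rl _ _ _ _ _ (phiP u Mu) (phiP v Mv)).
  exact: (module_lin hM).
- move=> x u Mu; apply: Runiq (phiP _ _) (Ra _ _ _ (phiP u Mu)).
  exact: (module_act hM).
Qed.

Section Splitting.
Variables (K : fieldType) (M N1 N2 : premodule K).
Variables (iota : mspace N1 -> mspace M) (orth : mspace M -> Prop).
Variable G : mspace M -> mspace N2 -> Prop.
Hypotheses (hM : is_module M) (hN1 : is_module N1) (hN2 : is_module N2).
Hypothesis iota_linear : linear iota.
Hypothesis iota_in : forall y, mcarrier y -> mcarrier (iota y).
Hypothesis iota_act : forall x y, iota (maction x y) = maction x (iota y).
Hypothesis orth_lin : forall a u v, orth u -> orth v -> orth (a *: u + v).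
Hypothesis orth_act : forall x u, orth u -> orth (maction x u).
Hypothesis orth_iota : forall y, mcarrier y -> orth (iota y) -> y = 0.
Hypothesis orth_proj : forall u, mcarrier u -> exists2 y, mcarrier y & orth (u - iota y).
Hypothesis G_in : forall u y, G u y -> mcarrier u /\ mcarrier y.
Hypothesis G_lin : forall a u v y z, G u y -> G v z -> G (a *: u + v) (a *: y + z).
Hypothesis G_act : forall x u y, G u y -> G (maction x u) (maction x y).
Hypothesis G_total : forall u, mcarrier u -> exists y, G u y.
Hypothesis G_onto : forall y, mcarrier y -> exists u, G u y.
Hypothesis G_fun : forall y, G 0 y -> y = 0.
Hypothesis G_ker : forall u, G u 0 -> exists2 y, mcarrier y & u = iota y.
Hypothesis G_iota : forall y, mcarrier y -> G (iota y) 0.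

Lemma module_iso_split : module_iso M (dsum N1 N2).
Proof.
(* [u] corresponds to its projection to [N1] along [orth], together with its image in [N2] under the
   surjection with graph [G]. *)
pose R u (p : mspace (dsum N1 N2)) := [/\ mcarrier p.1, orth (u - iota p.1) & G u p.2].
have N1sub y z : mcarrier y -> mcarrier z -> @mcarrier _ N1 (y - z).
  by move=> hy hz; rewrite addrC -scaleN1r; apply: (module_lin hN1).
apply: (module_iso_relation (R := R)) => //.
- exact: dsum_module.
- by move=> u y [y1 _ /G_in[]].
- move=> a u v y z [y1 oy Gy] [z1 oz Gz]; split=> /=.
  + exact: (module_lin hN1).
  + have -> : a *: u + v - iota (a *: y.1 + z.1) = a *: (u - iota y.1) + (v - iota z.1).
      by rewrite iota_linear scalerBr opprD addrACA.
    exact: orth_lin.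
  + exact: G_lin.
- move=> x u y [y1 oy Gy]; split=> /=.
  + exact: (module_act hN1).
  + have [uM _] := G_in Gy; have -> : maction x u - iota (maction x y.1) = maction x (u - iota y.1).
      rewrite iota_act -![_ - _]addrC -!scaleN1r (module_linr hM) //; exact: iota_in.
    exact: orth_act.
  + exact: G_act.
- move=> u Mu; have [y1 hy1 o1] := orth_proj Mu; have [y2 G2] := G_total Mu.
  by exists (y1, y2).
- move=> [y1 y2] [/= h1 h2]; have [u Gu] := G_onto h2.
  have [Mu _] := G_in Gu; have [z hz oz] := orth_proj Mu.
  (* Exchanging the component [z] of [u] for [y1] keeps the image [y2], as [G] relates the image of
     [iota] to 0. *)
  exists (u - iota z + iota y1); split=> //=; first by rewrite addrK.
  have -> : u - iota z + iota y1 = 1 *: u + iota (y1 - z).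
    by rewrite (linB iota_linear) scale1r addrAC addrA.
  by rewrite -[y2]addr0 -[y2]scale1r; apply: G_lin => //; apply/G_iota/N1sub.
- move=> [y1 y2] [/= h1 o1 G2]; rewrite (G_fun G2); congr (_, _).
  have hN : @mcarrier _ N1 (- y1) by rewrite -[- y1]add0r; apply: N1sub => //; exact: module0.
  apply: oppr_inj; rewrite oppr0; apply: orth_iota => //.
  by rewrite (linN iota_linear) -[- _]add0r.
- move=> u [/= h1]; rewrite (lin0 iota_linear) subr0 => ou /G_ker[y hy uE].
  by rewrite uE in ou *; rewrite (orth_iota hy ou) (lin0 iota_linear).
Qed.

Hypothesis iota_onto : forall u, mcarrier u -> exists2 y, mcarrier y & u = iota y.

Lemma module_iso_onto : (forall y, iota y = 0 -> y = 0) -> module_iso M N1.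
Proof.
move=> inj; apply: (module_iso_relation (R := fun u y => mcarrier y /\ u = iota y)) => //.
- by move=> u y [hy ->]; split=> //; exact: iota_in.
- by move=> a u v y z [hy ->] [hz ->]; split; [exact: (module_lin hN1)|rewrite iota_linear].
- by move=> x u y [hy ->]; split; [exact: (module_act hN1)|rewrite iota_act].
- by move=> u /iota_onto[y hy ->]; exists y.
- by move=> y hy; exists (iota y).
- by move=> y [_ /esym/inj].
- by move=> u [_ ->]; exact: lin0.
Qed.

End Splitting.

(** * The Hermitian form *)

Section HermitianForm.
Variables (C : numClosedFieldType) (T : choiceType).
Local Notation V := {malg C[T]}.
Implicit Types (u v w : V) (t : T).

Definition form u v : C := lin_ext (fun t => (v@_t)^* : C^o) u.

Lemma form_linear v : linear (fun u => form u v : C^o).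
Proof. exact: lin_ext_is_linear. Qed.

Lemma formC u v : form v u = (form u v)^*.
Proof.
have uv : (msupp u `<=` msupp u `|` msupp v)%fset by exact: fsubsetUl.
have vu : (msupp v `<=` msupp u `|` msupp v)%fset by exact: fsubsetUr.
rewrite /form (lin_extEw _ uv) (lin_extEw _ vu) rmorph_sum; apply: eq_bigr => t _.
have conj_mul (a b : C) : a * b^* = (b * a^*)^* by rewrite rmorphM /= conjCK mulrC.
exact: conj_mul.
Qed.

Lemma formU t v : form << t >> v = (v@_t)^*.
Proof. exact: (@lin_extU C T C^o (fun s => (v@_s)^*) t). Qed.

Lemma form_coef u t : form u << t >> = u@_t.
Proof. by rewrite formC formU conjCK. Qed.

Lemma form0 v : form 0 v = 0. Proof. exact: (lin0 (form_linear v)). Qed.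
Lemma formr0 u : form u 0 = 0. Proof. by rewrite formC form0 conjC0. Qed.

Lemma formD u v w : form (u + v) w = form u w + form v w.
Proof. exact: (linD (form_linear w)). Qed.

Lemma formZ a u w : form (a *: u) w = a * form u w.
Proof. exact: (linZ (form_linear w)). Qed.

Lemma form_linr a u v w : form u (a *: v + w) = a^* * form u v + form u w.
Proof. by rewrite formC formD formZ rmorphD rmorphM /= -!formC. Qed.

Lemma form_eq0 u : form u u = 0 -> u = 0.
Proof.
rewrite /form /lin_ext => /eqP; rewrite psumr_eq0 => [/allP h|t _]; last exact: mul_conjC_ge0.
apply/malgP => t; rewrite mcoeff0; have [/h /=|] := boolP (t \in msupp u).
  by rewrite mul_conjC_eq0 => /eqP.
by rewrite -mcoeff_eq0 => /eqP.
Qed.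

Lemma form_fsuml (F : int -> V) v : fsupp F -> form (fsum F) v = fsum (fun i => form (F i) v : C^o).
Proof. by move=> fF; apply: (fsum_lin (form_linear v) fF). Qed.

Lemma form_fsumr (F : int -> V) v : fsupp F -> form v (fsum F) = fsum (fun i => form v (F i) : C^o).
Proof.
move=> fF; rewrite formC form_fsuml //; have [A FA] := fsuppP fF.
rewrite !(@fsumE _ _ A).
- by rewrite rmorph_sum; apply: eq_bigr => i _; rewrite [RHS]formC.
- by move=> i /FA ->; rewrite formr0.
- by move=> i /FA ->; rewrite form0.
Qed.

Definition orthogonal (N : V -> Prop) u := forall n, N n -> form u n = 0.

Lemma orthogonal_lin N a u v : orthogonal N u -> orthogonal N v -> orthogonal N (a *: u + v).
Proof. by move=> hu hv n Nn; rewrite formD formZ hu // hv // mulr0 addr0. Qed.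

(* Gram-Schmidt: peel off one basis vector of the support at a time. *)
Lemma finite_projection (S : seq T) (N : V -> Prop) :
  N 0 -> (forall a u v, N u -> N v -> N (a *: u + v)) ->
  (forall n, N n -> forall t, t \notin S -> n@_t = 0) ->
  forall u, exists2 n, N n & orthogonal N (u - n).
Proof.
elim: S N => [|t S IH] N N0 Nl NS u.
  exists 0 => // n Nn; suff -> : n = 0 by rewrite formr0.
  by apply/malgP => t; rewrite (NS n Nn) // mcoeff0.
pose N' n := N n /\ n@_t = 0.
have NZ a v : N v -> N (a *: v) by move=> Nv; rewrite -[_ *: _]addr0; apply: Nl.
have {}IH v : exists2 n, N' n & orthogonal N' (v - n).
  apply: IH; first by split; rewrite ?mcoeff0.
    move=> a x y [Nx xt] [Ny yt]; split; first exact: Nl.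
    by rewrite mcoeffD mcoeffZ xt yt mulr0 addr0.
  move=> n [Nn nt] s sS; have [->//|st] := eqVneq s t.
  by apply: NS => //; rewrite inE negb_or st.
have [[m Nm mt]|no] := pselect (exists2 m, N m & m@_t != 0); last first.
  have [n [Nn _] on] := IH u; exists n => // n' Nn'; apply: on; split=> //.
  by apply: contrapT => /eqP nt; apply: no; exists n'.
(* [m1] spans [N] modulo [N'] and is orthogonal to [N'], so the projection to [N] is the one to [N']
   plus the component along [m1]. *)
have [m' [Nm' m't] om'] := IH m; pose m1 := m - m'.
have Nm1 : N m1 by rewrite /m1 addrC -scaleN1r; apply: Nl.
have m1t : m1@_t != 0 by rewrite mcoeffB m't subr0.
have m1m1 : form m1 m1 != 0.
  by apply: contraNneq m1t => /form_eq0 ->; rewrite mcoeff0.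
have [n0 [Nn0 n0t] on0] := IH u; pose a := form (u - n0) m1 / form m1 m1.
exists (a *: m1 + n0); first exact: Nl.
move=> n' Nn'; pose b := n'@_t / m1@_t.
have -> : n' = b *: m1 + (- b *: m1 + n') by rewrite scaleNr addrA subrr add0r.
have N'r : N' (- b *: m1 + n').
  by split; [exact: Nl | rewrite mcoeffD mcoeffZ mulNr divfK // addNr].
have -> : u - (a *: m1 + n0) = - a *: m1 + (u - n0) by rewrite scaleNr opprD addrA addrAC addrC.
rewrite form_linr !(formD (- a *: m1) (u - n0)) !formZ (on0 _ N'r) (om' _ N'r : form m1 _ = 0).
by rewrite mulr0 addr0 /a mulNr divfK // addNr mulr0 addr0.
Qed.

Definition adjoint (A B : V -> V) := forall u v, form (A u) v = form u (B v).

Lemma adjoint_sym A B : adjoint A B -> adjoint B A.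
Proof. by move=> AB u v; rewrite formC -AB -formC. Qed.

Lemma adjoint_basis A B : linear A -> linear B ->
  (forall s t, (A << s >>)@_t = ((B << t >>)@_s)^*) -> adjoint A B.
Proof.
move=> Al Bl AB u v.
have key t v' : form (A << t >>) v' = form << t >> (B v').
  apply: (inv_inj (@conjCK C)); rewrite -!formC; move: v'; apply: (@linear_malg_ext _ _ C^o).
  - exact: form_linear.
  - exact: (lin_comp (form_linear _) Bl).
  by move=> s; rewrite formU form_coef AB conjCK.
move: u; apply: (@linear_malg_ext _ _ C^o).
- exact: (lin_comp (form_linear _) Al).
- exact: form_linear.
by move=> t; apply: key.
Qed.

Lemma adjoint_sum (I : Type) (r : seq I) (A B : I -> V -> V) :
  (forall i, adjoint (A i) (B i)) ->
  adjoint (fun u => \sum_(i <- r) A i u) (fun u => \sum_(i <- r) B i u).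
Proof.
move=> AB u v; elim: r => [|i r IH]; first by rewrite !big_nil form0 formr0.
by rewrite !big_cons formD IH AB -[B i v]scale1r form_linr conjC1 mul1r scale1r.
Qed.

End HermitianForm.

(** * Adjoints of the modes *)

Section FockAdjoint.
Variable C : numClosedFieldType.

(** Both operators toggle [p], with the same real sign, as toggling [p] does not change what lies to
    its right. *)
Lemma rmul_adjoint p : adjoint (@rmul_var C p) (rder_var p).
Proof.
apply: adjoint_basis; [exact: rmul_linear|exact: rder_linear|].
move=> X Y; rewrite rmulU rderU.
have sgn Z : (nsign C Z p)^* = nsign C Z p.
  by rewrite /nsign rmorphXn rmorphN1.
case oX: (occ X p); case oY: (occ Y p); rewrite ?mcoeff0 ?conjC0 // mcoeffZ mcoeffU.
- rewrite rmorphM /= sgn; case: (toggle Y p =P X) => [YX|_]; last by rewrite conjC0 mulr0.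
  by move: oX; rewrite -YX occ_toggle eqxx oY.
- rewrite mcoeffZ mcoeffU rmorphM /= sgn.
  have -> : (toggle X p == Y) = (toggle Y p == X).
    by apply/eqP/eqP => <-; rewrite toggleK.
  case: eqP => [<-|_]; last by rewrite conjC0 !mulr0.
  by rewrite nsign_toggle ltxx mul1r conjC1.
- case: (toggle X p =P Y) => [XY|_]; last by rewrite mulr0.
  by move: oY; rewrite -XY occ_toggle eqxx oX.
Qed.

(** The adjoint of psi(i) phi(n-i) is phi'(i-n) psi'(-i), hence the shift of the summation index by
    n. *)
Lemma e_mode_adjoint n : adjoint (@e_mode C n) (@f_mode C (- n)).
Proof.
move=> u v; apply: etrans (form_fsuml v (finite_e_mode n u)) _.
apply: etrans (esym (form_fsumr u (finite_f_mode (- n) v))).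
apply: etrans (@fsum_shift C C^o n _) _; apply: eq_fsum => i.
apply: etrans (rmul_adjoint _ _ _) _; apply: etrans (rmul_adjoint _ _ _) _.
have -> : (n - (i + n)) *+ 2 + 1 = (- i) *+ 2 + 1 by lia.
by have -> : (i + n) *+ 2 = (- (- n - i)) *+ 2 by lia.
Qed.

Variable k : nat.
Local Notation FT := (FockT C k).

Lemma coef_put (t t' : {ffun 'I_k -> semimon}) a (u : Fock C) :
  (put t a u)@_t' = if t' == upd t a (t' a) then u@_(t' a) else 0.
Proof.
move: u; apply: (@linear_malg_ext _ _ C^o).
- by move=> x u v; rewrite put_linear mcoeffD mcoeffZ.
- by move=> x u v; case: (_ == _); [rewrite mcoeffD mcoeffZ | rewrite scaler0 addr0].
move=> X; rewrite putU !mcoeffU.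
have -> : (upd t a X == t') = (t' == upd t a (t' a)) && (X == t' a).
  apply/eqP/andP => [<-|[/eqP E /eqP XE]]; last by rewrite XE -E.
  by rewrite updE !eqxx.
by case: (_ == upd _ _ _).
Qed.

Lemma place_adjoint a (A B : Fock C -> Fock C) :
  adjoint A B -> adjoint (@place C k a A) (place a B).
Proof.
move=> AB; apply: adjoint_basis; [exact: place_linear|exact: place_linear|].
move=> s t; rewrite !placeU !coef_put.
have -> : (t == upd s a (t a)) = (s == upd t a (s a)).
  by apply/eqP/eqP => E; rewrite [X in upd X]E upd_upd upd_id.
case: eqP => [_|_]; last by rewrite conjC0.
by rewrite -!form_coef AB -formC.
Qed.

Lemma coproduct_adjoint (A B : Fock C -> Fock C) :
  adjoint A B -> adjoint (@coproduct C k A) (coproduct B).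
Proof.
move=> AB u v; rewrite !coproductE.
by apply: (@adjoint_sum _ _ _ _ (fun a => place a A) (fun a => place a B)) => a; exact: place_adjoint.
Qed.

Lemma et_adjoint n : adjoint (@et C k n) (ft (- n)).
Proof. by rewrite et.unlock ft.unlock; apply/coproduct_adjoint/e_mode_adjoint. Qed.

Lemma ft_adjoint n : adjoint (@ft C k n) (et (- n)).
Proof. by apply: adjoint_sym; have := et_adjoint (- n); rewrite opprK. Qed.

Lemma orthogonal_act (N : FT -> Prop) x u : (forall x n, N n -> N (FockT_act x n)) ->
  orthogonal N u -> orthogonal N (FockT_act x u).
Proof.
move=> Na; move: x u; apply: FockT_act_closed.
- by move=> a u v; exact: orthogonal_lin.
- by move=> n _; exact: form0.
- move=> i u ou n Nn; apply: etrans (et_adjoint _ _ _) _; apply: ou.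
  by have := Na << Some (sl2_f, - i) >> n Nn; rewrite FockT_actU ft.unlock.
- move=> i u ou n Nn; apply: etrans (ft_adjoint _ _ _) _; apply: ou.
  by have := Na << Some (sl2_e, - i) >> n Nn; rewrite FockT_actU et.unlock.
Qed.

End FockAdjoint.

(** * The energy grading of the tensor power *)

Section Energy.
Variables (K : numFieldType) (k : nat).
Local Notation FT := (FockT K k).
Local Notation idx := {ffun 'I_k -> semimon}.

Definition tenergy (t : idx) : int := \sum_(a < k) energy (t a).

Lemma coproduct_energyU (t : idx) :
  coproduct (@energy_op K) << t >> = (tenergy t)%:~R *: << t >> :> FT.
Proof.
rewrite coproductE /tenergy rmorph_sum scaler_suml; apply: eq_bigr => a _.
by rewrite placeU energy_opU (linZ (put_linear _ _)) putU upd_id.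
Qed.

Lemma coproduct_energy_et i (u : FT) : coproduct (@energy_op K) (et i u) =
  et i (coproduct (@energy_op K) u) + (i *+ 2 + 1)%:~R *: et i u.
Proof.
apply/eqP; rewrite addrC -subr_eq; apply/eqP; rewrite et.unlock.
apply: etrans (coproduct_comm u (@energy_op_linear K) (@e_mode_linear K i)) _.
have -> : (i *+ 2 + 1)%:~R *: coproduct (@e_mode K i) u =
    coproduct (fun v => ((i *+ 2 + 1)%:~R - 1) *: e_mode i v + e_mode i v) u.
  by rewrite coproduct_linear_op scalerBl scale1r subrK.
apply: (f_equal (fun T => coproduct T u)); apply: funext => v.
by rewrite scalerBl scale1r subrK; apply/eqP; rewrite subr_eq addrC; apply/eqP/energy_e.
Qed.

Lemma coef_energy (u : FT) t : (coproduct (@energy_op K) u)@_t = (tenergy t)%:~R * u@_t.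
Proof.
move: u; apply: (@linear_malg_ext _ _ K^o).
- by move=> x u v; rewrite coproduct_linear mcoeffD mcoeffZ.
- by move=> x u v; rewrite mcoeffD mcoeffZ mulrDr mulrCA.
move=> s; rewrite coproduct_energyU mcoeffZ mcoeffU.
by case: eqP => [->//|_]; rewrite !mulr0.
Qed.

(** Commuting e_i with the energy operator multiplies it by 2i+1, so all monomials in the image of
    one monomial have the same energy. *)
Lemma et_supp i (s t : idx) : (@et K k i << s >>)@_t != 0 ->
  tenergy t = tenergy s + (i *+ 2 + 1).
Proof.
have /(congr1 (fun u : FT => u@_t)) := coproduct_energy_et i << s >>.
rewrite coef_energy coproduct_energyU (linZ (et_linear i)) mcoeffD !mcoeffZ -mulrDl -intrD.
by move=> + nz => /(mulIf nz) /eqP; rewrite eqr_int => /eqP.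
Qed.

(** An upper bound is enough: energies are nonnegative, and [finite_tenergy] leaves finitely many
    monomials below it. *)
Definition etrunc (b : int) : FT -> FT :=
  lin_ext (fun t => if tenergy t <= b then << t >> else 0).

Lemma etrunc_linear b : linear (etrunc b). Proof. exact: lin_ext_is_linear. Qed.

Lemma etruncU b t : etrunc b << t >> = if tenergy t <= b then << t >> else 0.
Proof. exact: lin_extU. Qed.

Lemma coef_etrunc b (u : FT) t : (etrunc b u)@_t = if tenergy t <= b then u@_t else 0.
Proof.
move: u; apply: (@linear_malg_ext _ _ K^o).
- by move=> x u v; rewrite etrunc_linear mcoeffD mcoeffZ.
- by move=> x u v; case: ifP => _; [rewrite mcoeffD mcoeffZ | rewrite scaler0 addr0].
move=> s; rewrite etruncU !(fun_if (fun u : FT => u@_t)) mcoeff0 mcoeffU.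
by case: eqP => [->//|_]; case: ifP; case: ifP.
Qed.

Lemma etrunc_et b i u : etrunc b (et i u) = et i (etrunc (b - (i *+ 2 + 1)) u).
Proof.
move: u; apply: linear_malg_ext.
- exact: lin_comp (etrunc_linear b) (et_linear i).
- exact: lin_comp (et_linear i) (etrunc_linear _).
move=> s; apply/malgP => t; rewrite coef_etrunc etruncU.
have [z|nz] := eqVneq ((@et K k i << s >>)@_t) 0.
  by rewrite z; case: ifP => _; case: ifP => _; rewrite ?z // (lin0 (et_linear i)) mcoeff0.
have E := et_supp nz; case: ifP => h; case: ifP => h' //; first by lia.
  by lia.
by rewrite (lin0 (et_linear i)) mcoeff0.
Qed.

End Energy.

Lemma le_energy (X : semimon) p : p \in X -> `|p| <= energy X.
Proof.
by move=> pX; rewrite /energy (big_fsetD1 _ pX) /= lerDl sumr_ge0.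
Qed.

Lemma le_tenergy k (t : {ffun 'I_k -> semimon}) a p : p \in t a -> `|p| <= tenergy t.
Proof.
move=> /le_energy pt; rewrite /tenergy (bigD1 a) //=; apply: le_trans pt _.
by rewrite lerDl sumr_ge0 // => b _; apply: sumr_ge0.
Qed.

(** Each position that differs from the sea contributes its absolute value, so all differences lie
    in a finite interval. *)
Lemma finite_tenergy k (b : int) :
  exists S : seq {ffun 'I_k -> semimon}, forall t, tenergy t <= b -> t \in S.
Proof.
pose I : {fset int} := fset_set [set i | - b <= i /\ i <= b]%classic.
exists [seq [ffun a => val (g a)] | g : {ffun 'I_k -> fpowerset I}] => t tb.
have tI a : t a \in fpowerset I.
  rewrite fpowersetE; apply/fsubsetP => p /le_tenergy pt.
  rewrite in_fset_set; last exact: finite_int_itv.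
  by apply: mem_set; split; lia.
apply/mapP; exists [ffun a => [` tI a]%fset]; first by rewrite mem_enum.
by apply/ffunP => a; rewrite !ffunE.
Qed.

Section EnergyProjection.
Variables (C : numClosedFieldType) (k : nat).
Local Notation FT := (FockT C k).
Variable N : FT -> Prop.
Hypothesis N0 : N 0.
Hypothesis Nl : forall a u v, N u -> N v -> N (a *: u + v).

Lemma etrunc_form b (u v : FT) : form (etrunc b u) v = form u (etrunc b v).
Proof.
move: u v; apply: adjoint_basis; [exact: etrunc_linear|exact: etrunc_linear|].
move=> s t; rewrite !coef_etrunc !mcoeffU.
have [->|st] := eqVneq s t; first by case: ifP; rewrite ?conjC0 ?eqxx ?conjC1.
by case: ifP; case: ifP; rewrite ?conjC0.
Qed.

(** [u] has finite support, hence bounded energy. Projecting it to the part of [N] below that bound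
    suffices, since truncation is self-adjoint and preserves [N]. *)
Theorem energy_projection (u : FT) : (forall b n, N n -> N (etrunc b n)) ->
  exists2 n, N n & orthogonal N (u - n).
Proof.
move=> Nt; pose b := \sum_(t <- msupp u) `|tenergy t|.
have ub : etrunc b u = u.
  apply/malgP => t; rewrite coef_etrunc; case: ifP => // /negbT tb.
  apply/esym/eqP; rewrite mcoeff_eq0; apply: contra tb => tu.
  apply: le_trans (ler_norm _) _.
  by rewrite /b (big_fsetD1 _ tu) /= lerDl sumr_ge0.
have [S SP] := finite_tenergy k b.
pose N' n := N n /\ etrunc b n = n.
have [||n Nn t tS|n [Nn nb] on] := @finite_projection _ _ S N' _ _ _ u.
- by split=> //; exact: lin0 (etrunc_linear b).
- move=> a x y [Nx xb] [Ny yb]; split; first exact: Nl.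
  by rewrite etrunc_linear xb yb.
- case: Nn => _ <-; rewrite coef_etrunc; case: ifP => // /SP tS'.
  by rewrite tS' in tS.
exists n => // n' Nn'.
have unb : etrunc b (u - n) = u - n by rewrite (linB (etrunc_linear b)) ub nb.
rewrite -unb etrunc_form; apply: on; split; first exact: Nt.
by apply/malgP => t; rewrite !coef_etrunc; case: (_ <= b).
Qed.

Lemma cyc_etrunc S w u b : (forall i n, N n -> N (et i n)) ->
  (forall b, N (etrunc b w)) -> cyc (@et C k) S w u -> N (etrunc b u).
Proof.
move=> Ne Nw h; elim: h b => [|i {}u _ _ IH|a u1 u2 _ h1 _ h2] b.
- exact: Nw.
- by rewrite etrunc_et; apply: Ne.
- by rewrite etrunc_linear; apply: Nl.
Qed.

End EnergyProjection.

(** * Cyclic modules generated by pairs *)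

Section CyclicPairs.
Variables (K : numFieldType) (U W : lmodType K).
Variables (E : int -> U -> U) (F : int -> W -> W).

Lemma cyc_map (T : U -> W) S w u : linear T -> (forall i v, T (E i v) = F i (T v)) ->
  cyc E S w u -> cyc F S (T w) (T u).
Proof.
move=> Tl TE; elim=> [|i {}u Si _ IH|a u1 u2 _ h1 _ h2].
- exact: cyc_base.
- by rewrite TE; apply: cyc_op.
- by rewrite Tl; apply: cyc_lin.
Qed.

Definition pairop (i : int) (p : U * W) : U * W := (E i p.1, F i p.2).

Hypotheses (El : forall i, linear (E i)) (Fl : forall i, linear (F i)).
Hypothesis EC : forall i j u, E i (E j u) = E j (E i u).
Hypothesis FC : forall i j u, F i (F j u) = F j (F i u).

Lemma pairop_linear i : linear (pairop i).
Proof. by move=> a [u v] [u' v']; rewrite /pairop /= El Fl. Qed.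

Lemma pairopC i j p : pairop i (pairop j p) = pairop j (pairop i p).
Proof. by rewrite /pairop /= EC FC. Qed.

Lemma fst_linear : linear (@fst U W). Proof. by []. Qed.
Lemma snd_linear : linear (@snd U W). Proof. by []. Qed.

Lemma act_pairop top P u v :
  act (fun j : nat => pairop (top + j%:Z)) P (u, v) =
  (act (fun j : nat => E (top + j%:Z)) P u, act (fun j : nat => F (top + j%:Z)) P v).
Proof.
rewrite [LHS]surjective_pairing; congr (_, _).
- by apply: (act_comm (E' := fun j : nat => E (top + j%:Z)) fst_linear).
- by apply: (act_comm (E' := fun j : nat => F (top + j%:Z)) snd_linear).
Qed.

Lemma cyc_liftl S w w' u : cyc E S w u -> exists v, cyc pairop S (w, w') (u, v).
Proof.
elim=> [|i {}u Si _ [v h]|a u1 u2 _ [v1 h1] _ [v2 h2]].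
- by exists w'; exact: cyc_base.
- by exists (F i v); apply: (cyc_op Si h).
- by exists (a *: v1 + v2); apply: (cyc_lin a h1 h2).
Qed.

Lemma cyc_liftr S w w' v : cyc F S w' v -> exists u, cyc pairop S (w, w') (u, v).
Proof.
elim=> [|i {}v Si _ [u h]|a v1 v2 _ [u1 h1] _ [u2 h2]].
- by exists w; exact: cyc_base.
- by exists (E i u); apply: (cyc_op Si h).
- by exists (a *: u1 + u2); apply: (cyc_lin a h1 h2).
Qed.

End CyclicPairs.

(** * The relations of the quotient module *)

Lemma csum_lo a b c i : (forall j, (j < a)%N -> c j = 0%N) ->
  (forall j, (a <= j < b)%N -> c j = 1%N) -> (i <= b)%N -> csum c i = (i - a)%N.
Proof.
move=> c_lo c_mid; elim: i => [|i IH] ib; first by rewrite /csum big_ord0.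
rewrite csumS IH; last exact: ltnW.
have [ia|ai] := ltnP i a; first by rewrite (c_lo i ia); lia.
by rewrite (c_mid i) ?ai //; lia.
Qed.

Section Split.
Variables (K : numFieldType) (a b k : nat) (c : nat -> nat).
Hypotheses (a0 : (0 < a)%N) (ab : (a <= b)%N) (bk : (b < k)%N).
Hypothesis cn : nondecr k c.
Hypothesis c_lo : forall i, (i < a)%N -> c i = 0%N.
Hypothesis c_mid : forall i, (a <= i < b)%N -> c i = 1%N.
Hypothesis c_hi : (2 <= c b)%N.

(* The sequence of the quotient module, lowered at [b] and raised at [a - 1]. *)
Definition ctail (i : nat) : nat := (c i + (i.+1 == a) - (i == b))%N.

(** Only the sums with a <= i <= b change, each growing by one; the additive form avoids truncated
    subtraction. *)
Lemma csum_ctail i : (csum ctail i + (b < i) = csum c i + (a <= i))%N.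
Proof.
elim: i => [|i IH]; first by rewrite /csum !big_ord0; lia.
rewrite !csumS; have -> : ctail i = (c i + (i.+1 == a) - (i == b))%N by [].
case: (i =P b) => [ib|ib]; first by rewrite ib in IH *; lia.
lia.
Qed.

Lemma ctail_nondecr : nondecr k ctail.
Proof.
move=> i j ij jk; have := cn ij jk; have := @cn b j; have := c_hi; move: ij jk.
have := @c_lo i; have := @c_mid i; have := @c_lo j; have := @c_mid j.
by rewrite /ctail; case: (eqVneq j b) => [->|?]; case: (eqVneq i b) => [->|?]; lia.
Qed.

Lemma crel_ctail (P : cpoly K) : ideal (crel k c) P -> ideal (crel k ctail) P.
Proof.
apply: ideal_le; first exact: ideal_is_ideal.
move=> g [i [n [i0 ikn ->]]]; apply: ideal_gen1; exists i, n; split=> //.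
by have := csum_ctail i; move: ikn; lia.
Qed.

Lemma crel_ctail_lead : ideal (crel k ctail) (ccoef K a 0).
Proof.
apply: ideal_gen1; exists a, 0%N; split=> //.
by have := csum_ctail a; lia.
Qed.

(** The new relations are the coefficients of z^(i-a) in e(z)^i for a <= i <= b, because the entries
    below b are zeros and ones; by [ccoef_cvar0] each is a multiple of x_0^a. *)
Lemma crel_ctail_gen (P : cpoly K) : ideal (crel k ctail) P ->
  ideal (fun g => crel k c g \/ g = ccoef K a 0) P.
Proof.
apply: ideal_le; first exact: ideal_is_ideal.
move=> g [i [n [i0 ikn ->]]].
have [h|h] := boolP ((i <= k) && (n < csum c i) || (i == k.+1))%N.
  by apply: ideal_gen1; left; exists i, n.
have [|q ->] := @ccoef_cvar0 K a i n; last by apply: ideal_gen; right.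
have := csum_ctail i; have [ib|bi] := leqP i b; last by lia.
by have := csum_lo c_lo c_mid ib; lia.
Qed.

End Split.

(** * The decomposition *)

Section Decomposition.
Variables (C : numClosedFieldType) (k : nat) (t0 : int) (a : nat).
Variables (c c1 : nat -> nat) (p : {perm 'I_k}).
Local Notation FT := (FockT C k).
Local Notation E := (@et C k).
Hypothesis cn : nondecr k c.
Hypothesis c1n : nondecr k c1.
Hypotheses (a0 : (0 < a)%N) (ak : (a <= k)%N).
Hypothesis c_lo : forall i, (i < a)%N -> c i = 0%N.
Hypothesis c_next : (a < k)%N -> c a != 0%N.
Hypothesis c1p : forall i : 'I_k, c1 (p i) = raise2 a c i.

Let k0 : (0 < k)%N. Proof. exact: leq_trans ak. Qed.
Let El := @et_linear C k.
Let EC := @etC C k.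
Let om s : FT := wseq C k t0 c s.
Let om' s : FT := wtop C k (seqtop t0 s) (raise2 a c).
Let actE s P (u : FT) := act (fun j : nat => E (seqtop t0 s + j%:Z)) P u.
(** The raised sequence need not be nondecreasing; [p] sorts it into [c1], so that the kernel is a
    module of the same kind. *)
Let iota : FT -> FT := ptens p.

Let om'E s : iota (wseq C k t0 c1 s) = om' s.
Proof. by apply: ptens_tvec => i; rewrite c1p. Qed.

Let csum_a : csum c a = 0%N.
Proof. by rewrite /csum big1 // => i _; rewrite c_lo. Qed.

Let lead s : exists2 x : C, x != 0 & actE s (ccoef C a 0) (om s) = x *: om' s.
Proof.
exists (a`!%:R * \prod_(i < a) wsign C (seqtop t0 s) (c i)).
  rewrite mulf_neq0 ?pnatr_eq0 -?lt0n ?fact_gt0 // prodf_seq_neq0; apply/allP => i _ /=.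
  by rewrite /wsign /psign; case: ifP; rewrite ?oppr_eq0 oner_eq0.
have aak : (0 < a <= k)%N by rewrite a0.
have cc : (a < k)%N -> (c a.-1 < c a)%N.
  by move=> /c_next; rewrite (c_lo (i := a.-1)) ?lt0n // prednK.
by have := lead_wtop C (seqtop t0 s) cn aak cc; rewrite csum_a.
Qed.

Let cyc_actE s P u : cyc E xpredT u (actE s P u).
Proof. by apply: (@cyc_act C FT E El EC xpredT u 0 0 P (seqtop t0 s)); left. Qed.

Let cyc_om' s : cyc E xpredT (om s) (om' s).
Proof.
have [x x0 h] := lead s; rewrite -[om' s](scalerK x0) -h; apply: cycZ.
exact: cyc_actE.
Qed.

Let iota_linear : linear iota. Proof. exact: ptens_linear. Qed.

Let cyc_iota s y : cyc E xpredT (wseq C k t0 c1 s) y -> cyc E xpredT (om' s) (iota y).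
Proof. by move=> h; rewrite -om'E; apply: cyc_map h => // i v; exact: ptens_et. Qed.

Let iota_cyc s u : cyc E xpredT (om' s) u -> exists2 y, wspan t0 c1 y & u = iota y.
Proof.
have iK v : iota (ptens p^-1%g v) = v by have := ptensK p^-1%g v; rewrite invgK.
move=> h; exists (ptens p^-1%g u); last by rewrite iK.
exists s; have <- : ptens p^-1%g (om' s) = wseq C k t0 c1 s by rewrite -om'E ptensK.
by apply: cyc_map h; [exact: ptens_linear | move=> i v; exact: ptens_et].
Qed.

Let iota_in y : wspan t0 c1 y -> wspan t0 c (iota y).
Proof. by case=> s /cyc_iota h; exists s; apply: cyc_trans h; exact: cyc_om'. Qed.

Let iota_inj y : iota y = 0 -> y = 0.
Proof. by move=> y0; rewrite -[y](ptensK p) -/iota y0 (lin0 (ptens_linear _)). Qed.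

Let c_module := wmod_module C t0 cn k0.
Let c1_module := wmod_module C t0 c1n k0.

(** The entries add up to k - a, so by [ccoef_cvar0] the coefficient that takes w_(s+1) to a
    multiple of w_s is divisible by x_0^a. *)
Lemma wmod_iso_onto : (forall i, (a <= i < k)%N -> c i = 1%N) ->
  module_iso (wmod C k t0 c) (wmod C k t0 c1).
Proof.
move=> c_hi; suff onto u : wspan t0 c u -> exists2 y, wspan t0 c1 y & u = iota y.
  exact: (@module_iso_onto C (wmod C k t0 c) (wmod C k t0 c1) iota c_module c1_module
    iota_linear iota_in (ptens_act p) onto iota_inj).
case=> s h; apply: (@iota_cyc s.+1); apply: cyc_trans h.
have ck := csum_lo c_lo c_hi (leqnn k).
have [|q qE] := @ccoef_cvar0 C a k (csum c k); first by lia.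
have [x x0 hx] := lead s.+1.
have qM : actE s.+1 (q * ccoef C a 0) (om s.+1) = actE s.+1 q (actE s.+1 (ccoef C a 0) (om s.+1)).
  by apply: actM => [j|i j v]; [exact: El | exact: EC].
have := wseq_step C t0 cn k0 s; rewrite qE => hs.
have -> : wseq C k t0 c s = (wscal C k t0 c s)^-1 *: actE s.+1 q (x *: om' s.+1).
  by rewrite -hx -qM [actE _ _ _]hs scalerK ?wscal_neq0.
apply/cycZ/(cyc_trans _ (cyc_actE _ _ _))/cycZ/cyc_base.
Qed.

Variable b : nat.
Hypotheses (ab : (a <= b)%N) (bk : (b < k)%N).
Hypothesis c_mid : forall i, (a <= i < b)%N -> c i = 1%N.
Hypothesis c_hi : (2 <= c b)%N.

Let c2 := ctail a b c.
Let c2n : nondecr k c2. Proof. exact: (ctail_nondecr a0 ab bk cn c_lo c_mid c_hi). Qed.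
Let c2_module := wmod_module C t0 c2n k0.
Let om2 s : FT := wseq C k t0 c2 s.

(** The steps of the two chains have different scalars; this factor gives the pairs [pom] a step
    with one common scalar. *)
Let ratio s : C := \prod_(i < s) (wscal C k t0 c i / wscal C k t0 c2 i).

Let ratio_neq0 s : ratio s != 0.
Proof.
rewrite prodf_seq_neq0; apply/allP => i _ /=.
by rewrite mulf_neq0 ?invr_eq0 ?wscal_neq0.
Qed.

Let PE := pairop E E.
Let PEl i : linear (PE i) := pairop_linear El El i.
Let PEC i j q : PE i (PE j q) = PE j (PE i q) := pairopC EC EC i j q.
Let pom s : FT * FT := (om s, ratio s *: om2 s).
Let actP s P (q : FT * FT) := act (fun j : nat => PE (seqtop t0 s + j%:Z)) P q.

Let actPE s P u v : actP s P (u, v) = (actE s P u, actE s P v).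
Proof. exact: act_pairop. Qed.

Let actEl s P : linear (actE s P).
Proof. exact: act_is_linear. Qed.

Let graph u v := seqspan PE pom (u, v).

Let pom_annih s P : ideal (crel k c) P -> actP s P (pom s) = 0.
Proof.
move=> iP; rewrite actPE; congr (_, _); first exact: wseq_annih.
rewrite (linZ (actEl s P)) (_ : actE s P (om2 s) = 0) ?scaler0 //.
exact/(wseq_annih _ c2n)/(crel_ctail a0 ab bk c_hi).
Qed.

Let csum_c2 : csum c2 k = csum c k.
Proof. by have := csum_ctail a0 ab bk c_hi k; rewrite bk ak => /addIn. Qed.

Let pom_step s : actP s.+1 (ccoef C k (csum c k)) (pom s.+1) = wscal C k t0 c s *: pom s.
Proof.
rewrite actPE; congr (_, _); first exact: wseq_step.
rewrite (linZ (actEl _ _)) -csum_c2 [actE _ _ _](wseq_step C t0 c2n k0) !scalerA.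
congr (_ *: _); rewrite /ratio big_ord_recr /= -mulrA divfK ?wscal_neq0 //; exact: mulrC.
Qed.

Let wn s : wscal C k t0 c s != 0 := wscal_neq0 C k t0 c s.

Let graph_lin x u v y z : graph u y -> graph v z -> graph (x *: u + v) (x *: y + z).
Proof. exact: (seqspan_lin PEl PEC k0 pom_annih wn pom_step x (u := (u, y)) (v := (v, z))). Qed.

Let graph_f j u y : graph u y -> graph (ft j u) (ft j y).
Proof.
pose m (d : nat -> nat) := (\max_(i < k) d i)%N.
have mP d i : (i < k)%N -> (d i <= m d)%N.
  by move=> ik; exact: (@leq_bigmax _ (fun i : 'I_k => d i) (Ordinal ik)).
pose PF j (q : FT * FT) := (ft j q.1, ft j q.2).
pose PH j (q : FT * FT) := (ht j q.1, ht j q.2).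
suff main q : seqspan PE pom q -> seqspan PE pom (PF j q) by exact: (main (u, y)).
apply: (seqspan_f PEl PEC k0 pom_annih wn pom_step (f := PF) (h := PH)
  (fb := 1 - t0 - (m c + m c2)%N%:Z)).
- by move=> i r [v v'] [w w']; rewrite /PF /= !ft_linear.
- by move=> i r [v v'] [w w']; rewrite /PH /= !ht_linear.
- by move=> i l [v v'] il; rewrite /PF /PE /pairop /= !ft_et.
- by move=> i l [v v']; rewrite /PH /PE /pairop /= !ht_et.
- move=> s i h; rewrite /PF /= (linZ (ft_linear i)) (@wseq_ft _ _ _ _ (m c)); first last.
  + by move: h; lia.
  + exact: mP.
  rewrite (@wseq_ft _ _ _ _ (m c2)) ?scaler0 //; first exact: mP.
  by move: h; lia.
- by move=> s i h; rewrite /PH /= (linZ (ht_linear i)) !wseq_ht ?scaler0.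
Qed.

Let graph_act x u y : graph u y -> graph (FockT_act x u) (FockT_act x y).
Proof.
apply: FockT_act_closed2.
- by move=> *; exact: graph_lin.
- exact: seqspan0.
- by move=> i v v' h; exact: (seqspan_op i h).
- by move=> *; exact: graph_f.
Qed.

Let graph_in u y : graph u y -> wspan t0 c u /\ wspan t0 c2 y.
Proof.
case=> s h; split.
  by exists s; apply: (cyc_map (@fst_linear _ _ _) _ h).
exists s; apply: cyc_trans (cyc_map (@snd_linear _ _ _) _ h) => //.
exact/cycZ/cyc_base.
Qed.

Let graph_total u : wspan t0 c u -> exists y, graph u y.
Proof.
case=> s h; have [y hy] := cyc_liftl E (ratio s *: om2 s) h.
by exists y, s.
Qed.

Let graph_onto y : wspan t0 c2 y -> exists u, graph u y.
Proof.
case=> s h; have h' : cyc E xpredT (ratio s *: om2 s) y.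
  apply: cyc_trans h; have := cycZ (ratio s)^-1 (cyc_base E xpredT (ratio s *: om2 s)).
  by rewrite scalerK.
by have [u hu] := cyc_liftr E (om s) h'; exists u, s.
Qed.

(** One polynomial produces both components, which turns statements about the graph into statements
    about ideals. *)
Let graph_poly u y : graph u y -> exists s (P : cpoly C),
  u = actE s P (om s) /\ y = ratio s *: actE s P (om2 s).
Proof.
case=> s h; have [|P hP] := act_of_cyc PEl PEC (top := seqtop t0 s) _ h.
  by move=> i it; rewrite /PE /pairop /= (linZ (El i)) !wseq_et ?scaler0.
exists s, P; move: hP; rewrite -/(actP s P (pom s)) actPE (linZ (actEl s P)).
by case.
Qed.

Let graph_fun y : graph 0 y -> y = 0.
Proof.
case/graph_poly => s [P [/esym P0 ->]].
have iP := crel_ctail a0 ab bk c_hi (wtop_annih cn P0).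
by rewrite [actE s P _](wseq_annih t0 c2n _ iP) scaler0.
Qed.

(** A polynomial that kills the second component is a multiple of x_0^a plus a relation of [c], so
    it sends w_s into the module generated by [om' s]. *)
Let graph_ker u : graph u 0 -> exists2 y, wspan t0 c1 y & u = iota y.
Proof.
case/graph_poly => s [P [-> /esym/eqP]]; rewrite scaler_eq0 (negbTE (ratio_neq0 s)) /= => /eqP P0.
have := crel_ctail_gen a0 ab bk c_lo c_mid c_hi (wtop_annih c2n P0).
case/ideal_addgen => q [Q [iQ ->]]; apply: (@iota_cyc s).
have [x x0 hx] := lead s.
have qM : actE s (q * ccoef C a 0) (om s) = actE s q (actE s (ccoef C a 0) (om s)).
  by apply: actM => [j|i j v]; [exact: El | exact: EC].
have -> : actE s (q * ccoef C a 0 + Q) (om s) = actE s q (x *: om' s).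
  rewrite /actE (linD (act_is_linearl _ _)) -!/(actE s _ _) qM hx.
  by rewrite [actE s Q _](wseq_annih t0 cn _ iQ) addr0.
exact/(cyc_trans _ (cyc_actE _ _ _))/cycZ/cyc_base.
Qed.

(** x_0^a is a relation of [c2], so applied to a generating pair it gives a nonzero multiple of
    ([om' s], 0). *)
Let graph_iota y : wspan t0 c1 y -> graph (iota y) 0.
Proof.
case=> s /cyc_iota h; exists s.
have Tl : linear (fun u : FT => (u, 0 : FT)).
  move=> r u v; have z : r *: (0 : FT) + 0 = 0 by rewrite scaler0 addr0.
  exact: (congr1 (pair (r *: u + v)) (esym z)).
have TE i (u : FT) : (E i u, 0 : FT) = PE i (u, 0 : FT).
  by rewrite /PE /pairop /= (lin0 (El i)).
apply: cyc_trans (cyc_map Tl TE h).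
have [x x0 hx] := lead s.
have -> : (om' s, 0 : FT) = x^-1 *: actP s (ccoef C a 0) (pom s).
  rewrite actPE hx (linZ (actEl _ _)) [actE s _ (om2 s)](wseq_annih _ c2n).
    by congr (_, _); rewrite ?scalerK ?scaler0.
  exact: (crel_ctail_lead C a0 ab bk c_hi).
apply: cycZ; apply: (@cyc_act C _ PE PEl PEC xpredT (pom s) 0 0 _ (seqtop t0 s)); by left.
Qed.

Let N u := exists2 y, wspan t0 c1 y & u = iota y.

Let N_lin x u v : N u -> N v -> N (x *: u + v).
Proof.
case=> y hy -> [z hz ->]; exists (x *: y + z); last by rewrite iota_linear.
exact: wspan_lin.
Qed.

Let N_0 : N 0.
Proof. by exists 0; [exact: seqspan0 | rewrite (lin0 iota_linear)]. Qed.

Let N_et i u : N u -> N (E i u).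
Proof.
case=> y hy ->; exists (E i y); first exact: seqspan_op.
by rewrite [RHS]ptens_et.
Qed.

(** The generator [om' s] is a single monomial, so truncation keeps it or kills it. *)
Let N_etrunc d u : N u -> N (etrunc d u).
Proof.
case=> y [s /cyc_iota h] ->.
apply: (cyc_etrunc N_lin d N_et _ h) => d'; rewrite /om' /wtop /tvec etruncU.
case: ifP => _; last exact: N_0.
by apply: (@iota_cyc s); exact: cyc_base.
Qed.

Let orth := orthogonal N.

Theorem wmod_iso_dsum :
  module_iso (wmod C k t0 c) (dsum (wmod C k t0 c1) (wmod C k t0 c2)).
Proof.
have orth_act x u : orth u -> orth (FockT_act x u).
  apply: orthogonal_act => y n [z hz ->]; exists (FockT_act y z); first exact: wspan_act.
  by rewrite [RHS]ptens_act.
have orth_iota y : wspan t0 c1 y -> orth (iota y) -> y = 0.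
  by move=> hy oy; apply/iota_inj/form_eq0/oy; exists y.
have orth_proj u : wspan t0 c u -> exists2 y, wspan t0 c1 y & orth (u - iota y).
  move=> _; have [n [y hy ->] on] := energy_projection N_0 N_lin u N_etrunc.
  by exists y.
exact: (@module_iso_split C (wmod C k t0 c) (wmod C k t0 c1) (wmod C k t0 c2) iota orth graph
  c_module c1_module c2_module iota_linear iota_in (ptens_act p) (@orthogonal_lin _ _ N)
  orth_act orth_iota orth_proj graph_in graph_lin graph_act graph_total graph_onto
  graph_fun graph_ker graph_iota).
Qed.

End Decomposition.

(** * The sequences attached to D *)

Section BetaLemmas.
Variable k : nat.
Implicit Types D : k.+1.-tuple nat.

Lemma betaS D i : (i <= k)%N -> beta D i = (entry D i.+1 + beta D i.+1)%N.
Proof. by move=> ik; rewrite /beta big_ltn. Qed.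

Lemma beta_last D : beta D k.+1 = 0%N.
Proof. by rewrite /beta big_geq. Qed.

Lemma entry_of d i : (0 < i <= k.+1)%N -> entry (of_entries k d) i = d i.
Proof.
case: i => // i /= ik; rewrite /entry /of_entries /=.
by have := tnth_nth 0%N [tuple d j.+1 | j < k.+1] (Ordinal ik); rewrite tnth_mktuple.
Qed.

Lemma down_ind (P : nat -> Prop) : P k.+1 -> (forall i, (i <= k)%N -> P i.+1 -> P i) ->
  forall i, (i <= k.+1)%N -> P i.
Proof.
move=> Pk PS i ik; rewrite -(subKn ik); elim: (k.+1 - i)%N (leq_subr i k.+1) => [|n IH] nk.
  by rewrite subn0.
by apply: PS; [lia | rewrite -subSn //; apply: IH; exact: ltnW].
Qed.

Lemma beta_mono D i j : (i <= j)%N -> (j <= k.+1)%N -> (beta D j <= beta D i)%N.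
Proof.
elim: j => [|j IH] ij jk; first by have -> : i = 0%N by lia.
have [->//|ne] := eqVneq i j.+1; have := IH _ (ltnW jk); rewrite (@betaS D j) //; lia.
Qed.

Lemma beta_const D i j : (i <= j)%N -> (j <= k.+1)%N ->
  (forall t, (i < t <= j)%N -> entry D t = 0%N) -> beta D j = beta D i.
Proof.
elim: j => [|j IH] ij jk d0; first by have -> : i = 0%N by lia.
have [->//|ne] := eqVneq i j.+1; rewrite -IH; try by lia.
  by rewrite [RHS](@betaS D j) // d0 //; lia.
by move=> t tj; apply: d0; lia.
Qed.

(** The same n, that of D, is used for the summand D', so that both modules start from the same
    [t0]. *)
Definition gap (n : nat) D (i : nat) : nat := (n - beta D i.+1)%N.

Lemma gap_nondecr n D : nondecr k (gap n D).
Proof. by move=> i j ij jk; rewrite /gap; have := @beta_mono D i.+1 j.+1; lia. Qed.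

(* Sorts the sequence with [m] twos followed by [n] ones. *)
Definition block_swap (m n i : nat) : nat :=
  if (i < m)%N then (i + n)%N else if (i < m + n)%N then (i - m)%N else i.

Lemma block_swap_perm m n : (m + n <= k)%N ->
  exists p : {perm 'I_k}, forall i : 'I_k, p i = block_swap m n i :> nat.
Proof.
move=> mnk.
have lt (i : 'I_k) : (block_swap m n i < k)%N.
  by have := ltn_ord i; rewrite /block_swap; case: (ltnP i m) => ?; [lia|case: (ltnP i (m + n)%N) => ?; lia].
have inj : injective (fun i : 'I_k => Ordinal (lt i)).
  move=> i j [] E; apply: val_inj => /=; move: E; rewrite /block_swap.
  by case: (ltnP i m) => ?; case: (ltnP j m) => ?; case: (ltnP i (m + n)%N) => ?;
    case: (ltnP j (m + n)%N) => ?; lia.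
by exists (perm inj) => i; rewrite permE.
Qed.

End BetaLemmas.

Section Entries.
Variables (k : nat) (D : k.+1.-tuple nat).

Lemma beta_Da' l i : (0 < l <= k)%N -> (2 <= entry D l)%N -> (i <= k.+1)%N ->
  (beta (Da' D l) i + 2 * (i < l) = beta D i)%N.
Proof.
move=> lk dl; move: i; apply: down_ind; first by rewrite !beta_last; lia.
move=> i ik; rewrite !(@betaS _ _ i) // entry_of; last by lia.
by case: (i.+1 =P l) => [E|E]; rewrite ?E; lia.
Qed.

(** When l = k and d_(k+1) = 1, the last entry becomes 0 instead of 2, which lowers all tail sums up
    to index k by 2. *)
Lemma beta_Da'' l i : (1 < l <= k)%N -> (2 <= entry D l)%N -> (entry D k.+1 <= 1)%N ->
  (i <= k.+1)%N ->
  (beta (Da'' D l) i + 2 * ((l == k) && (i <= k)) * entry D k.+1 + (i.+1 == l)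
   = beta D i + (i == l))%N.
Proof.
move=> lk dl dk; move: i; apply: down_ind; first by rewrite !beta_last; lia.
move=> i ik; rewrite !(@betaS _ _ i) // entry_of; last by lia.
rewrite /succ_entry.
case: (i.+1 =P l.-1) => [E1|E1]; first by rewrite -E1; lia.
case: (i.+1 =P l) => [E|E]; first by rewrite ?E; lia.
case: (i.+1 =P l.+1) => [[E2]|E2]; last by lia.
by rewrite -E2; case: (i =P k) => [->|ne]; lia.
Qed.

Lemma beta_Db' l l1 i : (1 < l)%N -> (l < l1 <= k.+1)%N -> entry D l = 1%N ->
  entry D l1 <> 0%N -> (i <= k.+1)%N ->
  (beta (Db' D l l1) i + (i < l) + (i < l1) = beta D i + (i < l1 - l + 1))%N.
Proof.
move=> l2 ll1 dl dl1; move: i; apply: down_ind; first by rewrite !beta_last; lia.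
move=> i ik; rewrite !(@betaS _ _ i) // entry_of; last by lia.
by case: (i.+1 =P l) => [E|E]; case: (i.+1 =P l1) => [E1|E1]; rewrite ?E ?E1; lia.
Qed.

Lemma beta_Db'' l l1 i : (1 < l)%N -> (l < l1 <= k)%N -> entry D l = 1%N ->
  entry D l1 <> 0%N -> (entry D k.+1 <= 1)%N -> (i <= k.+1)%N ->
  (beta (Db'' D l l1) i + 2 * ((l1 == k) && (i <= k)) * entry D k.+1 + (i.+1 == l)
   = beta D i + (i == l1))%N.
Proof.
move=> l2 ll1 dl dl1 dk; move: i; apply: down_ind; first by rewrite !beta_last; lia.
move=> i ik; rewrite !(@betaS _ _ i) // entry_of; last by lia.
rewrite /succ_entry.
case: (i.+1 =P l.-1) => [E1|E1]; first by rewrite -E1; lia.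
case: (i.+1 =P l) => [E|E]; first by rewrite E; lia.
case: (i.+1 =P l1) => [E2|E2]; first by rewrite E2; lia.
case: (i.+1 =P l1.+1) => [[E3]|E3]; last by lia.
by rewrite -E3; case: (i =P k) => [->|ne]; lia.
Qed.

End Entries.

(** * The decompositions of L^D *)

Section Corollary.
Variables (C : numClosedFieldType) (k : nat) (D : k.+1.-tuple nat) (l : nat).
Hypothesis k0 : (0 < k)%N.
Hypothesis dk : (entry D k.+1 <= 1)%N.
Hypothesis lk : (1 < l <= k)%N.
Hypothesis d_lo : forall i, (0 < i < l)%N -> entry D i = 0%N.
Hypothesis dl0 : (0 < entry D l)%N.

Let n := beta D 1.
Let t0 : int := 1 - n%:Z.

Lemma LD_gap (D' : k.+1.-tuple nat) : (forall i, (0 < i <= k)%N -> beta D' i <= n)%N ->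
  LD C D' = wmod C k t0 (gap n D').
Proof.
move=> h; apply: (@LD_wmod0 C k D' t0 (gap n D') k0 (@gap_nondecr k n D')) => i ik.
by have := h i.+1 ik; rewrite /gap /t0; lia.
Qed.

Let le_n i : (0 < i <= k)%N -> (beta D i <= n)%N.
Proof. by move=> ik; apply: beta_mono; lia. Qed.

Let beta_lo i : (0 < i < l)%N -> beta D i = n.
Proof. by move=> il; apply: beta_const; try lia; move=> t ti; apply: d_lo; lia. Qed.

Let beta_l : (beta D l + entry D l = n)%N.
Proof. have := @beta_lo l.-1; rewrite (@betaS _ _ l.-1) ?prednK; lia. Qed.

(** The entries before d_l vanish, so beta_1, ..., beta_(l-1) agree and the sequence starts with
    exactly l - 1 zeros. *)
Let a := l.-1.
Let gap_lo i : (i < a)%N -> gap n D i = 0%N.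
Proof. by rewrite /a => ia; rewrite /gap beta_lo ?subnn //; lia. Qed.

Let gap_next : (a < k)%N -> gap n D a != 0%N.
Proof. by move=> _; rewrite /gap /a prednK; lia. Qed.

(** The first nonzero entry is already at least 2, so b = a with no ones in between, and the raised
    sequence is sorted: the permutation is trivial. *)
Lemma LD_split_a : (2 <= entry D l)%N ->
  module_iso (LD C D) (dsum (LD C (Da' D l)) (LD C (Da'' D l))).
Proof.
have l0k : (0 < l <= k)%N by lia.
move=> dl; have b' i := @beta_Da' _ D l i l0k dl; have b'' i := @beta_Da'' _ D l i lk dl dk.
have gap_a : (2 <= gap n D a)%N by rewrite /gap /a prednK; lia.
have mid i : (a <= i < a)%N -> gap n D i = 1%N by lia.
have a0 : (0 < a)%N by rewrite /a; lia.
have ak : (a < k)%N by rewrite /a; lia.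
have c2n := ctail_nondecr a0 (leqnn a) ak (@gap_nondecr k n D) gap_lo mid gap_a.
rewrite (LD_gap le_n) (@LD_gap (Da' D l)); last first.
  by move=> i ik; have := b' i; have := le_n ik; lia.
(* The even shift makes up for d_(k+1) + 1 = 2 being reduced to 0; it is nonzero only when l = k and
   d_(k+1) = 1. *)
rewrite (@LD_wmod C k (Da'' D l) t0 _ ((l == k) * entry D k.+1)%N k0 c2n); last first.
  move=> i ik; have := b'' i.+1; have := le_n (i := i.+1); have := gap_lo (i := i).
  have : i = l.-1 -> (2 <= gap n D i)%N by move=> ->.
  have := @beta_lo i.+1; have := beta_l; rewrite /ctail /gap /t0 /a ik andbT.
  by case: (l == k); rewrite ?muln0 ?muln1 ?mul0n ?mul1n; lia.
suff c1p (i : 'I_k) : gap n (Da' D l) ((1%g : {perm 'I_k}) i) = raise2 a (gap n D) i.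
  exact: (wmod_iso_dsum C t0 (@gap_nondecr k n D) (@gap_nondecr k n (Da' D l)) a0
    (ltnW ak) gap_lo gap_next c1p (leqnn a) ak mid gap_a).
rewrite perm1; have := b' i.+1; have := ltn_ord i.
by have := @beta_lo i.+1; have := @le_n i.+1; rewrite /raise2 /gap /a; lia.
Qed.

(** * The case d_l = 1 *)

Section SecondEntry.
Variable l1 : nat.
Hypothesis dl : entry D l = 1%N.
Hypothesis ll1 : (l < l1 <= k.+1)%N.
Hypothesis dl1 : entry D l1 <> 0%N.
Hypothesis d_mid : forall i, (l < i < l1)%N -> entry D i = 0%N.

Let a0 : (0 < a)%N. Proof. by rewrite /a; lia. Qed.
Let ak : (a < k)%N. Proof. by rewrite /a; lia. Qed.

Let b' i := @beta_Db' _ D l l1 i (proj1 (andP lk)) ll1 dl dl1.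

Let beta_mid i : (l <= i < l1)%N -> beta D i = n.-1.
Proof.
move=> il; rewrite (@beta_const _ D l i); try lia.
by move=> t ti; apply: d_mid; lia.
Qed.

Let beta_l1 : (l1 <= k)%N -> (beta D l1 + 2 <= n)%N.
Proof.
move=> l1k; have := @beta_mid l1.-1; rewrite (@betaS _ _ l1.-1) ?prednK; lia.
Qed.

Let gap_mid i : (a <= i < l1.-1)%N -> gap n D i = 1%N.
Proof. by rewrite /a => ai; rewrite /gap beta_mid; have := beta_l; lia. Qed.

Let Db'_gap : LD C (Db' D l l1) = wmod C k t0 (gap n (Db' D l l1)).
Proof.
apply: LD_gap => i ik; have := @b' i; have := le_n ik; have := @beta_lo i; have := @beta_mid i.
have := beta_l; lia.
Qed.

Let gap' := gap n (Db' D l l1).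

Let gap'_lo i : (i < l1 - l)%N -> gap' i = 1%N.
Proof.
move=> h; rewrite /gap' /gap; have := @b' i.+1; have := beta_l.
by case: (ltnP i.+1 l) => il; [rewrite (@beta_lo i.+1) | rewrite (@beta_mid i.+1)]; lia.
Qed.

Let gap'_mid i : (l1 - l <= i < l1.-1)%N -> gap' i = 2%N.
Proof.
move=> h; rewrite /gap' /gap; have := @b' i.+1; have := beta_l.
by case: (ltnP i.+1 l) => il; [rewrite (@beta_lo i.+1) | rewrite (@beta_mid i.+1)]; lia.
Qed.

Let gap'_hi i : (l1.-1 <= i < k)%N -> gap' i = gap n D i.
Proof.
move=> h; rewrite /gap' /gap; have := @b' i.+1; lia.
Qed.

(** After raising, a twos are followed by l1 - l ones. Exchanging the two blocks puts the jump from
    1 to 2 at index l1 - l, which is why D' increases d_(l1-l+1). *)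
Let swap_gap : exists p : {perm 'I_k}, forall i : 'I_k, gap' (p i) = raise2 a (gap n D) i.
Proof.
have [|p pE] := @block_swap_perm k a (l1 - l); first by rewrite /a; lia.
exists p => i; rewrite pE /block_swap /raise2; have ik := ltn_ord i.
case: (ltnP i a) => ia.
  rewrite gap_lo //; have [h|h] := ltnP (i + (l1 - l)) l1.-1.
    by rewrite gap'_mid //; lia.
  by move: h ia; rewrite /a; lia.
have [h|h] := ltnP i (a + (l1 - l))%N.
  rewrite gap_mid; last by move: h ia; rewrite /a; lia.
  by rewrite gap'_lo //; lia.
rewrite mul0n addn0; apply: gap'_hi; move: h; rewrite /a; lia.
Qed.

(** The ones fill the indices from a to l1 - 2, so the entry to be lowered is at b = l1 - 1. *)
Lemma LD_split_b : l1 <> k.+1 ->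
  module_iso (LD C D) (dsum (LD C (Db' D l l1)) (LD C (Db'' D l l1))).
Proof.
move=> l1k; have ll1k : (l < l1 <= k)%N by lia.
have b'' i := @beta_Db'' _ D l l1 i (proj1 (andP lk)) ll1k dl dl1 dk.
have gap_b : (2 <= gap n D l1.-1)%N by rewrite /gap prednK; have := beta_l1; have := beta_l; lia.
have ab : (a <= l1.-1)%N by rewrite /a; lia.
have bk : (l1.-1 < k)%N by lia.
have c2n := ctail_nondecr a0 ab bk (@gap_nondecr k n D) gap_lo gap_mid gap_b.
rewrite (LD_gap le_n) Db'_gap.
rewrite (@LD_wmod C k (Db'' D l l1) t0 _ ((l1 == k) * entry D k.+1)%N k0 c2n); last first.
  move=> i ik; have := b'' i.+1; have := le_n (i := i.+1); have := gap_lo (i := i).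
  have : i = l1.-1 -> (2 <= gap n D i)%N by move=> ->.
  have := @beta_lo i.+1; have := beta_l; have := beta_l1; rewrite /ctail /gap /t0 /a ik andbT.
  by case: (l1 == k); rewrite ?muln0 ?muln1 ?mul0n ?mul1n; lia.
have [p pE] := swap_gap.
exact: (wmod_iso_dsum C t0 (@gap_nondecr k n D) (@gap_nondecr k n (Db' D l l1)) a0
  (ltnW ak) gap_lo gap_next pE ab bk gap_mid gap_b).
Qed.

(** The sequence consists of zeros and ones only, so there is no entry to lower and the submodule is
    everything. *)
Lemma LD_onto_b : l1 = k.+1 -> module_iso (LD C D) (LD C (Db' D l l1)).
Proof.
move=> l1k; rewrite (LD_gap le_n) Db'_gap; have [p pE] := swap_gap.
apply: (wmod_iso_onto C t0 (@gap_nondecr k n D) (@gap_nondecr k n (Db' D l l1)) a0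
  (ltnW ak) gap_lo gap_next pE) => i ik.
by apply: gap_mid; rewrite l1k.
Qed.

End SecondEntry.
End Corollary.

Theorem corollary4p1 (R : realType) (k : nat) (D : k.+1.-tuple nat) (l : nat)
  (hk : (1 <= k)%N)
  (hd1 : entry D 1 = 0%N)
  (hdk : (entry D k.+1 <= 1)%N)
  (hsum : (2 <= \sum_(2 <= i < k.+2) entry D i)%N)
  (hl : (2 <= l <= k)%N)
  (hlmin : forall i : nat, (1 <= i < l)%N -> entry D i = 0%N) :
  ((2 <= entry D l)%N ->
     module_iso (LD R[i] D) (dsum (LD R[i] (Da' D l)) (LD R[i] (Da'' D l))))
  /\
  (entry D l = 1%N ->
   forall l1 : nat,
     (l < l1 <= k.+1)%N -> entry D l1 <> 0%N ->
     (forall i : nat, (l < i < l1)%N -> entry D i = 0%N) ->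
     (l1 <> k.+1 ->
        module_iso (LD R[i] D)
          (dsum (LD R[i] (Db' D l l1)) (LD R[i] (Db'' D l l1))))
     /\
     (l1 = k.+1 ->
        module_iso (LD R[i] D) (LD R[i] (Db' D l l1)))).
Proof.
have dlo i : (0 < i < l)%N -> entry D i = 0%N by exact: hlmin.
split=> [dl|dl l1 ll1 dl1 d_mid].
  exact: (LD_split_a R[i] hk hdk hl dlo (ltnW dl) dl).
have dl0 : (0 < entry D l)%N by rewrite dl.
split=> l1k.
- exact: (LD_split_b R[i] hk hdk hl dlo dl0 dl ll1 dl1 d_mid l1k).
- exact: (LD_onto_b R[i] hk hdk hl dlo dl0 dl ll1 dl1 d_mid l1k).
Qed.
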